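(* Let $r\in\mathbb N$. There exists a constant $C_r>0$ depending only on $r$ such that the following holds. Let $n,m\in\mathbb N$, $p\in(0,1)$, let $A^{(1)},\ldots,A^{(n)}$ be the attribute vectors of the random intersection graph $\mathcal G(n,m,p)$ (see context), let $h\in L^4\big((\{0,1\}^m)^r,\mu_{m,p}^{\otimes r}\big)$ be symmetric, and let $$X=\sum_{1\le k_1<\cdots<k_r\le n}h\big(A^{(k_1)},\ldots,A^{(k_r)}\big).$$ Then, with $\mathcal N\sim\mathcal N(0,1)$, $$d_{K/W}\left(\frac{X-\mathbb E[X]}{\sqrt{\operatorname{Var}[X]}},\mathcal N\right)\le \frac{C_r n^{2r}}{\operatorname{Var}[X]}\Bigg(\sum_{0\le i<j\le r}\frac{\|\overline h_j\ast_j^i\overline h_j\|_2^2}{n^{3j-i}}+\sum_{1\le i<j\le r}\Big(\frac{\|\overline h_j\ast_i^i\overline h_j\|_2^2}{n^{2j}}+\frac{\|\overline h_j\ast_i^i\overline h_i\|_2^2}{n^{j+i}}\Big)\Bigg)^{1/2},$$ where for $1\le j\le r$, $$h_j(x_1,\ldots,x_j)=\int_{(\{0,1\}^m)^{r-j}}h(x_1,\ldots,x_r)\,d\mu_{m,p}^{\otimes(r-j)}(x_{j+1},\ldots,x_r),$$ and $\overline h_j=h_j-\int_{(\{0,1\}^m)^j}h_j\,d\mu_{m,p}^{\otimes j}$.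
   Context: Random intersection graph $\mathcal G(n,m,p)$: vertex set $\{v_1,\ldots,v_n\}$, attribute set $\{a_1,\ldots,a_m\}$; each vertex $v_k$ chooses each attribute $a_i$ independently with probability $p$, and two vertices are adjacent iff they chose at least one common attribute. $A^{(k)}=(A^{(k)}_1,\ldots,A^{(k)}_m)\in\{0,1\}^m$, where $A^{(k)}_i$ is the indicator that $v_k$ chose $a_i$; all $A^{(k)}_i$ are independent Bernoulli$(p)$, so each $A^{(k)}$ has law $\mu_{m,p}(x)=p^{|x|}(1-p)^{m-|x|}$, $|x|=\sum_i x_i$. All $L^q$ norms $\|\cdot\|_2$ are taken with respect to the appropriate product measure $\mu_{m,p}^{\otimes s}$. Contraction: for $f:(\{0,1\}^m)^k\to\mathbb R$, $g:(\{0,1\}^m)^l\to\mathbb R$ and $0\le a\le b\le k\wedge l$, $f\ast_b^a g(x_1,\ldots,x_{b-a},y_1,\ldots,y_{k-b},z_1,\ldots,z_{l-b})=\int_{(\{0,1\}^m)^a}f(w,x,y)\,g(w,x,z)\,d\mu_{m,p}^{\otimes a}(w)$, where $w=(w_1,\ldots,w_a)$. Distances: $d_K(X,Y)=\sup_t|\mathbb P(X\le t)-\mathbb P(Y\le t)|$, $d_W(X,Y)=\sup_{\mathrm{Lip}(\phi)\le1}|\mathbb E[\phi(X)-\phi(Y)]|$, and $d_{K/W}=\max\{d_K,d_W\}$. *)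

(* Defs.v *)
From HB Require Import structures.
From mathcomp Require Import all_boot all_order all_algebra all_fingroup.
From mathcomp Require Import all_classical all_reals all_analysis.
Set Implicit Arguments. Unset Strict Implicit. Unset Printing Implicit Defensive.
Import Order.TTheory GRing.Theory Num.Theory.
Local Open Scope ring_scope.
Local Open Scope classical_set_scope.

Notation attr m := {ffun 'I_m -> bool}.

Section RIG.
Variables (R : realType) (m : nat) (p : R).

Definition wt (x : attr m) : nat := \sum_(i < m) (x i : nat).

Definition mu_mp (x : attr m) : R := p ^+ wt x * (1 - p) ^+ (m - wt x).

Definition muprod s (w : {ffun 'I_s -> attr m}) : R := \prod_(i < s) mu_mp (w i).

Definition fnth s (w : {ffun 'I_s -> attr m}) (i : nat) : attr m :=
  if insub i is Some j then w j else [ffun => false].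

Definition glue3 a c d (w : {ffun 'I_a -> attr m}) (x : {ffun 'I_c -> attr m})
  (y : {ffun 'I_d -> attr m}) (i : nat) : attr m :=
  if (i < a)%N then fnth w i
  else if (i < a + c)%N then fnth x (i - a)
  else fnth y (i - a - c).

(* squared L^2(mu^{(x)(b-a+k-b+l-b)}) norm of the contraction f *_b^a g,
   with f of arity k and g of arity l:
   (f *_b^a g)(x,y,z) = \int f(w,x,y) g(w,x,z) dmu^{(x)a}(w). *)
Definition contraction k l a b (f : {ffun 'I_k -> attr m} -> R)
  (g : {ffun 'I_l -> attr m} -> R)
  (x : {ffun 'I_(b - a) -> attr m}) (y : {ffun 'I_(k - b) -> attr m})
  (z : {ffun 'I_(l - b) -> attr m}) : R :=
  \sum_(w : {ffun 'I_a -> attr m})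
     muprod w * f [ffun i : 'I_k => glue3 w x y i]
              * g [ffun i : 'I_l => glue3 w x z i].

Definition contr_norm2 k l a b (f : {ffun 'I_k -> attr m} -> R)
  (g : {ffun 'I_l -> attr m} -> R) : R :=
  \sum_(x : {ffun 'I_(b - a) -> attr m})
  \sum_(y : {ffun 'I_(k - b) -> attr m})
  \sum_(z : {ffun 'I_(l - b) -> attr m})
     muprod x * muprod y * muprod z * (contraction f g x y z) ^+ 2.

Definition hproj r (h : {ffun 'I_r -> attr m} -> R) j
  (x : {ffun 'I_j -> attr m}) : R :=
  \sum_(y : {ffun 'I_(r - j) -> attr m})
     muprod y * h [ffun i : 'I_r => glue3 x y [ffun i : 'I_0 => [ffun => false]] i].

Definition hbar r (h : {ffun 'I_r -> attr m} -> R) j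
  (x : {ffun 'I_j -> attr m}) : R :=
  hproj h x - \sum_(x' : {ffun 'I_j -> attr m}) muprod x' * hproj h x'.

Definition symmetric_fun r (h : {ffun 'I_r -> attr m} -> R) : Prop :=
  forall (s : 'S_r) (x : {ffun 'I_r -> attr m}), h [ffun i => x (s i)] = h x.

(* sample space: the attribute vectors (A^(1),...,A^(n)), law mu^{(x) n} *)
Definition Ustat n r (h : {ffun 'I_r -> attr m} -> R)
  (A : {ffun 'I_n -> attr m}) : R :=
  \sum_(k : {ffun 'I_r -> 'I_n} |
        [forall i : 'I_r, forall j : 'I_r, (i < j)%N ==> (k i < k j)%N])
     h [ffun i => A (k i)].

Definition Expect n (Y : {ffun 'I_n -> attr m} -> R) : R :=
  \sum_(A : {ffun 'I_n -> attr m}) muprod A * Y A.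

Definition Variance n (Y : {ffun 'I_n -> attr m} -> R) : R :=
  Expect (fun A => (Y A - Expect Y) ^+ 2).

Definition Prob n (E : {ffun 'I_n -> attr m} -> bool) : R :=
  \sum_(A : {ffun 'I_n -> attr m} | E A) muprod A.

Definition dK_normal n (Y : {ffun 'I_n -> attr m} -> R) : \bar R :=
  ereal_sup [set `|(Prob (fun A => Y A <= t))%:E - normal_prob 0 1 `]-oo, t]|%E
            | t in [set: R]].

Definition lipschitz1 (phi : R -> R) : Prop :=
  forall x y, `|phi x - phi y| <= `|x - y|.

Definition dW_normal n (Y : {ffun 'I_n -> attr m} -> R) : \bar R :=
  ereal_sup [set `|(Expect (fun A => phi (Y A)))%:E
                  - \int[normal_prob (0:R) 1]_x (phi x)%:E|%E
            | phi in lipschitz1].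

Definition dKW_normal n (Y : {ffun 'I_n -> attr m} -> R) : \bar R :=
  Order.max (dK_normal Y) (dW_normal Y).

End RIG.

(* Main.v *)
(* Stein's method with an exchangeable pair.  Expand Y = X - E[X] as the sum of the
   \overline h_r(A_S) over the r-subsets S, and let G be the combination of the
   \overline h_j(A_S), |S| <= r, with \sum_k (G - E_k G) = Y.  Writing D_k for the
   effect of replacing A^(k) by an independent copy,
     E[Y f(Y)] = 1/2 \sum_k E[D_k G D_k (f o Y)],
   so both distances are controlled by the fluctuations of \sum_k D_k G D_k Y and by
   \sum_(k,l) E[(D_l D_k G)^2 (D_k Y)^2] and its mirror image.  For the Kolmogorov
   distance this uses that the Stein remainder is dominated by an increment of a
   bounded monotone function, which antisymmetry turns into such sums again.
   Everything expands into moments E[\prod_(i <= 4) \overline h(A_(S_i))] in which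
   S_1 meets S_2, S_3 meets S_4, and S_1 u S_2 meets S_3 u S_4.  By Cauchy-Schwarz
   each is at most the bracketed sum times n^(\sum |S_i| - |S_1 u ... u S_4|), and the
   number of such quadruples is O(n^|S_1 u ... u S_4|). *)

Require Import Defs.
From HB Require Import structures.
From mathcomp Require Import all_boot all_order all_algebra all_fingroup.
From mathcomp Require Import all_classical all_reals all_analysis.
From mathcomp Require Import measurable_realfun ring lra zify.
Import Order.TTheory GRing.Theory Num.Theory.
Local Open Scope ring_scope.

Set Implicit Arguments.
Unset Strict Implicit.
Unset Printing Implicit Defensive.

(** The functions \overline h_j are not Hoeffding components and are not mutually orthogonal.
    Consistency takes the place of orthogonality: averaging [psi P] over the coordinates outside [Z]
    gives [psi (Z :&: P)]. Conditioning therefore shrinks the sets in a product until its integral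
    is one of the contractions in the bracket. The independent copies are built into the index set:
    a coordinate is a vertex together with a boolean, and resampling a vertex permutes coordinates.
    Iterated differences thus become signed sums of functions [psi P], where [P] lies over a set [S]
    of vertices. Such lifts can be disjoint although the sets below them meet, and then the moment
    bound loses a factor n. In that case the union of the lifts has more points than its projection,
    and this surplus pays for the loss. For Lipschitz test functions the Stein remainder is
    quadratic, which needs one more input: the sum of the E[(D_k Y)^2] is at most 2 r Var[X]. It
    follows from the same consistency, because E[[psi P] [psi Q]] is the second moment of
    [psi (P :&: Q)]. *)

Section StandardNormal.
Import numFieldNormedType.Exports.
Local Open Scope classical_set_scope.
Variable R : realType.
Implicit Types (f g : R -> R) (x y z w u v a b : R).

(** * Derivative rules and mean value bounds *)

Lemma is_derive_add f g x a b : is_derive x 1 f a -> is_derive x 1 g b ->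
  is_derive x 1 (fun y => f y + g y) (a + b).
Proof. move=> df dg; exact: is_deriveD. Qed.

Lemma is_derive_sub f g x a b : is_derive x 1 f a -> is_derive x 1 g b ->
  is_derive x 1 (fun y => f y - g y) (a - b).
Proof. move=> df dg; exact: is_deriveB. Qed.

Lemma is_derive_mul f g x a b : is_derive x 1 f a -> is_derive x 1 g b ->
  is_derive x 1 (fun y => f y * g y) (a * g x + f x * b).
Proof.
move=> df dg; apply: is_derive_eq (is_deriveM df dg) _.
by rewrite addrC /GRing.scale /= [g x * a]mulrC.
Qed.

Lemma is_derive_const c x : is_derive x 1 (fun=> c : R) 0.
Proof. exact: is_derive_cst. Qed.

Lemma is_derive_idR x : is_derive x 1 (fun y => y) 1.
Proof. exact: is_derive_id. Qed.

Lemma is_derive_inv f x a : f x != 0 -> is_derive x 1 f a ->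
  is_derive x 1 (fun y => (f y)^-1) (- (a / f x ^+ 2)).
Proof.
move=> f0 df; apply: is_derive_eq (is_deriveV f0 df) _.
by rewrite /GRing.scale /= mulNr mulrC.
Qed.

Lemma is_derive_flip f x a : is_derive (- x) 1 f a ->
  is_derive x 1 (fun y => f (- y)) (- a).
Proof.
move=> df; have dN : is_derive x 1 (fun y => - y) (-1).
  exact: is_deriveN.
have := is_derive1_comp df dN; rewrite mulrN1; exact.
Qed.

Section Slopes.
Variables (f df : R -> R) (a b : R).
Hypothesis dfx : forall x, a <= x <= b -> is_derive x 1 f (df x).

Lemma mean_value : a < b ->
  exists2 x, a < x < b & f b - f a = df x * (b - a).
Proof.
move=> ab; have cf : {within `[a, b], continuous f}.
  apply: derivable_within_continuous => x; rewrite in_itv /= => /dfx dx.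
  exact: (@ex_derive _ _ _ _ _ _ _ dx).
have dfo x : x \in `]a, b[%R -> is_derive x 1 f (df x).
  by rewrite in_itv /= => /andP[ax xb]; apply: dfx; rewrite !ltW.
by have [x] := MVT ab dfo cf; rewrite in_itv /= => abx e; exists x.
Qed.

Lemma slope_ge c : a <= b -> (forall x, a < x < b -> c <= df x) ->
  c * (b - a) <= f b - f a.
Proof.
rewrite le_eqVlt => /predU1P[->|ab] cd; first by rewrite !subrr !mulr0.
have [x /cd cx ->] := mean_value ab.
by rewrite ler_wpM2r // subr_ge0 ltW.
Qed.

Lemma slope_le c : a <= b -> (forall x, a < x < b -> df x <= c) ->
  f b - f a <= c * (b - a).
Proof.
rewrite le_eqVlt => /predU1P[->|ab] cd; first by rewrite !subrr !mulr0.
have [x /cd cx ->] := mean_value ab.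
by rewrite ler_wpM2r // subr_ge0 ltW.
Qed.

End Slopes.

(** The mean value bound gives [f n%:R <= f a] for large [n], and the left side tends to 0. The tail
    inequalities below apply this to explicit functions vanishing at infinity, which avoids
    estimating improper integrals. *)
Lemma ge0_of_decreasing f df a : (forall x, a <= x -> is_derive x 1 f (df x)) ->
  (forall x, a < x -> df x <= 0) -> f n%:R @[n --> \oo] --> 0 -> 0 <= f a.
Proof.
move=> dfx df0 f0; have <- : lim (f n%:R @[n --> \oo]) = 0.
  by apply/cvg_lim => //; exact: Rhausdorff.
apply: limr_le; first by apply/cvg_ex; exists 0.
near=> n; have an : a <= n%:R by near: n; exact: nbhs_infty_ger.
have dfx' x : a <= x <= n%:R -> is_derive x 1 f (df x) by move=> /andP[+ _]; exact: dfx.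
rewrite -subr_le0 -(mul0r (n%:R - a)); apply: slope_le => // x /andP[ax _].
exact: df0.
Unshelve. all: by end_near. Qed.

(** * The Mills ratio of an abstract Gaussian density *)

Section Mills.
Variables g Phi : R -> R.
Hypothesis g_gt0 : forall x, 0 < g x.
Hypothesis g_even : forall x, g (- x) = g x.
Hypothesis dPhi : forall x, is_derive x 1 Phi (g x).
Hypothesis dg : forall x, is_derive x 1 g (- (x * g x)).
Hypothesis g_cvg : g n%:R @[n --> \oo] --> 0.
Hypothesis Phiy_cvg : 1 - Phi n%:R @[n --> \oo] --> 0.
Hypothesis PhiNy_cvg : Phi (- n%:R) @[n --> \oo] --> 0.

Let g_neq0 x : g x != 0. Proof. by rewrite gt_eqF. Qed.

Lemma Phi_le1 x : Phi x <= 1.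
Proof.
rewrite -subr_ge0.
have dJ y : x <= y -> is_derive y 1 (fun x => 1 - Phi x) (0 - g y).
  by move=> _; exact: (is_derive_sub (is_derive_const 1 y) (dPhi y)).
apply: (ge0_of_decreasing dJ _ Phiy_cvg) => y _.
by rewrite sub0r oppr_le0 ltW.
Qed.

(** The defect [F] has derivative 0 and vanishes at infinity, so both [F] and its negative are
    nonnegative. *)
Lemma Phi_sym x : Phi (- x) = 1 - Phi x.
Proof.
pose F x := Phi x + Phi (- x) - 1; suff F0 y : F y = 0.
  by apply/eqP; rewrite -subr_eq0 opprB addrCA addrA; apply/eqP; exact: F0.
have dF z : is_derive z 1 F 0.
  have := is_derive_sub (is_derive_add (dPhi z) (is_derive_flip (dPhi (- z)))) (is_derive_const 1 z).
  by rewrite g_even subrr subr0.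
have Fcvg : F n%:R @[n --> \oo] --> 0.
  have -> : (fun n : nat => F n%:R) = (fun n => Phi (- n%:R) - (1 - Phi n%:R)).
    by apply/funext => n; rewrite /F; ring.
  by rewrite -[X in _ --> X](subr0 0); apply: cvgB.
have dF' z : y <= z -> is_derive z 1 F 0 by move=> _; exact: dF.
have dF'' z : y <= z -> is_derive z 1 (fun x => 0 - F x) (0 - 0).
  by move=> _; exact: (is_derive_sub (is_derive_const 0 z) (dF z)).
apply/eqP; rewrite eq_le; apply/andP; split; last first.
  exact: (ge0_of_decreasing dF' (fun _ _ => lexx 0) Fcvg).
rewrite -oppr_ge0 -sub0r; apply: (ge0_of_decreasing dF'') => [z _|].
  by rewrite subrr.
by rewrite -[X in _ --> X](subr0 0); apply: cvgB => //; exact: cvg_cst.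
Qed.

Definition mills x := (1 - Phi x) / g x.

Lemma mills_ge0 x : 0 <= mills x.
Proof. by rewrite divr_ge0 ?subr_ge0 ?Phi_le1 // ltW. Qed.

Lemma is_derive_mills x : is_derive x 1 mills (x * mills x - 1).
Proof.
apply: is_derive_eq (is_derive_mul (is_derive_sub (is_derive_const 1 x) (dPhi x))
  (is_derive_inv (g_neq0 x) (dg x))) _.
rewrite /mills; field; exact: g_neq0.
Qed.

Lemma mills_upper x : x * mills x <= 1.
Proof.
have [x0|x0] := leP x 0; first by rewrite (le_trans (mulr_le0_ge0 x0 (mills_ge0 x))).
suff : 0 <= g x / x - (1 - Phi x).
  rewrite subr_ge0 ler_pdivlMr // => h; rewrite /mills mulrA ler_pdivrMr //.
  by rewrite mul1r mulrC.
pose df y := (- (y * g y)) * y^-1 + g y * (- (1 / y ^+ 2)) - (0 - g y).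
have dJ y : x <= y -> is_derive y 1 (fun y => g y / y - (1 - Phi y)) (df y).
  move=> xy; have y0 : y != 0 by rewrite gt_eqF // (lt_le_trans x0).
  exact: (is_derive_sub (is_derive_mul (dg y) (is_derive_inv y0 (is_derive_idR y)))
    (is_derive_sub (is_derive_const 1 y) (dPhi y))).
apply: (ge0_of_decreasing dJ) => [y xy|].
  have y0 : 0 < y by apply: lt_trans xy.
  rewrite (_ : df y = - (g y / y ^+ 2)); last first.
    by rewrite /df; field; rewrite gt_eqF.
  by rewrite oppr_le0 divr_ge0 ?exprn_ge0 ?(ltW y0) ?ltW.
rewrite -[X in _ --> X](subr0 0); apply: cvgB => //.
rewrite -(mul0r 0); apply: cvgM => //.
apply/cvgrPdist_lt => e e0; near=> n; rewrite sub0r normrN ger0_norm ?invr_ge0 //.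
have n0 : e^-1 < n%:R by near: n; exact: nbhs_infty_gtr.
by rewrite invf_plt ?posrE // (lt_trans _ n0) ?invr_gt0.
Unshelve. all: by end_near. Qed.

(** The function [J] tends to 0 and has derivative [- (2 * g y / (1 + y * y) ^+ 2)]. The inequality
    says exactly that the derivative of [x * mills x] is nonnegative, which is how [mul_mills_mono]
    uses it. *)
Lemma mills_lower x : x <= (1 + x ^+ 2) * mills x.
Proof.
have p y : 0 < 1 + y * y by rewrite ltr_pwDl // -expr2 sqr_ge0.
have pn y : 1 + y * y != 0 by rewrite gt_eqF.
pose J y := 1 - Phi y - y * (1 + y * y)^-1 * g y.
pose dJ y := 0 - g y - ((1 * (1 + y * y)^-1
   + y * - ((0 + (1 * y + y * 1)) / (1 + y * y) ^+ 2)) * g y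
   + y * (1 + y * y)^-1 * - (y * g y)).
suff h : 0 <= J x.
  rewrite /mills mulrA ler_pdivlMr // -subr_ge0 expr2.
  rewrite (_ : _ - _ = (1 + x * x) * J x); first by rewrite mulr_ge0 // ltW.
  by rewrite /J; field; exact: pn.
have dd y : x <= y -> is_derive y 1 J (dJ y).
  move=> _; have dy := is_derive_idR y.
  have d2 := is_derive_add (is_derive_const 1 y) (is_derive_mul dy dy).
  exact: (is_derive_sub (is_derive_sub (is_derive_const 1 y) (dPhi y))
    (is_derive_mul (is_derive_mul dy (@is_derive_inv (fun y => 1 + y * y) y _ (pn y) d2)) (dg y))).
apply: (ge0_of_decreasing dd) => [y _|].
  rewrite (_ : dJ y = - (2 * g y / (1 + y * y) ^+ 2)); last first.
    by rewrite /dJ; field; exact: pn.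
  by rewrite oppr_le0 divr_ge0 ?exprn_ge0 ?mulr_ge0 ?(ltW (p y)) // ltW.
rewrite -[X in _ --> X](subr0 0); apply: cvgB => //.
apply/cvgrPdist_le => e e0; move/cvgrPdist_le: g_cvg => /(_ e e0).
apply: filterS => n; rewrite !sub0r !normrN normrM; apply: le_trans.
rewrite ler_piMl // normrM [`|(_)^-1|]ger0_norm ?invr_ge0 ?(ltW (p _)) //.
rewrite ler_pdivrMr // mul1r ger0_norm //.
have := sqr_ge0 (n%:R - 1 : R); rewrite expr2.
have : (0 : R) <= n%:R by []. nra.
Qed.

Lemma mul_mills_mono u v : u <= v -> u * mills u <= v * mills v.
Proof.
move=> uv; rewrite -subr_ge0.
have dU y : u <= y <= v -> is_derive y 1 (fun x => x * mills x)
    (1 * mills y + y * (y * mills y - 1)).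
  by move=> _; exact: (is_derive_mul (is_derive_idR y) (is_derive_mills y)).
rewrite -(mul0r (v - u)); apply: (slope_ge dU) => // y _.
rewrite (_ : 1 * mills y + y * (y * mills y - 1) = (1 + y ^+ 2) * mills y - y); last by ring.
by rewrite subr_ge0 mills_lower.
Qed.

Lemma Phi_ge0 x : 0 <= Phi x.
Proof. by rewrite -[x]opprK Phi_sym subr_ge0 Phi_le1. Qed.

Lemma is_derive_mills_flip x :
  is_derive x 1 (fun y => mills (- y)) (x * mills (- x) + 1).
Proof.
have := is_derive_flip (is_derive_mills (- x)).
by rewrite opprB mulNr opprK addrC.
Qed.

Lemma mills_match x : (1 - Phi x) * mills (- x) = Phi x * mills x.
Proof. by rewrite /mills Phi_sym g_even; field; exact: g_neq0. Qed.

(** * Solution of Stein's equation for a half-line *)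

Section Indicator.
Variable z : R.

(** The bounded solution of [f' w - w * f w = (w <= z) - Phi z]. Since [mills (- w)] equals
    [Phi w / g w], the first branch is the classical [Phi w * (1 - Phi z) / g w]. *)
Definition stein_ind w :=
  if w <= z then (1 - Phi z) * mills (- w) else Phi z * mills w.

Local Notation f := stein_ind.
Let Phi0 : 0 <= Phi z. Proof. exact: Phi_ge0. Qed.
Let Phi1 : 0 <= 1 - Phi z. Proof. by rewrite subr_ge0 Phi_le1. Qed.

Let fL w : w <= z -> f w = (1 - Phi z) * mills (- w).
Proof. by rewrite /f => ->. Qed.

Let fR w : z <= w -> f w = Phi z * mills w.
Proof.
rewrite le_eqVlt => /predU1P[<-|zw]; first by rewrite /f lexx mills_match.
by rewrite /f leNgt zw.
Qed.

Let wfL w : w <= z -> w * f w = - ((1 - Phi z) * (- w * mills (- w))).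
Proof. by move=> /fL ->; ring. Qed.

Let wfR w : z <= w -> w * f w = Phi z * (w * mills w).
Proof. by move=> /fR ->; ring. Qed.

(** Each branch is monotone by [mul_mills_mono], and the branches agree at [z] by [mills_match]. *)
Lemma mul_stein_ind_mono u v : u <= v -> u * f u <= v * f v.
Proof.
have monoL w w' : w <= w' -> w' <= z -> w * f w <= w' * f w'.
  move=> ww' w'z; rewrite !wfL ?(le_trans ww') // lerN2 ler_wpM2l //.
  by rewrite mul_mills_mono // lerN2.
have monoR w w' : w <= w' -> z <= w -> w * f w <= w' * f w'.
  move=> ww' zw; rewrite !wfR ?(le_trans zw) // ler_wpM2l //.
  by rewrite mul_mills_mono.
have [vz|zv] := leP v z; first by move=> uv; exact: monoL.
have [uz|zu] := leP u z; last by move=> uv; apply: monoR => //; exact: ltW.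
by move=> _; apply: le_trans (monoL u z uz (lexx z)) (monoR z v (ltW zv) (lexx z)).
Qed.

Lemma mul_stein_ind_bound w : `|w * f w| <= 1.
Proof.
rewrite ler_norml; have [wz|zw] := leP w z; apply/andP; split.
- rewrite wfL // lerN2 (le_trans (ler_wpM2l Phi1 (mills_upper _))) // mulr1.
  by rewrite gerBl.
- apply: le_trans (mul_stein_ind_mono wz) _; rewrite wfR //.
  by rewrite (le_trans (ler_wpM2l Phi0 (mills_upper _))) // mulr1 Phi_le1.
- apply: le_trans (mul_stein_ind_mono (ltW zw)); rewrite wfL // lerN2.
  by rewrite (le_trans (ler_wpM2l Phi1 (mills_upper _))) // mulr1 gerBl.
- rewrite (wfR (ltW zw)) (le_trans (ler_wpM2l Phi0 (mills_upper _))) // mulr1.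
  exact: Phi_le1.
Qed.

Local Notation ind w := ((w <= z)%R%:R : R).
Definition stein_ind_deriv w := w * f w + ind w - Phi z.
(** Both [w * f w] and minus the indicator are nondecreasing, so an increment of this function
    dominates the oscillation of either part of [stein_ind_deriv]. *)
Definition stein_ind_mono w := w * f w - ind w.

Let ind01 w : 0 <= ind w <= 1. Proof. by rewrite ler0n lern1 leq_b1. Qed.

Lemma stein_ind_deriv_bound w : `|stein_ind_deriv w| <= 2.
Proof.
have := mul_stein_ind_bound w; have /andP[] := ind01 w.
rewrite !ler_norml /stein_ind_deriv => i0 i1 /andP[w1 w2].
have := Phi_ge0 z; have := Phi_le1 z; move: i0 i1 w1 w2.
set i := ind w; set q := w * _; lra.
Qed.

Lemma stein_ind_mono_bound w : `|stein_ind_mono w| <= 2.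
Proof.
have := mul_stein_ind_bound w; have /andP[] := ind01 w.
rewrite !ler_norml /stein_ind_mono; set i := ind w; set q := w * _; lra.
Qed.

(** Off [z] the derivative is [x * f x + ind x - Phi z], with a nondecreasing first part and a
    nonincreasing indicator, so mixing the endpoints bounds it on the whole interval. At [z] there
    is a corner: when [z] lies inside, the mean value bounds on the two halves are added. *)
Let slopes u v : u <= v ->
  (u * f u + ind v - Phi z) * (v - u) <= f v - f u
  <= (v * f v + ind u - Phi z) * (v - u).
Proof.
move=> uv.
have dL x : is_derive x 1 (fun w => (1 - Phi z) * mills (- w))
    (x * ((1 - Phi z) * mills (- x)) + 1 - Phi z).
  apply: is_derive_eq (is_derive_mul (is_derive_const (1 - Phi z) x)
    (is_derive_mills_flip x)) _; ring.
have dR x : is_derive x 1 (fun w => Phi z * mills w) (x * (Phi z * mills x) - Phi z).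
  apply: is_derive_eq (is_derive_mul (is_derive_const (Phi z) x)
    (is_derive_mills x)) _; ring.
have L c d a b : a <= b -> b <= z -> (forall x, a < x < b -> c <= x * f x + 1 - Phi z <= d) ->
    c * (b - a) <= f b - f a <= d * (b - a).
  move=> ab bz cd; rewrite (fL bz) (fL (le_trans ab bz)).
  have cd' x : a < x < b -> c <= x * ((1 - Phi z) * mills (- x)) + 1 - Phi z <= d.
    move=> abx; rewrite -fL ?cd //; case/andP: abx => _ xb.
    by rewrite (le_trans (ltW xb)).
  apply/andP; split.
    by apply: (slope_ge (fun x _ => dL x) ab) => x /cd'/andP[].
  by apply: (slope_le (fun x _ => dL x) ab) => x /cd'/andP[].
have R' c d a b : a <= b -> z <= a -> (forall x, a < x < b -> c <= x * f x - Phi z <= d) ->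
    c * (b - a) <= f b - f a <= d * (b - a).
  move=> ab za cd; rewrite (fR za) (fR (le_trans za ab)).
  have cd' x : a < x < b -> c <= x * (Phi z * mills x) - Phi z <= d.
    move=> abx; rewrite -fR ?cd //; case/andP: abx => ax _.
    by rewrite (le_trans za) // ltW.
  apply/andP; split.
    by apply: (slope_ge (fun x _ => dR x) ab) => x /cd'/andP[].
  by apply: (slope_le (fun x _ => dR x) ab) => x /cd'/andP[].
have mono x : u < x -> x < v -> u * f u <= x * f x <= v * f v.
  by move=> ux xv; rewrite !mul_stein_ind_mono // ltW.
have [vz|zv] := leP v z.
  rewrite (le_trans uv vz) /= mulr1n; apply: L => // x /andP[ux xv].
  by have /andP[? ?] := mono x ux xv; apply/andP; split; lra.
have [uz|zu] := leP u z; rewrite /= ?mulr1n ?mulr0n; last first.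
  apply: R' => //; first exact: ltW.
  by move=> x /andP[ux xv]; have /andP[? ?] := mono x ux xv; apply/andP; split; lra.
have /andP[l1 l2] : (u * f u + 0 - Phi z) * (z - u) <= f z - f u
    <= (v * f v + 1 - Phi z) * (z - u).
  by apply: L => // x /andP[ux xz]; have /andP[? ?] := mono x ux (lt_trans xz zv); apply/andP; split; lra.
have /andP[r1 r2] : (u * f u + 0 - Phi z) * (v - z) <= f v - f z
    <= (v * f v + 1 - Phi z) * (v - z).
  apply: R' => //; [exact: ltW|move=> x /andP[zx xv]].
  by have /andP[? ?] := mono x (le_lt_trans uz zx) xv; apply/andP; split; lra.
by apply/andP; split; lra.
Qed.

(** For [a <= b], [slopes] places the error, up to sign, between [(b - a) * (ind b - ind a)] and
    [(b - a) * (b * f b - a * f a)]. The first is nonpositive, the second nonnegative, and the sum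
    of their sizes is the right-hand side. *)
Lemma stein_ind_taylor a b :
  `|f a - f b - (a - b) * stein_ind_deriv a|
  <= (a - b) * (stein_ind_mono a - stein_ind_mono b).
Proof.
have indS u v : u <= v -> ind v <= ind u.
  by move=> uv; rewrite ler_nat; case: (leP v z) => // /(le_trans uv) ->.
rewrite /stein_ind_deriv /stein_ind_mono ler_norml.
have [ab|ba] := leP a b.
  have /andP[s1 s2] := slopes ab; have i := indS _ _ ab; have w := mul_stein_ind_mono ab.
  have d0 : 0 <= b - a by rewrite subr_ge0.
  have := ler_wpM2l d0 i; have := ler_wpM2l d0 w; move: s1 s2.
  set ia := ind a; set ib := ind b; set fa := f a; set fb := f b; set P := Phi z.
  by move=> *; apply/andP; split; lra.
have /andP[s1 s2] := slopes (ltW ba); have i := indS _ _ (ltW ba).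
have w := mul_stein_ind_mono (ltW ba).
have d0 : 0 <= a - b by rewrite subr_ge0 ltW.
have := ler_wpM2l d0 i; have := ler_wpM2l d0 w; move: s1 s2.
set ia := ind a; set ib := ind b; set fa := f a; set fb := f b; set P := Phi z.
by move=> *; apply/andP; split; lra.
Qed.

End Indicator.

(* A centered Lipschitz test function [phi] with the antiderivative [Psi] of
   [phi * g] that vanishes at both ends of the line. *)
Definition lip_pair (phi Psi : R -> R) : Prop :=
  [/\ forall x y, `|phi x - phi y| <= `|x - y|,
      forall x, is_derive x 1 Psi (phi x * g x),
      Psi n%:R @[n --> \oo] --> 0 & Psi (- n%:R) @[n --> \oo] --> 0].

(** * Solution of Stein's equation for a Lipschitz test function *)

Lemma lip_pair_flip phi Psi : lip_pair phi Psi ->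
  lip_pair (fun x => phi (- x)) (fun x => 0 - Psi (- x)).
Proof.
case=> lip dPsi limy limNy; split.
- by move=> x y; rewrite (le_trans (lip _ _)) // -opprD normrN.
- move=> x; apply: is_derive_eq (is_derive_sub (is_derive_const 0 x)
    (is_derive_flip (dPsi (- x)))) _.
  by rewrite sub0r opprK g_even.
- by rewrite -[X in _ --> X](subr0 0); apply: cvgB => //; exact: cvg_cst.
- rewrite -[X in _ --> X](subr0 0); apply: cvgB => //; first exact: cvg_cst.
  by under eq_fun do rewrite opprK.
Qed.

Lemma lip_pair_opp phi Psi : lip_pair phi Psi ->
  lip_pair (fun x => - phi x) (fun x => 0 - Psi x).
Proof.
case=> lip dPsi limy limNy; split.
- by move=> x y; rewrite -opprD normrN.
- move=> x; apply: is_derive_eq (is_derive_sub (is_derive_const 0 x) (dPsi x)) _.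
  by rewrite sub0r mulNr.
- by rewrite -[X in _ --> X](subr0 0); apply: cvgB => //; exact: cvg_cst.
- by rewrite -[X in _ --> X](subr0 0); apply: cvgB => //; exact: cvg_cst.
Qed.

(** Multiplied by [g w], the difference of the sides is the integral over the tail from [w] of
    [((x - w) - (phi x - phi w)) * g x], which is nonnegative by the Lipschitz bound. [J x] is the
    tail of this integral from [x], evaluated through [Phi], [g] and [Psi]. *)
Lemma lip_pair_ge phi Psi w : lip_pair phi Psi ->
  - (1 - w * mills w) <= Psi w / g w + phi w * mills w.
Proof.
case=> lip dPsi limy _.
pose J x := phi w * (1 - Phi x) + g x - w * (1 - Phi x) + Psi x.
suff : 0 <= J w.
  move=> J0; rewrite -subr_ge0 [X in 0 <= X](_ : _ = J w / g w).
    by rewrite divr_ge0 // ltW.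
  by rewrite /J /mills; field; exact: g_neq0.
pose dJ x := 0 * (1 - Phi x) + phi w * (0 - g x) + - (x * g x)
  - (0 * (1 - Phi x) + w * (0 - g x)) + phi x * g x.
have dd x : w <= x -> is_derive x 1 J (dJ x).
  move=> _; have d1 := is_derive_sub (is_derive_const 1 x) (dPhi x).
  exact: (is_derive_add (is_derive_sub (is_derive_add
    (is_derive_mul (is_derive_const (phi w) x) d1) (dg x))
    (is_derive_mul (is_derive_const w x) d1)) (dPsi x)).
apply: (ge0_of_decreasing dd) => [x wx|].
  rewrite (_ : dJ x = - (g x * ((x - w) - (phi x - phi w)))); last by rewrite /dJ; ring.
  rewrite oppr_le0 mulr_ge0 ?(ltW (g_gt0 x)) // subr_ge0.
  have := lip x w; rewrite [leRHS]ger0_norm ?subr_ge0 ?(ltW wx) //.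
  by apply: le_trans; exact: ler_norm.
rewrite (_ : 0 = phi w * 0 + 0 - w * 0 + 0 :> R); last by rewrite !mulr0 !addr0 subr0.
apply: cvgD => //; apply: cvgB; last by apply: cvgM => //; exact: cvg_cst.
by apply: cvgD => //; apply: cvgM => //; exact: cvg_cst.
Qed.

Lemma lip_pair_right phi Psi w : lip_pair phi Psi ->
  `|Psi w / g w + phi w * mills w| <= 1 - w * mills w.
Proof.
move=> pp; rewrite ler_norml lip_pair_ge //=.
have := lip_pair_ge w (lip_pair_opp pp).
by rewrite sub0r !mulNr -opprD lerN2.
Qed.

Lemma lip_pair_left phi Psi w : lip_pair phi Psi ->
  `|Psi w / g w - phi w * mills (- w)| <= 1 + w * mills (- w).
Proof.
move=> /lip_pair_flip/(lip_pair_right (- w)) /=.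
by rewrite g_even opprK sub0r !mulNr opprK addrC distrC.
Qed.

Definition stein_lip (Psi : R -> R) x := Psi x / g x.
Definition stein_lip_deriv (phi Psi : R -> R) x := x * stein_lip Psi x + phi x.

(** For the normal density this is [sqrt (2 / pi)], the mean of [|N|] for a standard normal [N] and
    the largest value that a centred 1-Lipschitz function can take at 0. *)
Definition lip_const := (mills 0)^-1.

Let m0_gt0 : 0 < mills 0.
Proof.
rewrite divr_gt0 //; have := Phi_sym 0; rewrite oppr0 => <-.
rewrite lt0r Phi_ge0 andbT; apply/eqP => P0.
by have := Phi_sym 0; rewrite oppr0 P0 subr0 => /eqP; rewrite eq_sym oner_eq0.
Qed.

Lemma lip_const_gt0 : 0 < lip_const. Proof. by rewrite invr_gt0. Qed.

(** At 0 the bounds [lip_pair_right] and [lip_pair_left] differ only in the sign of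
    [phi 0 * mills 0]. Subtracting them eliminates [Psi 0] and leaves [|phi 0| * mills 0 <= 1]. *)
Lemma lip_pair_bound phi Psi w : lip_pair phi Psi -> `|phi w| <= lip_const + `|w|.
Proof.
move=> pp; have := lip_pair_left 0 pp; have := lip_pair_right 0 pp.
rewrite oppr0 mul0r subr0 addr0 !ler_norml => /andP[a1 a2] /andP[b1 b2].
have /andP[c1 c2] : - lip_const <= phi 0 <= lip_const.
  by rewrite /lip_const -[_^-1]mul1r -mulNr ler_pdivrMr // ler_pdivlMr //; apply/andP; split; lra.
have [lip _ _ _] := pp; have := lip w 0; rewrite subr0 !ler_norml => /andP[d1 d2].
by apply/andP; split; lra.
Qed.

(** With [rho = 1 - w * mills w], the first quantity is [w * (f + phi w * mills w) + phi w * rho],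
    so the linear growth of [phi] only appears multiplied by [rho], and [mills_lower] gives
    [(1 + w ^+ 2) * rho <= 1]. The second quantity is the derivative of [w * f w]. *)
Let stein_lip_ge0 phi Psi w : 0 <= w -> lip_pair phi Psi ->
  let f := Psi w / g w in
  `|w * f + phi w| <= lip_const + 1 /\ `|f + w * (w * f + phi w)| <= lip_const + 5.
Proof.
move=> w0 pp f.
have := lip_pair_right w pp; rewrite -/f.
have : 0 <= 1 - w * mills w by rewrite subr_ge0 mills_upper.
have : (1 + w ^+ 2) * (1 - w * mills w) <= 1.
  have := ler_wpM2l w0 (mills_lower w); nra.
have := lip_pair_bound w pp; rewrite (ger0_norm w0).
have Mle : lip_const * mills w <= 1.
  rewrite /lip_const mulrC ler_pdivrMr // mul1r.
  suff : mills w - mills 0 <= 0 * (w - 0) by rewrite mul0r subr_le0.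
  apply: (slope_le (fun x _ => is_derive_mills x) w0) => x _.
  by rewrite subr_le0 mills_upper.
have M0 := mills_ge0 w; have wM := mills_upper w.
have D0 := ltW lip_const_gt0.
move: Mle M0 wM D0; set M := mills w; set D := lip_const; set P := phi w.
move=> Mle M0 wM D0 Pb; set rho := 1 - w * M => rho1 rho0 q.
have rhoE : rho = 1 - w * M by [].
have e1 : w * f + P = w * (f + P * M) + P * rho by rewrite rhoE; ring.
have rle1 : rho <= 1 by rewrite rhoE gerBl mulr_ge0.
have wr : w * rho <= 1 / 2 by have := mulr_ge0 rho0 (sqr_ge0 (w - 1)); nra.
have w2r : w ^+ 2 * rho <= 1 by nra.
have b1 : `|w * f + P| <= (D + 2 * w) * rho.
  rewrite e1 (le_trans (ler_normD _ _)) // !normrM (ger0_norm w0) (ger0_norm rho0).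
  have := ler_wpM2l w0 q; have := ler_wpM2r rho0 Pb; lra.
have bf : `|f| <= 3.
  rewrite -[f](addrK (P * M)) (le_trans (ler_normB _ _)) //.
  rewrite [X in _ + X]normrM (ger0_norm M0).
  have := ler_wpM2r M0 Pb; lra.
split.
  apply: le_trans b1 _; have := ler_wpM2l D0 rle1; lra.
apply: le_trans (ler_normD _ _) _; rewrite [X in _ + X]normrM (ger0_norm w0).
have := ler_wpM2l w0 b1; have := ler_wpM2l D0 wr; lra.
Qed.

Lemma stein_lip_bounds phi Psi w : lip_pair phi Psi ->
  let f := Psi w / g w in
  `|w * f + phi w| <= lip_const + 1 /\ `|f + w * (w * f + phi w)| <= lip_const + 5.
Proof.
have [w0|w0] := leP 0 w; first exact: stein_lip_ge0.
move=> pp f; have Nw0 : 0 <= - w by rewrite oppr_ge0 ltW.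
have := stein_lip_ge0 Nw0 (lip_pair_flip pp).
rewrite /= opprK g_even sub0r !mulNr -/f !mulrN !opprK => -[h1 h2].
by split => //; rewrite -normrN opprD.
Qed.

Lemma is_derive_stein_lip phi Psi x : lip_pair phi Psi ->
  is_derive x 1 (stein_lip Psi) (stein_lip_deriv phi Psi x).
Proof.
case=> _ dPsi _ _.
apply: is_derive_eq (is_derive_mul (dPsi x) (is_derive_inv (g_neq0 x) (dg x))) _.
by rewrite /stein_lip_deriv /stein_lip; field; exact: g_neq0.
Qed.

(** Since [phi] need not be differentiable, no second derivative is taken. Instead [stein_lip_deriv]
    is shown to be Lipschitz, as the sum of [x * stein_lip Psi x], with constant [lip_const + 5],
    and of [phi], with constant 1. *)
Lemma stein_lip_taylor phi Psi a b : lip_pair phi Psi ->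
  `|stein_lip Psi a - stein_lip Psi b - (a - b) * stein_lip_deriv phi Psi a|
    <= (lip_const + 6) * (a - b) ^+ 2.
Proof.
move=> pp; have [lip _ _ _] := pp.
set f := stein_lip Psi; set fp := stein_lip_deriv phi Psi.
have df x := is_derive_stein_lip x pp.
have D0 := ltW lip_const_gt0.
have lipw x y : x <= y -> `|y * f y - x * f x| <= (lip_const + 5) * (y - x).
  move=> xy; have dwf u : x <= u <= y ->
      is_derive u 1 (fun v => v * f v) (1 * f u + u * (u * f u + phi u)).
    by move=> _; exact: (is_derive_mul (is_derive_idR u) (df u)).
  have bnd u : x < u < y -> - (lip_const + 5) <= 1 * f u + u * (u * f u + phi u) <= lip_const + 5.
    by move=> _; rewrite mul1r -ler_norml; have [] := stein_lip_bounds u pp.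
  rewrite ler_norml -mulNr; apply/andP; split.
    by apply: (slope_ge dwf xy) => u /bnd/andP[].
  by apply: (slope_le dwf xy) => u /bnd/andP[].
have lipf x y : x <= y -> `|fp y - fp x| <= (lip_const + 6) * (y - x).
  move=> xy; rewrite /fp /stein_lip_deriv -/f opprD addrACA (le_trans (ler_normD _ _)) //.
  have := lip y x; rewrite [leRHS]ger0_norm ?subr_ge0 // => l1.
  by have := lipw x y xy; lra.
have mv x y : x < y -> exists2 c, x < c < y & f y - f x = fp c * (y - x).
  by move=> xy; exact: (mean_value (fun u _ => df u) xy).
have [ab|ba|->] := ltgtP a b; last by rewrite !subrr mul0r subr0 normr0 expr0n mulr0.
  have [c /andP[ac cb] e] := mv a b ab.
  have -> : f a - f b - (a - b) * fp a = - ((fp c - fp a) * (b - a)) by rewrite [in RHS]mulrBl -e; ring.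
  have ba0 : 0 <= b - a by rewrite subr_ge0 ltW.
  rewrite normrN normrM (ger0_norm ba0) (_ : (a - b) ^+ 2 = (b - a) * (b - a)); last by ring.
  rewrite mulrA ler_wpM2r // (le_trans (lipf _ _ (ltW ac))) //.
  by rewrite ler_wpM2l ?addr_ge0 // lerD2r ltW.
have [c /andP[bc ca] e] := mv b a ba.
have -> : f a - f b - (a - b) * fp a = (fp c - fp a) * (a - b) by rewrite [in RHS]mulrBl -e; ring.
have ba0 : 0 <= a - b by rewrite subr_ge0 ltW.
rewrite normrM (ger0_norm ba0) expr2 mulrA ler_wpM2r // distrC.
rewrite (le_trans (lipf _ _ (ltW ca))) //.
by rewrite ler_wpM2l ?addr_ge0 // lerD2l lerN2 ltW.
Qed.

End Mills.
End StandardNormal.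

(** * The standard normal law: density, distribution function and integrals *)

Section NormalLaw.
Import numFieldNormedType.Exports.
Local Open Scope classical_set_scope.
Variable R : realType.
Local Notation mu := (@lebesgue_measure R).
Local Notation pdf := (@normal_pdf R 0 1).
Local Notation N01 := (@normal_prob R 0 1).

(** The Radon-Nikodym derivative of the law agrees almost everywhere with the density, because both
    have the same integral over every measurable set. *)
Lemma ge0_integral_normal_prob (f : R -> \bar R) :
  (forall x, 0 <= f x)%E -> measurable_fun setT f ->
  (\int[N01]_x f x = \int[mu]_x (f x * (pdf x)%:E))%E.
Proof.
move=> f0 mf; have dom := @normal_prob_dominates R 0 1.
rewrite -(Radon_Nikodym_SigmaFinite.change_of_variables dom f0 measurableT mf).
apply: ae_eq_integral => //=.
- apply: emeasurable_funM => //; apply: (measurable_int mu).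
  exact: Radon_Nikodym_SigmaFinite.f_integrable.
- apply: emeasurable_funM => //; apply/measurable_EFinP; exact: measurable_normal_pdf.
apply: ae_eqe_mul2l; apply: integral_ae_eq => //.
- exact: Radon_Nikodym_SigmaFinite.f_integrable.
- by apply/measurable_EFinP; exact: measurable_normal_pdf.
by move=> E _ mE; rewrite -Radon_Nikodym_SigmaFinite.f_integral.
Qed.

Lemma integral_normal_prob (f : R -> R) : measurable_fun setT f ->
  (\int[N01]_x (f x)%:E = \int[mu]_x (f x * pdf x)%:E)%E.
Proof.
move=> mf; have mf' : measurable_fun setT (fun x => (f x)%:E) by apply/measurable_EFinP.
rewrite integralE [RHS]integralE; congr (_ - _)%E.
  rewrite ge0_integral_normal_prob //; last exact: measurable_funepos.
  apply: eq_integral => x _; rewrite !funeposE -!EFin_max -EFinM; congr EFin.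
  by rewrite maxr_pMl ?normal_pdf_ge0 // mul0r.
rewrite ge0_integral_normal_prob //; last exact: measurable_funeneg.
apply: eq_integral => x _; rewrite !funenegE -!EFin_max -EFinM; congr EFin.
by rewrite maxr_pMl ?normal_pdf_ge0 // mul0r mulNr.
Qed.

Section Antiderivative.
Variable F : R -> R.
Hypothesis cF : continuous F.
Hypothesis iF : mu.-integrable setT (EFin \o F).

Definition prim (x : R) : R := (\int[mu]_(t in `]-oo, x]) F t)%R.

Lemma is_derive_prim (x : R) : is_derive x 1 prim (F x).
Proof.
have i1 : mu.-integrable `]-oo, x + 1] (EFin \o F).
  by apply: integrableS iF => //; exact: measurable_itv.
have xx1 : x < x + 1 by rewrite ltrDl.
have [d e] := continuous_FTC1 xx1 i1 (ltNyr x) (@cF x).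
by apply: DeriveDef => //; rewrite -e derive1E.
Qed.

Let lim_patch (D : nat -> set R) (G : R -> R) :
  (forall n, measurable (D n)) -> (forall x, (F \_ (D n)) x @[n --> \oo] --> G x) ->
  measurable_fun setT G ->
  (\int[mu]_(t in D n) F t)%R @[n --> \oo] --> (\int[mu]_t G t)%R.
Proof.
move=> mD FG mG; have mF := measurable_int _ iF.
have mFR : measurable_fun setT F by apply/measurable_EFinP.
have [] := @dominated_convergence _ _ _ mu setT measurableT
  (fun n => EFin \o (F \_ (D n))) (EFin \o G) (fun x => `|(F x)%:E|%E).
- move=> n; apply/measurable_EFinP; apply/(measurable_restrict _ (mD n) measurableT).
  exact: measurable_funS mFR.
- by apply/measurable_EFinP.
- by apply: aeW => x _; apply: cvg_EFin; [apply: nearW|exact: FG].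
- exact: integrable_abse.
- apply: aeW => x n _; rewrite /= patchE lee_fin; case: ifPn => // _.
  by rewrite normr0.
move=> iG _; rewrite /Rintegral; set l := (\int[_]_(_ in _) _)%E => h.
have lfin : l \is a fin_num by exact: integrable_fin_num iG.
apply: fine_cvg; rewrite fineK //.
apply: cvg_trans h; apply: near_eq_cvg; apply: nearW => n /=.
by rewrite [RHS]integral_mkcond; apply: eq_integral => x _; rewrite /= !patchE; case: ifP.
Qed.

Lemma prim_cvgy : prim n%:R @[n --> \oo] --> (\int[mu]_t F t)%R.
Proof.
apply: lim_patch => [n|x|]; first exact: measurable_itv.
  apply: cvg_near_cst; near=> n; rewrite patchE mem_set //= in_itv /=.
  by near: n; exact: nbhs_infty_ger.
by apply/measurable_EFinP; exact: measurable_int iF.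
Unshelve. all: by end_near. Qed.

Lemma prim_cvgNy : prim (- n%:R) @[n --> \oo] --> 0.
Proof.
rewrite (_ : 0 = (\int[mu]_t (cst 0 : R -> R) t)%R); last first.
  by rewrite /Rintegral integral0_eq.
apply: lim_patch => [n|x|]; [exact: measurable_itv| |exact: measurable_cst].
apply: cvg_near_cst; near=> n; rewrite patchE memNset //= in_itv /= => xn.
have : - x < n%:R by near: n; exact: nbhs_infty_gtr.
by rewrite ltrNl ltNge xn.
Unshelve. all: by end_near. Qed.

End Antiderivative.
Lemma normal_pdf01E x : pdf x = normal_peak 1 * expR (- (x * x) / 2).
Proof.
by rewrite normal_pdfE ?oner_neq0 // /normal_fun subr0 expr1n mulr2n expr2.
Qed.

Lemma normal_pdf_gt0 x : 0 < pdf x.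
Proof. by rewrite normal_pdf01E mulr_gt0 ?expR_gt0 ?normal_peak_gt0 ?oner_neq0. Qed.

Lemma normal_pdf_even x : pdf (- x) = pdf x.
Proof. by rewrite !normal_pdf01E mulrNN. Qed.

Lemma is_derive_normal_pdf (x : R) : is_derive x 1 pdf (- (x * pdf x)).
Proof.
pose q y : R := (0 - y * y) * 2^-1.
have pdfE : pdf = fun y => normal_peak 1 * (expR \o q) y.
  by apply/funext => y; rewrite normal_pdf01E /q /= sub0r.
have dx := is_derive_idR x.
have dq := is_derive_mul (is_derive_sub (is_derive_const 0 x) (is_derive_mul dx dx))
  (is_derive_const 2^-1 x).
have de := is_derive1_comp (is_derive_expR (q x)) dq.
have := is_derive_mul (is_derive_const (normal_peak 1) x) de.
by rewrite -pdfE => d; apply: is_derive_eq d _; rewrite pdfE /=; field.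
Qed.

Lemma normal_pdf_cvg : pdf n%:R @[n --> \oo] --> 0.
Proof.
apply/cvgrPdist_lt => e e0; near=> n.
have n0 : (0 : R) < n%:R by near: n; exact: nbhs_infty_gtr.
rewrite sub0r normrN gtr0_norm ?normal_pdf_gt0 // normal_pdf01E mulNr expRN.
have h1 : (n%:R : R) <= expR (n%:R * n%:R / 2).
  apply: le_trans (expR_ge1Dx _); have := sqr_ge0 (n%:R - 1 : R); rewrite expr2; nra.
rewrite ltr_pdivrMr ?expR_gt0 //; apply: lt_le_trans (ler_wpM2l (ltW e0) h1).
rewrite mulrC -ltr_pdivrMr //; near: n; exact: nbhs_infty_gtr.
Unshelve. all: by end_near. Qed.

Lemma integrable_pdf01 : mu.-integrable setT (EFin \o pdf).
Proof. exact: integrable_normal_pdf. Qed.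

Lemma continuous_pdf01 : continuous pdf.
Proof. exact: (continuous_normal_pdf (oner_neq0 R)). Qed.

Definition Phi01 : R -> R := prim pdf.

Lemma normal_prob_itv (z : R) : N01 `]-oo, z] = (Phi01 z)%:E.
Proof.
rewrite /Phi01 /prim /Rintegral /normal_prob fineK //.
by apply: integrable_fin_num => //; apply: integrableS integrable_pdf01.
Qed.

Lemma Rintegral_pdf01 : (\int[mu]_t pdf t)%R = 1.
Proof. by rewrite /Rintegral integral_normal_pdf. Qed.

Lemma Phi01_cvgy : 1 - Phi01 n%:R @[n --> \oo] --> 0.
Proof.
have := prim_cvgy integrable_pdf01; rewrite Rintegral_pdf01 => h.
by rewrite -(subrr (1 : R)); apply: cvgB => //; exact: cvg_cst.
Qed.

Lemma Phi01_cvgNy : Phi01 (- n%:R) @[n --> \oo] --> 0.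
Proof. exact: prim_cvgNy integrable_pdf01. Qed.

Lemma is_derive_Phi01 (x : R) : is_derive x 1 Phi01 (pdf x).
Proof. exact: is_derive_prim continuous_pdf01 integrable_pdf01 x. Qed.

Section LipschitzTest.
Variable phi : R -> R.
Hypothesis phi_lip : forall x y, `|phi x - phi y| <= `|x - y|.

Lemma lip_continuous : continuous phi.
Proof.
move=> x; apply/cvgrPdist_lt => e e0; near=> y.
apply: le_lt_trans (phi_lip _ _) _.
by near: y; apply: cvgr_dist_lt.
Unshelve. all: by end_near. Qed.

Lemma continuous_lip_pdf : continuous (fun x => phi x * pdf x).
Proof. by move=> x; apply: cvgM; [exact: lip_continuous|exact: continuous_pdf01]. Qed.

(* [(1 + |x|) exp(-x^2/2) <= 2 exp(-x^2/4)], a multiple of the density of N(0,2). *)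
Lemma integrable_lip_pdf : mu.-integrable setT (EFin \o (fun x => phi x * pdf x)).
Proof.
pose s : R := Num.sqrt 2; have s0 : s != 0 by rewrite gt_eqF // sqrtr_gt0.
have s2 : s ^+ 2 = 2 by rewrite sqr_sqrtr.
pose c := (`|phi 0| + 1) * (2 * normal_peak 1 / normal_peak s).
have ps : 0 < normal_peak s := normal_peak_gt0 s0.
have c0 : 0 <= c.
  by rewrite mulr_ge0 ?addr_ge0 // divr_ge0 ?mulr_ge0 ?normal_peak_ge0.
have := integrableZl measurableT c (@integrable_normal_pdf R 0 s).
apply: le_integrable => //.
  apply/measurable_EFinP; apply: continuous_measurable_fun; exact: continuous_lip_pdf.
move=> x _; rewrite /= lee_fin [leRHS]ger0_norm; last exact: mulr_ge0 c0 (normal_pdf_ge0 _ _ _).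
rewrite normrM (ger0_norm (normal_pdf_ge0 0 1 x)).
have h1 : `|phi x| <= (`|phi 0| + 1) * (1 + `|x|).
  have h := phi_lip x 0; rewrite subr0 in h.
  have := ler_normD (phi x - phi 0) (phi 0); rewrite subrK => h'.
  have := mulr_ge0 (normr_ge0 (phi 0)) (normr_ge0 x); lra.
have h2 : 1 + `|x| <= 2 * expR (x * x / 4).
  have := expR_ge1Dx (x * x / 4); have := sqr_ge0 (`|x| - 1).
  have -> : x * x = `|x| * `|x| by rewrite -!expr2 real_normK ?num_real.
  rewrite expr2; lra.
have -> : normal_pdf 0 s x = normal_peak s * expR (- (x * x) / 4).
  rewrite normal_pdfE // /normal_fun s2 subr0 -expr2; congr (_ * expR (_ / _)).
  by rewrite mulr2n; lra.
have eE : expR (x * x / 4) * expR (- (x * x) / 2) = expR (- (x * x) / 4).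
  by rewrite -expRD; congr expR; field.
rewrite normal_pdf01E; have p1 : 0 <= normal_peak 1 :> R by exact: normal_peak_ge0.
rewrite (_ : c * _ = (`|phi 0| + 1) * (2 * expR (x * x / 4)) *
    (normal_peak 1 * expR (- (x * x) / 2))); last first.
  by rewrite -eE /c; field; rewrite gt_eqF.
rewrite ler_wpM2r ?mulr_ge0 ?expR_ge0 // (le_trans h1) //.
by rewrite ler_wpM2l // addr_ge0.
Qed.

Definition normal_mean : R := (\int[mu]_x (phi x * pdf x))%R.

Lemma integral_lip : (\int[N01]_x (phi x)%:E = normal_mean%:E)%E.
Proof.
rewrite integral_normal_prob.
  by rewrite /normal_mean /Rintegral fineK // (integrable_fin_num _ integrable_lip_pdf).
apply: continuous_measurable_fun; exact: lip_continuous.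
Qed.

End LipschitzTest.

(** Subtracting the normal mean makes the total integral vanish, which is what sends the primitive
    to 0 at plus infinity; at minus infinity it tends to 0 anyway. *)
Lemma normal_lip_pair (phi : R -> R) : (forall x y, `|phi x - phi y| <= `|x - y|) ->
  lip_pair pdf (fun x => phi x - normal_mean phi)
    (prim (fun x => (phi x - normal_mean phi) * pdf x)).
Proof.
move=> phi_lip; set c := normal_mean phi.
have lip x y : `|(phi x - c) - (phi y - c)| <= `|x - y|.
  by rewrite opprB addrA subrK.
have cF := continuous_lip_pdf lip; have iF := integrable_lip_pdf lip.
split => //.
- by move=> x; exact: is_derive_prim.
- have := prim_cvgy iF; suff -> : (\int[mu]_x ((phi x - c) * pdf x))%R = 0 by [].
  rewrite (_ : (fun x => _) = (fun x => phi x * pdf x - c * pdf x)); last first.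
    by apply/funext => x; rewrite mulrBl.
  rewrite RintegralB //.
  + by rewrite RintegralZl ?integrable_pdf01 // Rintegral_pdf01 mulr1 subrr.
  + exact: integrable_lip_pdf.
  + exact: (integrableZl measurableT c integrable_pdf01).
- exact: prim_cvgNy iF.
Qed.

Lemma stein_solution_ind (z : R) : exists f fp m : R -> R,
  [/\ forall w, fp w - w * f w = (w <= z)%R%:R - Phi01 z,
      forall w, `|fp w| <= 2, forall w, `|m w| <= 2
    & forall a b, `|f a - f b - (a - b) * fp a| <= (a - b) * (m a - m b)].
Proof.
exists (stein_ind pdf Phi01 z), (stein_ind_deriv pdf Phi01 z), (stein_ind_mono pdf Phi01 z).
split=> *.
- by rewrite /stein_ind_deriv -[X in X - _]addrA addrAC subrr add0r.
- exact: (stein_ind_deriv_bound normal_pdf_gt0 normal_pdf_even is_derive_Phi01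
    is_derive_normal_pdf normal_pdf_cvg Phi01_cvgy Phi01_cvgNy).
- exact: (stein_ind_mono_bound normal_pdf_gt0 normal_pdf_even is_derive_Phi01
    is_derive_normal_pdf normal_pdf_cvg Phi01_cvgy Phi01_cvgNy).
- exact: (stein_ind_taylor normal_pdf_gt0 normal_pdf_even is_derive_Phi01
    is_derive_normal_pdf normal_pdf_cvg Phi01_cvgy Phi01_cvgNy).
Qed.

(** The constant is chosen before [phi], so that it can enter the constant of the theorem. *)
Lemma stein_solution_lip : exists2 c : R, 0 <= c &
  forall phi : R -> R, (forall x y, `|phi x - phi y| <= `|x - y|) ->
  exists f fp : R -> R,
  [/\ forall w, fp w - w * f w = phi w - normal_mean phi, forall w, `|fp w| <= c
    & forall a b, `|f a - f b - (a - b) * fp a| <= c * (a - b) ^+ 2].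
Proof.
have c0 : 0 <= lip_const pdf Phi01.
  exact: ltW (lip_const_gt0 normal_pdf_gt0 normal_pdf_even is_derive_Phi01 Phi01_cvgy Phi01_cvgNy).
exists (lip_const pdf Phi01 + 6) => [|phi lip]; first by rewrite addr_ge0.
have pp := normal_lip_pair lip.
set Psi := prim _ in pp; set phi' := (fun x => phi x - _) in pp.
exists (stein_lip pdf Psi), (stein_lip_deriv pdf phi' Psi); split=> [w|w|a b].
- by rewrite /stein_lip_deriv addrAC subrr add0r.
- apply: le_trans (_ : _ <= lip_const pdf Phi01 + 1) _; last by rewrite lerD2l ler1n.
  suff [] : `|w * (Psi w / pdf w) + phi' w| <= lip_const pdf Phi01 + 1 /\
    `|Psi w / pdf w + w * (w * (Psi w / pdf w) + phi' w)| <= lip_const pdf Phi01 + 5 by [].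
  exact: (stein_lip_bounds normal_pdf_gt0 normal_pdf_even is_derive_Phi01
    is_derive_normal_pdf normal_pdf_cvg Phi01_cvgy Phi01_cvgNy w pp).
- exact: (stein_lip_taylor normal_pdf_gt0 normal_pdf_even is_derive_Phi01
    is_derive_normal_pdf normal_pdf_cvg Phi01_cvgy Phi01_cvgNy a b pp).
Qed.

End NormalLaw.
(* The finite-set notations take precedence over the classical ones from here on. *)
From mathcomp Require Import fintype finset.

(** * Expectation and conditional expectation on finite products *)

Section ProductExpectation.
Variables (R : realFieldType) (T : finType) (mu : T -> R).
Hypotheses (mu_ge0 : forall t, 0 <= mu t) (mu_sum1 : \sum_t mu t = 1).
Implicit Types I J : finType.

Definition pw I (A : {ffun I -> T}) : R := \prod_i mu (A i).

Definition ex I (F : {ffun I -> T} -> R) : R := \sum_A pw A * F A.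

Lemma pw_ge0 I (A : {ffun I -> T}) : 0 <= pw A.
Proof. by apply: prodr_ge0 => i _. Qed.

Lemma pw_sum1 I : \sum_(A : {ffun I -> T}) pw A = 1.
Proof.
rewrite -(bigA_distr_bigA (fun _ t => mu t)) big1 // => i _; exact: mu_sum1.
Qed.

Lemma eq_ex I (F G : {ffun I -> T} -> R) : F =1 G -> ex F = ex G.
Proof. by move=> FG; apply: eq_bigr => A _; rewrite FG. Qed.

Lemma ex_cst I (c : R) : ex (fun _ : {ffun I -> T} => c) = c.
Proof. by rewrite /ex -mulr_suml pw_sum1 mul1r. Qed.

Lemma exD I (F G : {ffun I -> T} -> R) : ex (fun A => F A + G A) = ex F + ex G.
Proof. by rewrite /ex -big_split /=; apply: eq_bigr => A _; rewrite mulrDr. Qed.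

Lemma exZ I c (F : {ffun I -> T} -> R) : ex (fun A => c * F A) = c * ex F.
Proof. by rewrite /ex mulr_sumr; apply: eq_bigr => A _; rewrite mulrCA. Qed.

Lemma exZr I c (F : {ffun I -> T} -> R) : ex (fun A => F A * c) = ex F * c.
Proof. by rewrite mulrC -exZ; apply: eq_ex => A; rewrite mulrC. Qed.

Lemma exN I (F : {ffun I -> T} -> R) : ex (fun A => - F A) = - ex F.
Proof. by rewrite -mulN1r -exZ; apply: eq_ex => A; rewrite mulN1r. Qed.

Lemma exB I (F G : {ffun I -> T} -> R) : ex (fun A => F A - G A) = ex F - ex G.
Proof. by rewrite exD exN. Qed.

Lemma ex_sum I (K : Type) (s : seq K) (P : pred K) (F : K -> {ffun I -> T} -> R) :
  ex (fun A => \sum_(k <- s | P k) F k A) = \sum_(k <- s | P k) ex (F k).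
Proof.
by rewrite /ex exchange_big /=; apply: eq_bigr => A _; rewrite mulr_sumr.
Qed.

Lemma ler_ex I (F G : {ffun I -> T} -> R) :
  (forall A, F A <= G A) -> ex F <= ex G.
Proof. by move=> FG; apply: ler_sum => A _; rewrite ler_wpM2l ?pw_ge0. Qed.

Lemma ex_ge0 I (F : {ffun I -> T} -> R) : (forall A, 0 <= F A) -> 0 <= ex F.
Proof. by move=> F0; rewrite -(ex_cst I 0); apply: ler_ex. Qed.

Lemma ler_norm_ex I (F : {ffun I -> T} -> R) : `|ex F| <= ex (fun A => `|F A|).
Proof.
apply: le_trans (ler_norm_sum _ _ _) _; apply: ler_sum => A _.
by rewrite normrM (ger0_norm (pw_ge0 A)).
Qed.

Lemma ex_exchange I J (F : {ffun I -> T} -> {ffun J -> T} -> R) :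
  ex (fun A => ex (F A)) = ex (fun B => ex (F^~ B)).
Proof.
rewrite /ex (eq_bigr (fun A => \sum_B pw A * (pw B * F A B))); last first.
  by move=> A _; rewrite mulr_sumr.
rewrite exchange_big /=; apply: eq_bigr => B _; rewrite mulr_sumr.
by apply: eq_bigr => A _; rewrite mulrCA.
Qed.

(** Marginalisation: configurations are grouped by their restriction along [e]. Each group is a
    product set, so its mass factors, and the coordinates off the image of [e] contribute total mass
    1. *)
Lemma ex_reindex I J (e : J -> I) (F : {ffun J -> T} -> R) :
  injective e -> ex (fun A : {ffun I -> T} => F [ffun j => A (e j)]) = ex F.
Proof.
move=> einj; rewrite /ex.
rewrite (partition_big (fun A : {ffun I -> T} => [ffun j => A (e j)]) predT) //=.
apply: eq_bigr => B _.
pose Q i := [pred t | if [pick j | e j == i] is Some j then t == B j else true].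
have QE (A : {ffun I -> T}) : ([ffun j => A (e j)] == B) = (A \in family Q).
  apply/eqP/familyP => [eB i|AQ].
    by rewrite inE /Q -eB; case: pickP => // j /eqP <-; rewrite ffunE.
  apply/ffunP => j; rewrite ffunE; have := AQ (e j); rewrite inE /Q.
  by case: pickP => [k /eqP/einj -> /eqP //|/(_ j)]; rewrite eqxx.
rewrite (eq_bigr (fun A : {ffun I -> T} => pw A * F B)); last first.
  by move=> A /eqP eB; rewrite -[in RHS]eB.
rewrite -mulr_suml; congr (_ * _); rewrite (eq_bigl _ _ QE) -(bigA_distr_big_dep Q (fun _ t => mu t)).
rewrite (bigID (mem (codom e))) /= [X in _ * X]big1 ?mulr1; last first.
  move=> i ie; rewrite (eq_bigl xpredT) ?mu_sum1 // => t; rewrite /Q /=.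
  by case: pickP => // j /eqP ji; rewrite -ji codom_f in ie.
rewrite (eq_bigl (mem [set e j | j : J]%SET)); last first.
  by move=> i /=; apply/codomP/imsetP => [[j ->]|[j _ ->]]; exists j.
rewrite big_imset /=; last by move=> ? ? _ _; exact: einj.
rewrite /pw; apply: eq_bigr => j _; rewrite (big_pred1 (B j)) // => t.
by rewrite /Q /=; case: pickP => [k /eqP/einj ->|/(_ j)] //; rewrite eqxx.
Qed.

Lemma ex2E I J (G : {ffun I -> T} -> {ffun J -> T} -> R) :
  ex (fun A => ex (G A)) =
  \sum_(u : {ffun I -> T} * {ffun J -> T}) pw u.1 * pw u.2 * G u.1 u.2.
Proof.
rewrite -(pair_bigA _ (fun A B => pw A * pw B * G A B)) /=.
apply: eq_bigr => A _; rewrite mulr_sumr; apply: eq_bigr => B _.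
by rewrite mulrA.
Qed.

Definition mix I (Z : {set I}) (A B : {ffun I -> T}) : {ffun I -> T} :=
  [ffun i => if i \in Z then A i else B i].

(** Exchanging the coordinates outside [Z] between two independent configurations is an involution
    that preserves their joint weight. *)
Lemma ex_swap I (Z : {set I}) (F : {ffun I -> T} -> {ffun I -> T} -> R) :
  ex (fun A => ex (fun B => F (mix Z A B) (mix Z B A)))
  = ex (fun A => ex (fun B => F A B)).
Proof.
rewrite (ex2E (fun A B => F (mix Z A B) (mix Z B A))) ex2E.
pose s (u : {ffun I -> T} * {ffun I -> T}) := (mix Z u.1 u.2, mix Z u.2 u.1).
have sK : involutive s.
  move=> [A B]; rewrite /s /=; congr pair; apply/ffunP => i;
  by rewrite !ffunE; case: (i \in Z).
rewrite [RHS](reindex_inj (inv_inj sK)) /=; apply: eq_bigr => -[A B] _ /=.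
congr (_ * _); rewrite /pw -!big_split /=; apply: eq_bigr => i _.
by rewrite !ffunE; case: ifP => // _; rewrite mulrC.
Qed.

Lemma ex_mix I (Z : {set I}) (F : {ffun I -> T} -> R) :
  ex (fun A => ex (fun B => F (mix Z A B))) = ex F.
Proof.
rewrite (ex_swap Z (fun A _ => F A)); apply: eq_ex => A; exact: ex_cst.
Qed.

(** Lagrange's identity: twice the gap is a weighted double sum of squares. *)
Lemma sum_cauchy (V : finType) (w f g : V -> R) : (forall v, 0 <= w v) ->
  (\sum_v w v * (f v * g v)) ^+ 2
   <= (\sum_v w v * f v ^+ 2) * (\sum_v w v * g v ^+ 2).
Proof.
move=> w0; set f2 := \sum_v w v * f v ^+ 2; set g2 := \sum_v w v * g v ^+ 2.
set fg := \sum_v _.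
suff : \sum_u \sum_v w u * w v * (f u * g v - f v * g u) ^+ 2
    = 2 * (f2 * g2 - fg ^+ 2).
  move=> eq2; rewrite -subr_ge0 -(@pmulr_rge0 _ 2) // -eq2.
  by do 2 (apply: sumr_ge0 => ? _); rewrite mulr_ge0 ?sqr_ge0 ?mulr_ge0.
transitivity (\sum_u (w u * f u ^+ 2 * g2 - 2 * (w u * (f u * g u)) * fg
    + w u * g u ^+ 2 * f2)).
  apply: eq_bigr => u _; rewrite !mulr_sumr -sumrB -big_split /=.
  by apply: eq_bigr => v _; ring.
rewrite big_split sumrB /= -!mulr_suml -mulr_sumr -/f2 -/g2 -/fg; ring.
Qed.

Lemma ex_cauchy I (F G : {ffun I -> T} -> R) :
  (ex (fun A => F A * G A)) ^+ 2 <= ex (fun A => F A ^+ 2) * ex (fun A => G A ^+ 2).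
Proof. by apply: sum_cauchy => A; exact: pw_ge0. Qed.

Lemma ex2_cauchy I J (F G : {ffun I -> T} -> {ffun J -> T} -> R) :
  (ex (fun A => ex (fun B => F A B * G A B))) ^+ 2
  <= ex (fun A => ex (fun B => F A B ^+ 2)) * ex (fun A => ex (fun B => G A B ^+ 2)).
Proof.
rewrite !ex2E.
apply: (@sum_cauchy _ (fun u : {ffun I -> T} * {ffun J -> T} => pw u.1 * pw u.2)).
by move=> u; rewrite mulr_ge0 ?pw_ge0.
Qed.

Lemma ex_jensen I (F : {ffun I -> T} -> R) : (ex F) ^+ 2 <= ex (fun A => F A ^+ 2).
Proof.
have := ex_cauchy F (fun=> 1); rewrite (eq_ex (G := F)); last first.
  by move=> A; rewrite mulr1.
by rewrite ex_cst expr1n mulr1.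
Qed.

Definition dep I (P : {set I}) (F : {ffun I -> T} -> R) :=
  forall A B : {ffun I -> T}, {in P, A =1 B} -> F A = F B.

Lemma depS I (P Q : {set I}) F : P \subset Q -> dep P F -> dep Q F.
Proof. by move=> /subsetP PQ FP A B AB; apply: FP => i /PQ/AB. Qed.

Lemma depM I (P : {set I}) F G :
  dep P F -> dep P G -> dep P (fun A => F A * G A).
Proof. by move=> FP GP A B AB; rewrite (FP A B AB) (GP A B AB). Qed.

(** Conditional expectation given the coordinates in [Z], kept as a function of the whole
    configuration so that conditionings can be nested without changing the type. *)
Definition cond I (Z : {set I}) (F : {ffun I -> T} -> R) (A : {ffun I -> T}) : R :=
  ex (fun B => F (mix Z A B)).

Lemma dep_cond I (Z P : {set I}) F : dep P F -> dep (P :&: Z) (cond Z F).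
Proof.
move=> FP A B AB; apply: eq_ex => C; apply: FP => i iP; rewrite !ffunE.
by case: ifP => // iZ; apply: AB; rewrite inE iP.
Qed.

Lemma eq_cond I (Z : {set I}) F G A : F =1 G -> cond Z F A = cond Z G A.
Proof. by move=> FG; apply: eq_ex => B; exact: FG. Qed.

Lemma ex_cond I (Z : {set I}) F : ex (cond Z F) = ex F.
Proof. exact: ex_mix. Qed.

Lemma cond_id I (Z : {set I}) F A : dep Z F -> cond Z F A = F A.
Proof.
move=> FZ; rewrite -[RHS](ex_cst I); apply: eq_ex => B; apply: FZ => i iZ.
by rewrite ffunE iZ.
Qed.

Lemma cond0 I F (A : {ffun I -> T}) : cond set0 F A = ex F.
Proof. by apply: eq_ex => B; congr F; apply/ffunP => i; rewrite ffunE inE. Qed.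

Lemma cond_cond I (Z Y : {set I}) F A :
  cond Z (cond Y F) A = cond (Z :&: Y) F A.
Proof.
rewrite [RHS]/cond -(ex_mix Y); apply: eq_ex => B; apply: eq_ex => C.
congr F; apply/ffunP => i; rewrite !ffunE inE.
by case: (i \in Z); case: (i \in Y).
Qed.

(** By [ex_mix P] the resampling may use one copy on [P] and another off [P]. A coordinate that both
    functions read lies in [Z] and is not resampled, so the two factors see independent copies. *)
Lemma cond_indep I (Z P Q : {set I}) F G A : dep P F -> dep Q G ->
  P :&: Q \subset Z -> cond Z (fun A => F A * G A) A = cond Z F A * cond Z G A.
Proof.
move=> FP GQ /subsetP PQZ.
rewrite {1}/cond -(ex_mix P) {2}/cond -exZr; apply: eq_ex => B.
rewrite /cond -exZ; apply: eq_ex => C; congr (_ * _).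
  by apply: FP => i iP; rewrite !ffunE iP.
apply: GQ => i iQ; rewrite !ffunE; case: ifP => // iZ; case: ifP => // iP.
by rewrite PQZ ?inE ?iP in iZ.
Qed.

Lemma cond_pull I (Z : {set I}) F G A : dep Z F ->
  cond Z (fun A => F A * G A) A = F A * cond Z G A.
Proof.
move=> FZ; rewrite (@cond_indep _ Z Z [set: I]%SET) ?setIT //.
  by rewrite (cond_id _ FZ).
by move=> B C BC; congr G; apply/ffunP => i; rewrite BC ?inE.
Qed.

Lemma cond_cauchy I (Z : {set I}) F G A :
  (cond Z (fun A => F A * G A) A) ^+ 2
   <= cond Z (fun A => F A ^+ 2) A * cond Z (fun A => G A ^+ 2) A.
Proof. exact: ex_cauchy. Qed.

Lemma cond_ge0 I (Z : {set I}) F A : (forall A, 0 <= F A) -> 0 <= cond Z F A.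
Proof. by move=> F0; apply: ex_ge0. Qed.

Lemma cond_dep_eq I (Z Y P : {set I}) F A : dep P F -> P :&: Z = P :&: Y ->
  cond Z F A = cond Y F A.
Proof.
move=> FP ZY; apply: eq_ex => B; apply: FP => i iP; rewrite !ffunE.
by have := congr1 (fun S : {set I} => i \in S) ZY; rewrite !inE iP /= => ->.
Qed.

End ProductExpectation.

(** * The law of one attribute vector *)

Section AttributeLaw.
Variables (R : realType) (m : nat) (p : R).
Hypothesis p01 : 0 < p < 1.

Lemma mu_mp_ge0 (x : attr m) : 0 <= mu_mp p x.
Proof.
by case/andP: p01 => p0 p1; rewrite mulr_ge0 // exprn_ge0 ?subr_ge0 // ltW.
Qed.

Lemma mu_mp_sum1 : \sum_(x : attr m) mu_mp p x = 1.
Proof.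
transitivity (\sum_(x : attr m) \prod_i (if x i then p else 1 - p)).
  apply: eq_bigr => x _; rewrite (bigID x) /= /mu_mp.
  have wtE : wt x = #|[pred i | x i]|.
    by rewrite /wt -sum1_card [RHS]big_mkcond; apply: eq_bigr => i _; rewrite inE; case: (x i).
  congr (_ * _).
    by rewrite (eq_bigr (fun=> p)) ?big_const ?iter_mulr_1 ?wtE // => i ->.
  rewrite (eq_bigr (fun=> 1 - p)); last by move=> i /negPf ->.
  rewrite prodr_const wtE; congr (_ ^+ _).
  by rewrite -[X in (X - _)%N]card_ord -(cardC [pred i | x i]) addKn; apply: eq_card => i.
rewrite -(bigA_distr_bigA (fun _ b => if b : bool then p else 1 - p)).
by rewrite big1 // => i _; rewrite big_bool /= subrKC.
Qed.

End AttributeLaw.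

Section Enumeration.
Variables (I : finType) (V : Type) (v0 : V).

Lemma fnthE m s (w : {ffun 'I_s -> attr m}) k (ks : (k < s)%N) :
  fnth w k = w (Ordinal ks).
Proof. by rewrite /fnth insubT. Qed.

Lemma nth_codom_ord s (y : 'I_s -> V) k (ks : (k < s)%N) :
  nth v0 (codom y) k = y (Ordinal ks).
Proof.
rewrite /codom /image_mem (nth_map (Ordinal ks)) ?size_enum_ord //; congr y.
by apply: val_inj; rewrite /= nth_enum_ord.
Qed.

End Enumeration.

(** * Centred projections indexed by sets of coordinates *)

Section Psi.
Variables (R : realType) (m r : nat) (p : R) (h : {ffun 'I_r -> attr m} -> R).
Hypotheses (p01 : 0 < p < 1) (hsym : symmetric_fun h).
Variables (I : finType) (i0 : I).
Hypothesis rI : (r <= #|I|)%N.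

Local Notation ex := (ex (mu_mp p)).
Local Notation cond := (cond (mu_mp p)).
Local Notation a0 := ([ffun=> false] : attr m).

Let mu0 := @mu_mp_ge0 R m p p01.
Let mu1 := @mu_mp_sum1 R m p.

Definition hseq (s : seq (attr m)) : R := h [ffun i : 'I_r => nth a0 s i].

Lemma hseq_perm s t : size t = r -> perm_eq s t -> hseq s = hseq t.
Proof.
move=> /eqP szt; rewrite -[t]/(tval (Tuple szt)) => /tuple_permP [sg ->].
rewrite /hseq -[RHS](hsym sg); congr h; apply/ffunP => i; rewrite !ffunE.
by rewrite -!tnth_nth tnth_mktuple (tnth_nth a0).
Qed.

Lemma hproj_seq j s : (j <= r)%N -> size s = j ->
  hproj p h [ffun i : 'I_j => nth a0 s i]
  = ex (fun y : {ffun 'I_(r - j) -> attr m} => hseq (s ++ codom y)).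
Proof.
move=> jr szs; apply: eq_bigr => y _; congr (_ * h _); apply/ffunP => i.
rewrite !ffunE /glue3 subnKC // ltn_ord nth_cat szs.
case: ltnP => ij; first by rewrite fnthE ffunE.
have iy : (i - j < r - j)%N by rewrite ltn_sub2r // (leq_ltn_trans ij).
by rewrite (fnthE _ iy) (nth_codom_ord _ _ iy).
Qed.

Definition hbseq j (s : seq (attr m)) : R := hbar p h [ffun i : 'I_j => nth a0 s i].

Lemma hbseq_perm j s t : (j <= r)%N -> size t = j -> perm_eq s t ->
  hbseq j s = hbseq j t.
Proof.
move=> jr szt st; have szs : size s = j by rewrite (perm_size st).
rewrite /hbseq /hbar !hproj_seq //; congr (_ - _); apply: eq_ex => y.
by apply: hseq_perm; rewrite ?size_cat ?szt ?size_codom ?card_ord ?subnKC // perm_cat2r.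
Qed.

(* The paper's [\overline h_j] at the coordinates in [P], where [j] is the size of [P]. *)
Definition psi (P : {set I}) (A : {ffun I -> attr m}) : R :=
  hbseq #|P| [seq A i | i <- enum P].

Lemma dep_psi P : dep P (psi P).
Proof.
move=> A B AB; congr hbseq; apply/eq_in_map => i; rewrite mem_enum; exact: AB.
Qed.

(* Taking [take r s] to start with an enumeration of [P] exhibits [psi P] as a
   centered conditional expectation of a function that does not depend on [P]. *)
Lemma psi_cond (s : seq I) (P : {set I}) (A : {ffun I -> attr m}) : uniq s -> (r <= size s)%N -> (#|P| <= r)%N ->
  P =i take #|P| s ->
  let H := fun A : {ffun I -> attr m} => hseq [seq A i | i <- take r s] in
  psi P A = cond P H A - ex H.
Proof.
move=> us rs; set j := #|P| => jr Ps H.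
have js : (j <= size s)%N := leq_trans jr rs.
pose hp (A : {ffun I -> attr m}) :=
  hproj p h [ffun i : 'I_j => nth a0 [seq A i | i <- enum P] i].
have szP : size (enum P) = j by rewrite -cardE.
have permP : perm_eq (enum P) (take j s).
  apply: uniq_perm; rewrite ?enum_uniq ?take_uniq // => i.
  by rewrite mem_enum Ps.
have hpE B : cond P H B = hp B.
  rewrite /hp hproj_seq ?size_map //.
  pose e (k : 'I_(r - j)) := nth i0 s (j + k).
  have ltk (k : 'I_(r - j)) : (j + k < size s)%N.
    by apply: leq_trans rs; rewrite -ltn_subRL.
  rewrite -(ex_reindex mu1 (e := e)); last first.
    move=> k l /eqP; rewrite /e nth_uniq // eqn_add2l => /eqP; exact: val_inj.
  apply: eq_ex => C; apply: hseq_perm.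
    rewrite size_cat size_map szP size_codom card_ord subnKC //.
  have -> : take r s = take j s ++ take (r - j) (drop j s).
    by rewrite -[in LHS](subnKC jr) takeD.
  rewrite map_cat; apply: perm_cat.
    rewrite (_ : map _ _ = map B (take j s)); last first.
      by apply/eq_in_map => i; rewrite -Ps ffunE => ->.
    by apply: perm_map; rewrite perm_sym.
  rewrite (_ : map _ _ = codom [ffun k => C (e k)]) //.
  apply: (@eq_from_nth _ a0).
    rewrite size_map size_take size_drop size_codom card_ord.
    by case: ltnP => // le1; apply/eqP; rewrite eqn_leq le1 leq_sub2r.
  rewrite size_map size_take size_drop => k ksz.
  have kr : (k < r - j)%N.
    by move: ksz; case: (ltnP (r - j) (size s - j)) => // le1 lt2; apply: leq_trans lt2 le1.
  rewrite (nth_codom_ord _ _ kr) ffunE (nth_map i0) ?size_take ?size_drop //.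
  rewrite nth_take // nth_drop ffunE /e /=; case: ifP => //.
  have := us; rewrite -{1}(cat_take_drop j s) cat_uniq => /and3P[_ /hasPn nP _].
  rewrite Ps => inP; suff /nP : nth i0 s (j + k) \in drop j s by rewrite inP.
  by rewrite -nth_drop mem_nth // size_drop ltn_subRL (ltk (Ordinal kr)).
rewrite -(ex_cond mu1 P H) /psi /hbseq /hbar hpE; congr (_ - _).
rewrite (eq_ex _ (G := hp)) //.
pose e (k : 'I_j) := nth i0 (enum P) k.
rewrite -/(ex (fun x' : {ffun 'I_j -> attr m} => hproj p h x')).
rewrite -(ex_reindex mu1 (e := e)); last first.
  move=> k l /eqP; rewrite /e nth_uniq ?enum_uniq ?szP // => /eqP; exact: val_inj.
apply: eq_ex => C; congr hproj; apply/ffunP => k.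
by rewrite !ffunE (nth_map i0) // szP.
Qed.

(** The list [s] begins with [Z :&: P] and continues with the rest of [P]. By [psi_cond], [psi P]
    and [psi (Z :&: P)] are then centred conditional expectations of one and the same function, and
    the tower property relates them. *)
Lemma cond_psi (Z P : {set I}) (A : {ffun I -> attr m}) : (#|P| <= r)%N -> cond Z (psi P) A = psi (Z :&: P) A.
Proof.
move=> Pr; pose s := enum (Z :&: P) ++ enum (P :\: Z) ++ enum (~: P).
have us : uniq s.
  rewrite !cat_uniq !enum_uniq /= andbT; apply/andP; split; apply/hasPn => i.
    rewrite mem_cat !mem_enum !inE.
    by case: (i \in Z); case: (i \in P).
  by rewrite !mem_enum !inE => /negPf ->; rewrite andbF.
have szs : size s = #|I|.
  rewrite -(cardC P) !size_cat -!cardE addnA; congr (_ + _)%N; first last.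
    by apply: eq_card => i; rewrite !inE.
  by rewrite -(cardsID Z P) setIC.
have rs : (r <= size s)%N by rewrite szs.
have ZP : Z :&: P =i take #|Z :&: P| s.
  by move=> i; rewrite /s take_cat cardE ltnn subnn take0 cats0 mem_enum.
have PP : P =i take #|P| s.
  rewrite /s catA; have -> : #|P| = size (enum (Z :&: P) ++ enum (P :\: Z)).
    by rewrite size_cat -!cardE -(cardsID Z P) setIC.
  move=> i; rewrite take_size_cat // mem_cat !mem_enum !inE.
  by case: (i \in Z); case: (i \in P).
have ZPr : (#|Z :&: P| <= r)%N.
  by apply: leq_trans Pr; apply: subset_leq_card; exact: subsetIr.
rewrite (psi_cond A us rs ZPr ZP).
rewrite (eq_cond _ _ _ (fun A => psi_cond A us rs Pr PP)) -cond_cond //.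
by rewrite {1}/cond exB ex_cst.
Qed.

Lemma psi_set0 A : psi set0 A = 0.
Proof.
have us := enum_uniq I.
rewrite (@psi_cond (enum I)) ?enum_uniq ?cards0 -?cardE // ?cond0 ?subrr // => i.
by rewrite take0 inE.
Qed.

Lemma ex_psi (P : {set I}) : (#|P| <= r)%N -> ex (psi P) = 0.
Proof.
move=> Pr; rewrite -(cond0 (mu_mp p) _ (finfun (fun=> a0))) cond_psi // set0I.
exact: psi_set0.
Qed.

Lemma psi_image (f : I -> I) (P : {set I}) (A : {ffun I -> attr m}) : injective f -> (#|P| <= r)%N ->
  psi [set f i | i in P] A = psi P [ffun i => A (f i)].
Proof.
move=> finj Pr; rewrite /psi card_imset //.
rewrite (_ : [seq _ | i <- enum P] = [seq A i | i <- [seq f i | i <- enum P]]); last first.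
  by rewrite -map_comp; apply: eq_map => i; rewrite /= ffunE.
apply: hbseq_perm => //; first by rewrite !size_map -cardE.
apply: perm_map; apply: uniq_perm; rewrite ?enum_uniq ?map_inj_uniq ?enum_uniq //.
move=> i; rewrite mem_enum; apply/imsetP/mapP => -[k kP ->]; exists k => //.
  by rewrite mem_enum.
by rewrite mem_enum in kP.
Qed.

Lemma psi_top (P : {set I}) (A : {ffun I -> attr m}) : #|P| = r ->
  hseq [seq A i | i <- enum P]
  = psi P A + \sum_(x : {ffun 'I_r -> attr m}) muprod p x * hproj p h x.
Proof.
move=> Pr; rewrite /psi Pr /hbseq /hbar subrK hproj_seq ?size_map -?cardE //.
rewrite (eq_ex _ (G := fun=> hseq [seq A i | i <- enum P])) ?ex_cst // => y.
by rewrite (_ : codom y = [::]) ?cats0 //; apply/nilP; rewrite /nilp size_codom card_ord subnn.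
Qed.

End Psi.

(** * Contraction norms as iterated expectations *)

Section Contractions.
Variables (R : realType) (m r : nat) (p : R) (h : {ffun 'I_r -> attr m} -> R).
Hypotheses (p01 : 0 < p < 1) (hsym : symmetric_fun h).
Variables (I : finType) (i0 : I).
Hypothesis rI : (r <= #|I|)%N.

Local Notation ex := (ex (mu_mp p)).
Local Notation cond := (cond (mu_mp p)).
Local Notation psi := (psi p h).
Local Notation a0 := ([ffun=> false] : attr m).

Let mu1 := @mu_mp_sum1 R m p.

Lemma psi_seq (s : seq I) (P : {set I}) j (A : {ffun I -> attr m}) :
  uniq s -> P =i s -> size s = j -> (j <= r)%N ->
  psi P A = hbar p h [ffun i : 'I_j => A (nth i0 s i)].
Proof.
move=> us Ps szs jr.
have Pj : #|P| = j by rewrite (eq_card Ps) (card_uniqP us).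
rewrite /psi Pj (hbseq_perm _ hsym jr (t := [seq A i | i <- s])) ?size_map //.
  by congr hbar; apply/ffunP => k; rewrite !ffunE (nth_map i0) // szs.
apply: perm_map; apply: uniq_perm; rewrite ?enum_uniq // => i.
by rewrite mem_enum Ps.
Qed.

(** The blocks of a contraction are tuples of different lengths. Each is read off an independent
    full configuration, at the coordinates that [s] assigns to its argument positions, so that
    contractions and conditional expectations live on the same space. *)
Lemma contr_norm2_ex k l a b (f : {ffun 'I_k -> attr m} -> R)
    (g : {ffun 'I_l -> attr m} -> R) (s : seq I) :
  (a <= b)%N -> (b <= k)%N -> (b <= l)%N -> (l <= k)%N -> uniq s ->
  (k <= size s)%N ->
  contr_norm2 p a b f g =
  ex (fun X => ex (fun Y => ex (fun Z => (ex (fun W : {ffun I -> attr m} =>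
    f [ffun i : 'I_k => if (i < a)%N then W (nth i0 s i) else
         if (i < b)%N then X (nth i0 s i) else Y (nth i0 s i)] *
    g [ffun i : 'I_l => if (i < a)%N then W (nth i0 s i) else
         if (i < b)%N then X (nth i0 s i) else Z (nth i0 s i)])) ^+ 2))).
Proof.
move=> ab bk bl lk us ks.
have inj c d : (c + d <= k)%N -> injective (fun u : 'I_d => nth i0 s (c + u)).
  move=> cdk u v /eqP; rewrite nth_uniq ?eqn_add2l //.
  - by move=> /eqP; exact: val_inj.
  - by apply: leq_trans ks; apply: leq_trans cdk; rewrite ltn_add2l.
  - by apply: leq_trans ks; apply: leq_trans cdk; rewrite ltn_add2l.
transitivity (ex (fun x : {ffun 'I_(b - a) -> attr m} =>
    ex (fun y : {ffun 'I_(k - b) -> attr m} =>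
    ex (fun z : {ffun 'I_(l - b) -> attr m} => Defs.contraction p f g x y z ^+ 2)))).
  apply: eq_bigr => x _; rewrite mulr_sumr; apply: eq_bigr => y _.
  by rewrite !mulr_sumr; apply: eq_bigr => z _; rewrite !mulrA.
have ia : (a + (b - a) <= k)%N by rewrite subnKC.
have ib : (b + (k - b) <= k)%N by rewrite subnKC.
have ib' : (b + (l - b) <= k)%N by rewrite subnKC.
rewrite -(ex_reindex mu1 _ (inj a _ ia)); apply: eq_ex => X.
rewrite -(ex_reindex mu1 _ (inj b _ ib)); apply: eq_ex => Y.
rewrite -(ex_reindex mu1 _ (inj b _ ib')); apply: eq_ex => Z.
congr (_ ^+ 2).
rewrite /Defs.contraction (eq_bigr (fun w => muprod p w * (
   f [ffun i : 'I_k => glue3 w [ffun u : 'I_(b - a) => X (nth i0 s (a + u))]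
        [ffun u : 'I_(k - b) => Y (nth i0 s (b + u))] i] *
   g [ffun i : 'I_l => glue3 w [ffun u : 'I_(b - a) => X (nth i0 s (a + u))]
        [ffun u : 'I_(l - b) => Z (nth i0 s (b + u))] i]))); last first.
  by move=> w _; rewrite mulrA.
rewrite -/(ex (fun w : {ffun 'I_a -> attr m} => _)).
rewrite -(ex_reindex mu1 _ (inj 0 a (leq_trans ab bk))); apply: eq_ex => W.
have glueE d (V : {ffun I -> attr m}) (u : 'I_d) :
  glue3 [ffun j : 'I_a => W (nth i0 s (0 + j))]
    [ffun u : 'I_(b - a) => X (nth i0 s (a + u))]
    [ffun u : 'I_(d - b) => V (nth i0 s (b + u))] u =
  if (u < a)%N then W (nth i0 s u) else
    if (u < b)%N then X (nth i0 s u) else V (nth i0 s u).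
  rewrite /glue3 subnKC //; case: ltnP => ua; first by rewrite fnthE ffunE.
  case: ltnP => ub.
    have lt1 : (u - a < b - a)%N by rewrite ltn_sub2r // (leq_ltn_trans ua).
    by rewrite (fnthE _ lt1) ffunE /= subnKC.
  have bd : (b <= d)%N by apply: leq_trans ub (ltnW (ltn_ord u)).
  have lt1 : (u - a - (b - a) < d - b)%N.
    by rewrite -subnDA subnKC // ltn_sub2r // (leq_ltn_trans ub).
  by rewrite (fnthE _ lt1) ffunE /= -subnDA !subnKC.
by congr (f _ * g _); apply/ffunP => u; rewrite !ffunE glueE.
Qed.

Definition bracket (n : nat) : R :=
  \sum_(j < r.+1) \sum_(i < j)
     contr_norm2 p i j (@hbar _ _ p _ h j) (@hbar _ _ p _ h j) / (n%:R) ^+ (3 * j - i)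
  + \sum_(j < r.+1) \sum_(i < j | (1 <= i)%N)
     (contr_norm2 p i i (@hbar _ _ p _ h j) (@hbar _ _ p _ h j) / (n%:R) ^+ (2 * j)
      + contr_norm2 p i i (@hbar _ _ p _ h j) (@hbar _ _ p _ h i) / (n%:R) ^+ (j + i)).

Lemma contr_norm2_ge0 k l a b (f : {ffun 'I_k -> attr m} -> R)
  (g : {ffun 'I_l -> attr m} -> R) : 0 <= contr_norm2 p a b f g.
Proof.
have pw0 s (w : {ffun 'I_s -> attr m}) : 0 <= muprod p w.
  by apply: prodr_ge0 => i _; exact: mu_mp_ge0.
do 3 (apply: sumr_ge0 => ? _).
by rewrite mulr_ge0 ?sqr_ge0 // !mulr_ge0.
Qed.

Section Bracket.
Variable n : nat.
Hypothesis n_gt0 : (0 < n)%N.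
Local Notation B := (bracket n).
Local Notation N := (n%:R : R).

Let div_ge0 c k : 0 <= c -> 0 <= c / N ^+ k.
Proof. by move=> c0; rewrite divr_ge0 ?exprn_ge0 ?ler0n. Qed.

Let N_gt0 k : 0 < N ^+ k.
Proof. by rewrite exprn_gt0 ?ltr0n. Qed.

Lemma bracket_ge0 : 0 <= B.
Proof.
rewrite addr_ge0 //; apply: sumr_ge0 => j _; apply: sumr_ge0 => i _.
  by rewrite div_ge0 ?contr_norm2_ge0.
by rewrite addr_ge0 // div_ge0 ?contr_norm2_ge0.
Qed.

Let le_sum2 (Q : nat -> bool) (c : nat -> nat -> R) j i :
  (forall j i, 0 <= c j i) -> (i < j)%N -> (j <= r)%N -> Q i ->
  c j i <= \sum_(j < r.+1) \sum_(i < j | Q i) c j i.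
Proof.
move=> c0 ij jr Qi; rewrite (bigD1 (Ordinal (jr : (j < r.+1)%N))) //=.
rewrite (bigD1 (Ordinal ij)) //= -addrA lerDl addr_ge0 //.
  by apply: sumr_ge0.
by apply: sumr_ge0 => ? _; apply: sumr_ge0.
Qed.

Let c1 j i :=
  contr_norm2 p i j (@hbar _ _ p _ h j) (@hbar _ _ p _ h j) / N ^+ (3 * j - i).
Let c2 j i :=
  contr_norm2 p i i (@hbar _ _ p _ h j) (@hbar _ _ p _ h j) / N ^+ (2 * j).
Let c3 j i :=
  contr_norm2 p i i (@hbar _ _ p _ h j) (@hbar _ _ p _ h i) / N ^+ (j + i).
Let c1_ge0 j i : 0 <= c1 j i. Proof. by rewrite div_ge0 ?contr_norm2_ge0. Qed.
Let c2_ge0 j i : 0 <= c2 j i. Proof. by rewrite div_ge0 ?contr_norm2_ge0. Qed.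
Let c3_ge0 j i : 0 <= c3 j i. Proof. by rewrite div_ge0 ?contr_norm2_ge0. Qed.

Let le_c1 j i : (i < j)%N -> (j <= r)%N -> c1 j i <= B.
Proof.
move=> ij jr; apply: le_trans (le_sum2 (Q := predT) c1_ge0 ij jr _) _ => //.
by rewrite /bracket lerDl; do 2 (apply: sumr_ge0 => ? _); rewrite addr_ge0 ?c2_ge0 ?c3_ge0.
Qed.

Let le_c23 j i : (0 < i)%N -> (i < j)%N -> (j <= r)%N -> c2 j i + c3 j i <= B.
Proof.
move=> i0' ij jr.
apply: le_trans (le_sum2 (Q := leq 1) (c := fun j i => c2 j i + c3 j i) _ ij jr i0') _.
  by move=> *; rewrite addr_ge0 ?c2_ge0 ?c3_ge0.
by rewrite /bracket lerDr; do 2 (apply: sumr_ge0 => ? _); exact: c1_ge0.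
Qed.

Lemma contr_le1 j i : (i < j)%N -> (j <= r)%N ->
  contr_norm2 p i j (@hbar _ _ p _ h j) (@hbar _ _ p _ h j) <= B * N ^+ (3 * j - i).
Proof. by move=> ij jr; rewrite -ler_pdivrMr //; exact: le_c1. Qed.

Lemma contr_le2 j i : (0 < i)%N -> (i < j)%N -> (j <= r)%N ->
  contr_norm2 p i i (@hbar _ _ p _ h j) (@hbar _ _ p _ h j) <= B * N ^+ (2 * j).
Proof.
move=> *; rewrite -ler_pdivrMr //; apply: le_trans (@le_c23 j i _ _ _) => //.
by rewrite lerDl c3_ge0.
Qed.

Lemma contr_le3 j i : (0 < i)%N -> (i < j)%N -> (j <= r)%N ->
  contr_norm2 p i i (@hbar _ _ p _ h j) (@hbar _ _ p _ h i) <= B * N ^+ (j + i).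
Proof.
move=> *; rewrite -ler_pdivrMr //; apply: le_trans (@le_c23 j i _ _ _) => //.
by rewrite lerDr c2_ge0.
Qed.

Let uniq_split (P Y : {set I}) : Y \subset P ->
  [/\ uniq (enum Y ++ enum (P :\: Y)), P =i enum Y ++ enum (P :\: Y)
    & size (enum Y ++ enum (P :\: Y)) = #|P|].
Proof.
move=> YP; split.
- rewrite cat_uniq !enum_uniq andbT; apply/hasPn => i.
  by rewrite !mem_enum inE => /andP[].
- move=> i; rewrite mem_cat !mem_enum inE.
  by case: (boolP (i \in Y)) => // /(subsetP YP) ->.
- by rewrite size_cat -!cardE -(cardsID Y P) (setIidPr YP).
Qed.

Let nth_split (P Y : {set I}) k : Y \subset P -> (k < #|P|)%N ->
  (nth i0 (enum Y ++ enum (P :\: Y)) k \in Y) = (k < #|Y|)%N.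
Proof.
move=> YP kP; rewrite nth_cat -cardE; case: ltnP => kY.
  by rewrite -mem_enum mem_nth // -cardE.
have : nth i0 (enum (P :\: Y)) (k - #|Y|) \in enum (P :\: Y).
  rewrite mem_nth // -cardE cardsD (setIidPr YP) ltn_sub2r //.
  exact: leq_ltn_trans kP.
by rewrite mem_enum inE => /andP[/negPf].
Qed.

(** The left side is the squared norm of [h *_j^i h] for h = \overline h_j, with [j = #|P|] and
    [i = #|P :\: Y|]. Enumerating [P :\: Y] first makes it the integrated block and [Y] the shared
    one, and [3 * j - i] is [2 * #|P| + #|Y|]. That [Y] is nonempty means [i < j]. *)
Lemma cond_sqr_bound (P Y : {set I}) : (#|P| <= r)%N -> Y \subset P ->
  (0 < #|Y|)%N ->
  ex (fun A => cond Y (fun A => psi P A ^+ 2) A ^+ 2) <= B * N ^+ (2 * #|P| + #|Y|).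
Proof.
move=> Pr YP Y0; have YleP := subset_leq_card YP.
have DP : P :\: Y \subset P := subsetDl _ _.
have cD : #|P :\: Y| = (#|P| - #|Y|)%N by rewrite cardsD (setIidPr YP).
have ltD : (#|P :\: Y| < #|P|)%N by rewrite cD; lia.
have [us Ps szs] := uniq_split DP.
apply: le_trans (_ : contr_norm2 p #|P :\: Y| #|P| (@hbar _ _ p _ h #|P|)
   (@hbar _ _ p _ h #|P|) <= _); last first.
  apply: le_trans (contr_le1 ltD Pr) _; rewrite le_eqVlt; apply/orP; left.
  by apply/eqP; congr (_ * _ ^+ _); rewrite cD; lia.
rewrite (contr_norm2_ex _ _ (ltnW ltD) (leqnn _) (leqnn _) (leqnn _) us) ?szs //.
rewrite le_eqVlt; apply/orP; left; apply/eqP; apply: eq_ex => X.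
rewrite -[LHS](ex_cst mu1 I); apply: eq_ex => Y'.
rewrite -[LHS](ex_cst mu1 I); apply: eq_ex => Z; congr (_ ^+ 2); apply: eq_ex => W.
rewrite expr2 !(psi_seq _ us Ps szs Pr);  congr (_ * _); congr hbar;
by apply/ffunP => k; rewrite !ffunE (ltn_ord k) -(nth_split DP) // !inE Ps mem_nth ?szs // andbT; case: ifP.
Qed.

(** A contraction of type [*_i^i] with [i = #|P :&: Z|]: [W] fills the integrated block, while [A]
    and [A'] supply the private arguments of the two factors. *)
Lemma cond_two_bound (P Z : {set I}) : (#|P| <= r)%N ->
  (0 < #|P :&: Z|)%N -> (#|P :&: Z| < #|P|)%N ->
  ex (fun A => ex (fun A' => ex (fun W =>
     psi P (mix Z W A) * psi P (mix Z W A')) ^+ 2)) <= B * N ^+ (2 * #|P|).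
Proof.
move=> Pr Y0 YP; have sY : P :&: Z \subset P := subsetIl _ _.
have [us Ps szs] := uniq_split sY.
apply: le_trans (contr_le2 Y0 YP Pr).
rewrite (contr_norm2_ex _ _ (leqnn _) (ltnW YP) (ltnW YP) (leqnn _) us) ?szs //.
rewrite le_eqVlt; apply/orP; left; apply/eqP.
rewrite -[LHS](ex_cst mu1 I); apply: eq_ex => X.
apply: eq_ex => Y; apply: eq_ex => Y'; congr (_ ^+ 2); apply: eq_ex => W.
rewrite !(psi_seq _ us Ps szs Pr); congr (_ * _); congr hbar;
by apply/ffunP => k; rewrite !ffunE -(nth_split sY) // !inE Ps mem_nth ?szs //; case: ifP.
Qed.

(** The mixed contraction: within [P], conditioning on [Z] integrates exactly [Q]. This uses up
    every argument of the second factor and leaves [P :\: Q] free in the first. *)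
Lemma cond_sub_bound (P Q Z : {set I}) : (#|P| <= r)%N -> Q \subset P ->
  (0 < #|Q|)%N -> (#|Q| < #|P|)%N -> P :&: Z = P :\: Q ->
  ex (fun A => cond Z (fun A => psi P A * psi Q A) A ^+ 2) <= B * N ^+ (#|P| + #|Q|).
Proof.
move=> Pr QP Q0 ltQP PZ.
have [us Ps szs] := uniq_split QP.
have Zk k : k \in P -> (k \in Z) = (k \notin Q).
  by move=> kP; have := congr1 (fun S : {set I} => k \in S) PZ; rewrite !inE kP /= andbT.
apply: le_trans (contr_le3 Q0 ltQP Pr).
rewrite (contr_norm2_ex _ _ (leqnn _) (ltnW ltQP) (leqnn _) (ltnW ltQP) us) ?szs //.
rewrite le_eqVlt; apply/orP; left; apply/eqP.
rewrite -[LHS](ex_cst mu1 I); apply: eq_ex => X; apply: eq_ex => Y.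
rewrite -[LHS](ex_cst mu1 I); apply: eq_ex => Y'; congr (_ ^+ 2); apply: eq_ex => W.
rewrite (psi_seq _ us Ps szs Pr).
rewrite (@psi_seq (enum Q) Q #|Q| _ (enum_uniq _)) ?(leq_trans (ltnW ltQP)) -?cardE //; last first.
  by move=> k; rewrite mem_enum.
congr (_ * _); congr hbar; apply/ffunP => k; rewrite !ffunE.
  by rewrite Zk ?Ps ?mem_nth ?szs ?nth_split //; case: (k < #|Q|)%N.
have kQ : nth i0 (enum Q) k \in Q by rewrite -mem_enum mem_nth // -cardE.
by rewrite Zk ?(subsetP QP) // kQ ltn_ord nth_cat -cardE ltn_ord.
Qed.

End Bracket.
End Contractions.

(** * Moments of products of four projections *)

Section FourthMoments.
Variables (R : realFieldType) (T : finType) (mu : T -> R).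
Hypotheses (mu_ge0 : forall t, 0 <= mu t) (mu_sum1 : \sum_t mu t = 1).
Local Notation ex := (ex mu).
Local Notation cond := (cond mu).
Variables (I : finType) (psi : {set I} -> {ffun I -> T} -> R) (r : nat) (B N : R).
Hypotheses (B_ge0 : 0 <= B) (N_ge1 : 1 <= N).
Hypothesis dep_psi : forall P, dep P (psi P).
Hypothesis psi_set0 : forall A, psi finset.set0 A = 0.
Hypothesis cond_psi : forall (Z P : {set I}) A,
  (#|P| <= r)%N -> cond Z (psi P) A = psi (Z :&: P) A.
Hypothesis sqr_bound : forall P Y : {set I}, (#|P| <= r)%N -> Y \subset P ->
  (0 < #|Y|)%N ->
  ex (fun A => cond Y (fun A => psi P A ^+ 2) A ^+ 2) <= B * N ^+ (2 * #|P| + #|Y|).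
Hypothesis two_bound : forall P Z : {set I}, (#|P| <= r)%N ->
  (0 < #|P :&: Z|)%N -> (#|P :&: Z| < #|P|)%N ->
  ex (fun A => ex (fun A' => ex (fun W =>
     psi P (mix Z W A) * psi P (mix Z W A')) ^+ 2)) <= B * N ^+ (2 * #|P|).
Hypothesis sub_bound : forall P Q Z : {set I}, (#|P| <= r)%N -> Q \subset P ->
  (0 < #|Q|)%N -> (#|Q| < #|P|)%N -> P :&: Z = P :\: Q ->
  ex (fun A => cond Z (fun A => psi P A * psi Q A) A ^+ 2) <= B * N ^+ (#|P| + #|Q|).

Let BN_ge0 k : 0 <= B * N ^+ k.
Proof. by rewrite mulr_ge0 // exprn_ge0 // (le_trans ler01). Qed.

(** The common end of the Cauchy-Schwarz arguments: both factors carry [B] to the first power, hence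
    so does their geometric mean, and only exponents of [N] remain to be compared. *)
Lemma ler_sqrM (x a b : R) k l e : x ^+ 2 <= a * b -> 0 <= a -> 0 <= b ->
  a <= B * N ^+ k -> b <= B * N ^+ l -> (k + l <= 2 * e)%N -> x <= B * N ^+ e.
Proof.
move=> xab a0 b0 ak bl kle; rewrite -[x <= _]orFb.
have [x0|x0] := leP x 0; first by apply: le_trans x0 _.
rewrite -(@ler_pXn2r _ 2) ?nnegrE ?(ltW x0) //.
apply: le_trans xab _; apply: le_trans (ler_pM a0 b0 ak bl) _.
rewrite mulrACA -exprD exprMn -expr2 ler_wpM2l ?sqr_ge0 // -exprM mulnC.
by rewrite ler_weXn2l.
Qed.

(** By Jensen the square is at most the bound for conditioning on a single point of [P]. The [+ 1]
    in the exponent is the cost of that point. *)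
Lemma ex_sqr_bound (P : {set I}) : (#|P| <= r)%N ->
  ex (fun A => psi P A ^+ 2) ^+ 2 <= B * N ^+ (2 * #|P| + 1).
Proof.
move=> Pr; have [->|[i iP]] := set_0Vmem P.
  rewrite (eq_ex _ (G := fun=> 0)); last by move=> A; rewrite psi_set0 expr0n.
  by rewrite ex_cst // expr0n BN_ge0.
have := @sqr_bound P [set i]%SET Pr; rewrite sub1set cards1 => /(_ iP isT).
apply: le_trans; rewrite -(ex_cond mu_sum1 [set i]%SET); exact: ex_jensen.
Qed.

Lemma ex_prod (P Q : {set I}) F G : dep P F -> dep Q G -> [disjoint P & Q] ->
  ex (fun A => F A * G A) = ex F * ex G.
Proof.
move=> FP GQ; rewrite -setI_eq0 => /eqP PQ.
have [A _|I0] := pickP (fun A : {ffun I -> T} => true).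
  by rewrite -!(cond0 _ _ A) (cond_indep mu_sum1 A FP GQ) // PQ sub0set.
have := pw_sum1 mu_sum1 I; rewrite big1 => [/eqP|A _]; first by rewrite eq_sym oner_eq0.
by have := I0 A.
Qed.

(** The cases that cost an extra factor [N]: no coordinate links [P] to [Q], or none links the pair
    to [Z]. *)
Let bad (P Q Z : {set I}) : bool := (P :&: Q == set0) || ((P :|: Q) :&: Z == set0).

(** The square is written with two independent copies [C] and [D] of the coordinates outside [Z].
    For fixed copies, the factors from [P] and from [Q] read disjoint parts of [Z] and so factor.
    Cauchy-Schwarz over the copies then leaves one contraction for each set. *)
Lemma cond_prod_two (P Q Z : {set I}) : (#|P| <= r)%N -> (#|Q| <= r)%N ->
  P :&: Q :&: Z = set0 -> P :&: Z != set0 -> Q :&: Z != set0 ->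
  P :\: Z != set0 -> Q :\: Z != set0 ->
  ex (fun A => cond Z (fun A => psi P A * psi Q A) A ^+ 2) <= B * N ^+ (#|P| + #|Q|).
Proof.
move=> Pr Qr PQZ PZ QZ PnZ QnZ.
pose f (P : {set I}) (C D : {ffun I -> T}) :=
  ex (fun A => psi P (mix Z A C) * psi P (mix Z A D)).
have -> : ex (fun A => cond Z (fun A => psi P A * psi Q A) A ^+ 2)
  = ex (fun C => ex (fun D => f P C D * f Q C D)).
  transitivity (ex (fun A => ex (fun C => ex (fun D =>
     (psi P (mix Z A C) * psi P (mix Z A D)) * (psi Q (mix Z A C) * psi Q (mix Z A D)))))).
    apply: eq_ex => A; rewrite /cond expr2 -exZr; apply: eq_ex => C.
    by rewrite -exZ; apply: eq_ex => D; rewrite mulrACA.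
  rewrite ex_exchange; apply: eq_ex => C; rewrite ex_exchange; apply: eq_ex => D.
  have depm S E : dep (S :&: Z) (fun A => psi S (mix Z A E)).
    move=> A A' AA'; apply: dep_psi => i iS; rewrite !ffunE; case: ifP => // iZ.
    by apply: AA'; rewrite inE iS.
  apply: (@ex_prod (P :&: Z) (Q :&: Z)); try by apply: depM.
  by rewrite -setI_eq0 setIACA setIid PQZ.
have two (S : {set I}) : (#|S| <= r)%N -> S :&: Z != set0 -> S :\: Z != set0 ->
    ex (fun C => ex (fun D => f S C D ^+ 2)) <= B * N ^+ (2 * #|S|).
  move=> Sr SZ SnZ; apply: two_bound => //; first by rewrite card_gt0.
  by rewrite -(cardsID Z S) -addn1 leq_add2l card_gt0.
apply: (ler_sqrM (ex2_cauchy mu_ge0 _ _) _ _ (two P Pr PZ PnZ) (two Q Qr QZ QnZ)).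
- by apply: ex_ge0 => // C; apply: ex_ge0 => // D; exact: sqr_ge0.
- by apply: ex_ge0 => // C; apply: ex_ge0 => // D; exact: sqr_ge0.
- by rewrite mulnDr.
Qed.

(** After conditional Cauchy-Schwarz, the two conditional second moments share only the coordinates
    in [x]. Given these they are independent, and a second Cauchy-Schwarz leads to [sqr_bound] with
    [Y = x] on both sides. *)
Lemma cond_prod_meet (P Q Z : {set I}) : (#|P| <= r)%N -> (#|Q| <= r)%N ->
  P :&: Q :&: Z != set0 ->
  ex (fun A => cond Z (fun A => psi P A * psi Q A) A ^+ 2)
  <= B * N ^+ (#|P| + #|Q| + #|P :&: Q :&: Z|).
Proof.
move=> Pr Qr; set x := P :&: Q :&: Z => x0.
have xP : x \subset P by rewrite /x -setIA subsetIl.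
have xQ : x \subset Q by rewrite /x (setIC P) -setIA subsetIl.
have xZ : x :&: Z = x by apply/setIidPl; exact: subsetIr.
pose f (P : {set I}) A := cond x (fun A => psi P A ^+ 2) A.
have f0 S A : 0 <= f S A by apply: cond_ge0 => // ?; exact: sqr_ge0.
apply: le_trans (_ : ex (fun A => f P A * f Q A) <= _).
  apply: le_trans (ler_ex mu_ge0 (fun A => cond_cauchy mu_ge0 Z (psi P) (psi Q) A)) _.
  rewrite -(ex_cond mu_sum1 x) le_eqVlt; apply/orP; left; apply/eqP.
  have dep2 S : dep S (fun A => psi S A ^+ 2).
    by move=> A A' AA'; congr (_ ^+ 2); apply: dep_psi.
  apply: eq_ex => A; rewrite (cond_indep mu_sum1 A (dep_cond mu (dep2 P)) (dep_cond mu (dep2 Q))).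
    by rewrite !cond_cond // xZ.
  by rewrite setIACA setIid.
have x1 : (0 < #|x|)%N by rewrite card_gt0.
apply: (ler_sqrM (ex_cauchy mu_ge0 _ _) _ _ (sqr_bound Pr xP x1) (sqr_bound Qr xQ x1)).
- by apply: ex_ge0 => // A; exact: sqr_ge0.
- by apply: ex_ge0 => // A; exact: sqr_ge0.
- lia.
Qed.

(** If no coordinate is common to all three sets, then either [P] and [Q] are disjoint and lie in
    [Z], or [P :&: Q] is exactly what is integrated. In the second case equality gives a squared
    second moment, strict inclusion the mixed contraction, and neither inclusion [cond_prod_two].
    Disjointness and equality are the [bad] outcomes. *)
Lemma cond_prod_reduced (P Q Z : {set I}) : (#|P| <= r)%N -> (#|Q| <= r)%N ->
  P :\: Q \subset Z -> Q :\: P \subset Z ->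
  ex (fun A => cond Z (fun A => psi P A * psi Q A) A ^+ 2)
  <= B * N ^+ (#|P| + #|Q| + #|P :&: Q :&: Z| + bad P Q Z).
Proof.
move=> Pr Qr PQ QP.
have inPQ i : i \in P -> i \notin Q -> i \in Z.
  by move=> iP iQ; apply: (subsetP PQ); rewrite inE iP iQ.
have inQP i : i \in Q -> i \notin P -> i \in Z.
  by move=> iP iQ; apply: (subsetP QP); rewrite inE iP iQ.
have [x0|x0] := eqVneq (P :&: Q :&: Z) set0; last first.
  apply: le_trans (cond_prod_meet Pr Qr x0) _.
  by rewrite ler_wpM2l // ler_weXn2l // leq_addr.
have inPQZ i : i \in P -> i \in Q -> i \notin Z.
  move=> iP iQ; apply/negP => iZ; have := in_set0 i.
  by rewrite -x0 !inE iP iQ iZ.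
have [PQ0|PQ0] := eqVneq (P :&: Q) set0.
  have PZ : P \subset Z.
    apply/subsetP => i iP; apply: inPQ => //; apply/negP => iQ.
    by have := in_set0 i; rewrite -PQ0 inE iP iQ.
  have QZ : Q \subset Z.
    apply/subsetP => i iQ; apply: inQP => //; apply/negP => iP.
    by have := in_set0 i; rewrite -PQ0 inE iP iQ.
  have -> : bad P Q Z by rewrite /bad PQ0 eqxx.
  rewrite (eq_ex _ (G := fun A => psi P A ^+ 2 * psi Q A ^+ 2)); last first.
    move=> A; rewrite cond_id ?exprMn //.
    by apply: depM; [exact: (depS PZ (@dep_psi P))|exact: (depS QZ (@dep_psi Q))].
  rewrite (@ex_prod P Q) -?setI_eq0 ?PQ0 //; last 2 first.
  - by move=> A A' AA'; congr (_ ^+ 2); apply: dep_psi.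
  - by move=> A A' AA'; congr (_ ^+ 2); apply: dep_psi.
  have le2 (a b : R) : (a * b) ^+ 2 <= a ^+ 2 * b ^+ 2 by rewrite exprMn.
  apply: (ler_sqrM (le2 _ _) _ _ (ex_sqr_bound Pr) (ex_sqr_bound Qr)); rewrite ?sqr_ge0 //.
  by rewrite set0I cards0; lia.
have [i0 i0PQ] := set0Pn _ PQ0; have /andP[iP iQ] : (i0 \in P) && (i0 \in Q).
  by rewrite inE in i0PQ.
have iZ := inPQZ _ iP iQ.
have PZ : P :&: Z = P :\: Q.
  apply/setP => i; rewrite !inE andbC; case: (boolP (i \in P)) => iP'; rewrite ?andbF //= !andbT.
  by case: (boolP (i \in Q)) => iQ' /=; [apply: negbTE; exact: inPQZ|exact: inPQ].
have QZ : Q :&: Z = Q :\: P.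
  apply/setP => i; rewrite !inE andbC; case: (boolP (i \in Q)) => iP'; rewrite ?andbF //= !andbT.
  by case: (boolP (i \in P)) => iQ' /=; [apply: negbTE; exact: inPQZ|exact: inQP].
rewrite x0 cards0 addn0.
have sub (S S' : {set I}) : (#|S| <= r)%N -> S' \subset S -> i0 \in S' -> S' != S ->
  S :&: Z = S :\: S' ->
  ex (fun A => cond Z (fun A => psi S A * psi S' A) A ^+ 2) <= B * N ^+ (#|S| + #|S'|).
  move=> Sr S'S iS' neq SZ; apply: sub_bound => //.
    by rewrite card_gt0; apply/set0Pn; exists i0.
  by apply: proper_card; rewrite properEneq neq.
have [PsQ|PsQ] := boolP (P \subset Q).
  have [eqPQ|nPQ] := eqVneq P Q; last first.
    apply: le_trans (_ : _ <= B * N ^+ (#|Q| + #|P|)) _.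
      rewrite (eq_ex _ (G := fun A => cond Z (fun A => psi Q A * psi P A) A ^+ 2)).
        exact: sub.
      by move=> A; congr (_ ^+ 2); apply: eq_cond => C; rewrite mulrC.
    by rewrite ler_wpM2l // ler_weXn2l // addnC leq_addr.
  have -> : bad P Q Z.
    by rewrite /bad -eqPQ setUid; move: x0; rewrite -eqPQ setIid => ->; rewrite eqxx orbT.
  rewrite (eq_ex _ (G := fun=> ex (fun A => psi P A ^+ 2) ^+ 2)); last first.
    move=> A; congr (_ ^+ 2); rewrite -(cond0 _ _ A) -eqPQ.
    rewrite (@cond_dep_eq _ _ _ _ _ set0 P) ?setI0 //.
    - by apply: depM; apply: dep_psi.
    - by move: x0; rewrite -eqPQ setIid.
  rewrite ex_cst //; apply: le_trans (ex_sqr_bound Pr) _; rewrite -eqPQ.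
  by rewrite mul2n -addnn.
have [QsP|QsP] := boolP (Q \subset P).
  apply: le_trans (_ : _ <= B * N ^+ (#|P| + #|Q|)) _; last first.
    by rewrite ler_wpM2l // ler_weXn2l // leq_addr.
  by apply: sub => //; apply: contraNneq PsQ => ->.
apply: le_trans (_ : _ <= B * N ^+ (#|P| + #|Q|)) _; last first.
  by rewrite ler_wpM2l // ler_weXn2l // leq_addr.
apply: cond_prod_two => //; rewrite ?PZ ?QZ ?setD_eq0 //.
- by apply/subsetPn; exists i0.
- by apply/subsetPn; exists i0.
Qed.

(** Coordinates of one set that lie neither in the other set nor in [Z] are averaged out beforehand
    by [cond_psi]. This replaces [P] and [Q] by [P'] and [Q'], and only the remaining coordinates
    count in the exponent. *)
Lemma cond_prod_bound (P Q Z : {set I}) : (#|P| <= r)%N -> (#|Q| <= r)%N ->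
  ex (fun A => cond Z (fun A => psi P A * psi Q A) A ^+ 2)
  <= B * N ^+ (#|P :&: Z| + #|Q :&: Z| + #|P :&: Q :&: Z|
       + 2 * #|(P :&: Q) :\: Z| + bad P Q Z).
Proof.
move=> Pr Qr.
pose P' := (Q :|: Z) :&: P; pose Q' := (P :|: Z) :&: Q.
have red A : cond Z (fun A => psi P A * psi Q A) A
  = cond Z (fun A => psi P' A * psi Q' A) A.
  have ZU (S : {set I}) : Z :&: (S :|: Z) = Z by rewrite setKU.
  have condU (S : {set I}) F : cond Z F A = cond Z (cond (S :|: Z) F) A.
    by rewrite cond_cond // ZU.
  rewrite (condU Q); transitivity (cond Z (fun A => psi P' A * psi Q A) A).
    apply: eq_cond => C.
    rewrite (eq_cond _ _ _ (G := fun A => psi Q A * psi P A)); last by move=> D; rewrite mulrC.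
    rewrite cond_pull ?cond_psi // 1?mulrC //.
    by apply: depS (@dep_psi Q); exact: subsetUl.
  rewrite (condU P); apply: eq_cond => C; rewrite cond_pull ?cond_psi //.
  apply: depS (@dep_psi P'); apply: subset_trans (subsetIr _ _) (subsetUl _ _).
have memP i : (i \in P') = (i \in P) && ((i \in Q) || (i \in Z)) by rewrite !inE andbC.
have memQ i : (i \in Q') = (i \in Q) && ((i \in P) || (i \in Z)) by rewrite !inE andbC.
have P'r : (#|P'| <= r)%N by rewrite (leq_trans _ Pr) // subset_leq_card ?subsetIr.
have Q'r : (#|Q'| <= r)%N by rewrite (leq_trans _ Qr) // subset_leq_card ?subsetIr.
have PQ : P' :&: Q' = P :&: Q.
  apply/setP => i; rewrite !(inE, memP, memQ).
  by case: (i \in P); case: (i \in Q); case: (i \in Z).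
have badE : bad P' Q' Z = bad P Q Z.
  rewrite /bad PQ; congr (_ || (_ == _)); apply/setP => i.
  rewrite !(inE, memP, memQ).
  by case: (i \in P); case: (i \in Q); case: (i \in Z).
rewrite (eq_ex _ (G := fun A => cond Z (fun A => psi P' A * psi Q' A) A ^+ 2)); last first.
  by move=> A; rewrite red.
have P'Q'Z : P' :\: Q' \subset Z.
  by apply/subsetP => i; rewrite !(inE, memP, memQ); case: (i \in P); case: (i \in Q); case: (i \in Z).
have Q'P'Z : Q' :\: P' \subset Z.
  by apply/subsetP => i; rewrite !(inE, memP, memQ); case: (i \in P); case: (i \in Q); case: (i \in Z).
apply: le_trans (cond_prod_reduced P'r Q'r P'Q'Z Q'P'Z) _.
rewrite badE PQ (_ : #|P'| = #|P :&: Z| + #|P :&: Q :\: Z|)%N; last first.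
  rewrite -(cardsID Z P'); congr addn; apply: eq_card => i; rewrite !(inE, memP).
    by case: (i \in P); case: (i \in Q); case: (i \in Z).
  by case: (i \in P); case: (i \in Q); case: (i \in Z).
rewrite (_ : #|Q'| = #|Q :&: Z| + #|P :&: Q :\: Z|)%N; last first.
  rewrite -(cardsID Z Q'); congr addn; apply: eq_card => i; rewrite !(inE, memQ).
    by case: (i \in P); case: (i \in Q); case: (i \in Z).
  by case: (i \in P); case: (i \in Q); case: (i \in Z).
by rewrite le_eqVlt; apply/orP; left; apply/eqP; congr (_ * _ ^+ _); lia.
Qed.

Let N_gt0 : 0 < N. Proof. exact: lt_le_trans N_ge1. Qed.

Let card_sum (S : {set I}) : #|S| = \sum_(i : I) (i \in S : nat).
Proof. by rewrite -sum1_card big_mkcond; apply: eq_bigr => i _; case: (i \in S). Qed.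

Let dep_prod (P Q : {set I}) : dep (P :|: Q) (fun A => psi P A * psi Q A).
Proof.
apply: depM; [apply: depS (@dep_psi P)|apply: depS (@dep_psi Q)].
  exact: subsetUl.
exact: subsetUr.
Qed.

(** Given the coordinates in [Z], which are all that the two pairs share, the pairs are independent,
    and Cauchy-Schwarz separates them. Each pair may lose one factor [N], but under a square root,
    so the total loss is at most one. *)
Lemma ex_four_bound (P1 P2 P3 P4 : {set I}) :
  (#|P1| <= r)%N -> (#|P2| <= r)%N -> (#|P3| <= r)%N -> (#|P4| <= r)%N ->
  `|ex (fun A => psi P1 A * psi P2 A * (psi P3 A * psi P4 A))|
     * N ^+ #|P1 :|: P2 :|: (P3 :|: P4)|
  <= B * N ^+ (#|P1| + #|P2| + #|P3| + #|P4| +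
       [|| P1 :&: P2 == set0, P3 :&: P4 == set0
         | (P1 :|: P2) :&: (P3 :|: P4) == set0]).
Proof.
move=> P1r P2r P3r P4r; set Z := (P1 :|: P2) :&: (P3 :|: P4).
set U := P1 :|: P2 :|: (P3 :|: P4).
have Zeq12 : (P1 :|: P2) :&: Z = Z by rewrite /Z setIA setIid.
have Zeq34 : (P3 :|: P4) :&: Z = Z by rewrite /Z setIC -setIA setIid.
have b12 := cond_prod_bound Z P1r P2r; have b34 := cond_prod_bound Z P3r P4r.
rewrite /bad Zeq12 in b12; rewrite /bad Zeq34 in b34.
pose V P Q A := cond Z (fun A => psi P A * psi Q A) A.
rewrite -(ex_cond mu_sum1 Z) (eq_ex _ (G := fun A => V P1 P2 A * V P3 P4 A)); last first.
  by move=> A; rewrite (cond_indep mu_sum1 A (@dep_prod P1 P2) (@dep_prod P3 P4)).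
have VV := ex_cauchy mu_ge0 (V P1 P2) (V P3 P4).
have V0 P Q : 0 <= ex (fun A => V P Q A ^+ 2) by apply: ex_ge0 => // A; exact: sqr_ge0.
(* Every coordinate contributes the same amount to both sides, whichever of the four sets contain
   it. *)
have count : (#|P1 :&: Z| + #|P2 :&: Z| + #|P1 :&: P2 :&: Z| + 2 * #|P1 :&: P2 :\: Z|
  + (#|P3 :&: Z| + #|P4 :&: Z| + #|P3 :&: P4 :&: Z| + 2 * #|P3 :&: P4 :\: Z|)
  + 2 * #|U| = 2 * (#|P1| + #|P2| + #|P3| + #|P4|))%N.
  rewrite !card_sum -!big_split !big_distrr -!big_split /=; apply: eq_bigr => i _.
  by rewrite !inE; case: (i \in P1); case: (i \in P2); case: (i \in P3); case: (i \in P4).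
apply: (@ler_sqrM _ (ex (fun A => V P1 P2 A ^+ 2) * N ^+ (2 * #|U|))
    (ex (fun A => V P3 P4 A ^+ 2)) _ _ _ _ _ _ _ b34).
- rewrite exprMn real_normK ?num_real // -exprM [(#|U| * 2)%N]mulnC [leRHS]mulrAC.
  by rewrite ler_wpM2r ?exprn_ge0 ?(ltW N_gt0).
- by rewrite mulr_ge0 ?exprn_ge0 ?(ltW N_gt0).
- exact: V0.
- apply: le_trans (ler_wpM2r _ b12) _; first by rewrite exprn_ge0 ?(ltW N_gt0).
  by rewrite -mulrA -exprD.
- move: count; case: (P1 :&: P2 == set0); case: (P3 :&: P4 == set0); case: (Z == set0) => /=; lia.
Qed.

Lemma ex_two_bound (P Q : {set I}) : (#|P| <= r)%N -> (#|Q| <= r)%N ->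
  ex (fun A => psi P A * psi Q A) ^+ 2 <= B * N ^+ (2 * #|P :&: Q| + 1).
Proof.
move=> Pr Qr; have := cond_prod_bound set0 Pr Qr.
rewrite (eq_ex _ (G := fun=> ex (fun A => psi P A * psi Q A) ^+ 2)); last first.
  by move=> A; rewrite cond0.
by rewrite ex_cst // /bad !setI0 setD0 cards0 eqxx orbT.
Qed.

Section Projection.
Variables (K : finType) (f : I -> K).

(** If [f] is injective on the union, then sets with meeting images meet, and [ex_four_bound] has no
    extra factor. Otherwise the image of the union is smaller than the union by at least one point,
    which absorbs the factor. *)
Lemma ex_four_proj (P1 P2 P3 P4 : {set I}) :
  (#|P1| <= r)%N -> (#|P2| <= r)%N -> (#|P3| <= r)%N -> (#|P4| <= r)%N ->
  (f @: P1) :&: (f @: P2) != set0 -> (f @: P3) :&: (f @: P4) != set0 ->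
  (f @: P1 :|: f @: P2) :&: (f @: P3 :|: f @: P4) != set0 ->
  `|ex (fun A => psi P1 A * psi P2 A * (psi P3 A * psi P4 A))|
     * N ^+ #|f @: P1 :|: f @: P2 :|: (f @: P3 :|: f @: P4)|
  <= B * N ^+ (#|P1| + #|P2| + #|P3| + #|P4|).
Proof.
move=> P1r P2r P3r P4r n12 n34 nZ.
have := ex_four_bound P1r P2r P3r P4r; move: n12 n34 nZ.
set U := P1 :|: P2 :|: (P3 :|: P4) => n12 n34 nZ.
rewrite -!imsetU -/U; set b := [|| _, _ | _] => bnd.
have leU := leq_imset_card f (mem U).
suff key : (#|f @: U| + b <= #|U|)%N.
  rewrite -(ler_pM2r (exprn_gt0 b N_gt0)) -[X in X <= _]mulrA -[X in _ <= X]mulrA -!exprD.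
  apply: le_trans bnd; rewrite ler_wpM2l ?normr_ge0 // ler_weXn2l //.
have [injf|] := boolP (#|f @: U| == #|U|); last first.
  by move=> ne; apply: leq_trans (_ : #|f @: U| < #|U|)%N;
    [rewrite -addn1 leq_add2l; exact: leq_b1|rewrite ltn_neqAle ne].
have finj : {in U &, injective f} by apply/imset_injP.
have meet (S S' : {set I}) : S \subset U -> S' \subset U -> (f @: S) :&: (f @: S') != set0 ->
    S :&: S' != set0.
  move=> /subsetP SU /subsetP S'U /set0Pn[k]; rewrite inE => /andP[/imsetP[i iS ->]].
  move=> /imsetP[j jS' ij]; apply/set0Pn; exists i; rewrite inE iS.
  by have -> : i = j by apply: finj => //; [exact: SU|exact: S'U].
rewrite (_ : b = false) ?addn0 //; apply/negbTE; rewrite /b !negb_or.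
rewrite !meet ?imsetU //; rewrite /U; apply/subsetP => i; rewrite !inE.
all: by case: (i \in P1); case: (i \in P2); case: (i \in P3); case: (i \in P4).
Qed.

(** The covariance vanishes when the pairs are disjoint. Otherwise the product of the two
    expectations loses one factor [N] through [ex_two_bound], and the common point of the pairs,
    counted once in the union, makes up for it. *)
Lemma ex_cov_proj (P1 P2 P3 P4 : {set I}) :
  (#|P1| <= r)%N -> (#|P2| <= r)%N -> (#|P3| <= r)%N -> (#|P4| <= r)%N ->
  (f @: P1) :&: (f @: P2) != set0 -> (f @: P3) :&: (f @: P4) != set0 ->
  `|ex (fun A => psi P1 A * psi P2 A * (psi P3 A * psi P4 A))
     - ex (fun A => psi P1 A * psi P2 A) * ex (fun A => psi P3 A * psi P4 A)|
     * N ^+ #|f @: P1 :|: f @: P2 :|: (f @: P3 :|: f @: P4)|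
  <= 2 * B * N ^+ (#|P1| + #|P2| + #|P3| + #|P4|).
Proof.
move=> P1r P2r P3r P4r n12 n34.
have [Z0|Z0] := eqVneq ((P1 :|: P2) :&: (P3 :|: P4)) set0.
  rewrite (ex_prod (@dep_prod P1 P2) (@dep_prod P3 P4)) -?setI_eq0 ?Z0 //.
  by rewrite subrr normr0 mul0r -mulrA mulr_ge0.
rewrite -[2 * B * _]mulrA mulr_natl mulr2n.
apply: le_trans (ler_wpM2r _ (ler_normB _ _)) _; first by rewrite exprn_ge0 ?(ltW N_gt0).
rewrite mulrDl lerD //.
  apply: ex_four_proj => //; have [i] := set0Pn _ Z0; rewrite -!imsetU inE => /andP[i1 i2].
  by apply/set0Pn; exists (f i); rewrite inE !imset_f.
set u := #|_ :|: _|; have ule : (u <= #|P1 :|: P2 :|: (P3 :|: P4)|)%N.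
  by rewrite /u -!imsetU; exact: leq_imset_card.
apply: (@ler_sqrM _ (ex (fun A => psi P1 A * psi P2 A) ^+ 2 * N ^+ (2 * u))
    (ex (fun A => psi P3 A * psi P4 A) ^+ 2) _ _ _ _ _ _ _ (ex_two_bound P3r P4r)).
- by rewrite exprMn real_normK ?num_real // -exprM [(u * 2)%N]mulnC exprMn [leRHS]mulrAC.
- by apply: mulr_ge0; [exact: sqr_ge0|rewrite exprn_ge0 ?(ltW N_gt0)].
- exact: sqr_ge0.
- apply: le_trans (ler_wpM2r _ (ex_two_bound P1r P2r)) _; first by rewrite exprn_ge0 ?(ltW N_gt0).
  by rewrite -mulrA -exprD.
have := cardsUI (P1 :|: P2) (P3 :|: P4); have := cardsUI P1 P2; have := cardsUI P3 P4.
have : (0 < #|(P1 :|: P2) :&: (P3 :|: P4)|)%N by rewrite card_gt0.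
lia.
Qed.

End Projection.

End FourthMoments.

(** * Summation over quadruples of small sets *)

Section Counting.
Variables (R : realFieldType) (K : finType).
Hypothesis K_gt0 : (0 < #|K|)%N.
Local Notation N := (#|K|%:R : R).

Let N_gt0 : 0 < N. Proof. by rewrite ltr0n. Qed.

Lemma leq_ffact_exp n n' u : (n <= n')%N -> (n ^_ u <= n' ^ u)%N.
Proof.
move=> nn'; elim: u => [|u IH]; first by rewrite ffactn0 expn0.
by rewrite ffactnSr expnSr leq_mul // (leq_trans (leq_subr _ _)).
Qed.

Lemma leq_bin_exp n u : ('C(n, u) <= n ^ u)%N.
Proof.
by apply: leq_trans (leq_ffact_exp u (leqnn n)); rewrite -bin_ffact leq_pmulr // fact_gt0.
Qed.

Lemma leq_fact m n : (m <= n)%N -> (m`! <= n`!)%N.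
Proof.
move=> mn; rewrite -(subnKC mn); elim: (n - m)%N => [|d IH]; first by rewrite addn0.
by rewrite addnS factS (leq_trans IH) // leq_pmull.
Qed.

(** There are at most [N ^+ u] sets of size [u], so each size contributes a bounded amount. *)
Lemma sum_sets_bound d q :
  \sum_(U : {set K} | (#|U| <= d)%N) (2 ^+ #|U|) ^+ q / N ^+ #|U|
  <= d.+1%:R * (2 ^+ d) ^+ q.
Proof.
rewrite (partition_big (fun U : {set K} => inord #|U| : 'I_d.+1) predT) //=.
have -> : d.+1%:R * (2 ^+ d) ^+ q = \sum_(u < d.+1) (2 ^+ d) ^+ q :> R.
  by rewrite sumr_const card_ord mulr_natl.
apply: ler_sum => u _.
rewrite (eq_bigl (fun U => U \in [set U : {set K} | #|U| == u]%SET)); last first.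
  move=> U; rewrite !inE; apply/andP/eqP => [[Ud /eqP <-]|->].
    by rewrite inordK.
  by rewrite -ltnS ltn_ord inord_val.
rewrite (eq_bigr (fun=> (2 ^+ u) ^+ q / N ^+ u)); last by move=> U; rewrite inE => /eqP ->.
rewrite sumr_const card_draws -[_ *+ _]mulr_natr mulrAC ler_pdivrMr ?exprn_gt0 //.
apply: ler_pM; rewrite ?exprn_ge0 ?ler0n //.
  by rewrite -!exprM ler_weXn2l ?ler1n // leq_mul2r -ltnS ltn_ord orbT.
by rewrite -natrX ler_nat leq_bin_exp.
Qed.

Definition union4 (S1 S2 S3 S4 : {set K}) := S1 :|: S2 :|: (S3 :|: S4).

Variable r : nat.

Definition small4 (S1 S2 S3 S4 : {set K}) :=
  [&& (#|S1| <= r), (#|S2| <= r), (#|S3| <= r) & (#|S4| <= r)]%N.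

Lemma card_union4 S1 S2 S3 S4 : small4 S1 S2 S3 S4 -> (#|union4 S1 S2 S3 S4| <= 4 * r)%N.
Proof.
case/and4P => s1 s2 s3 s4; rewrite /union4.
have := cardsUI S1 S2; have := cardsUI S3 S4.
have := cardsUI (S1 :|: S2) (S3 :|: S4); lia.
Qed.

(** Each quadruple is charged to its union, and a set [U] contains only [(2 ^+ #|U|) ^+ 4]
    quadruples of subsets. *)
Lemma sum_quad_bound :
  \sum_S1 \sum_S2 \sum_S3 \sum_S4
    (if small4 S1 S2 S3 S4 then (N ^+ #|union4 S1 S2 S3 S4|)^-1 else 0)
  <= (4 * r).+1%:R * (2 ^+ (4 * r)) ^+ 4.
Proof.
pose c (U : {set K}) (S : {set K}) : R := (S \subset U)%:R.
apply: le_trans (sum_sets_bound (4 * r) 4).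
have cU (U : {set K}) : \sum_S c U S = 2 ^+ #|U|.
  rewrite -natrX -card_powerset -sum1_card natr_sum big_mkcond /=.
  by rewrite [RHS]big_mkcond; apply: eq_bigr => S _; rewrite /c inE; case: ifP.
have -> : \sum_(U : {set K} | (#|U| <= 4 * r)%N) (2 ^+ #|U|) ^+ 4 / N ^+ #|U| =
  \sum_S1 \sum_S2 \sum_S3 \sum_S4 \sum_(U : {set K} | (#|U| <= 4 * r)%N)
     c U S1 * (c U S2 * (c U S3 * c U S4)) / N ^+ #|U|.
  under [RHS]eq_bigr => S1 _.
    under eq_bigr => S2 _.
      under eq_bigr => S3 _ do rewrite exchange_big.
      rewrite exchange_big /=; over.
    rewrite exchange_big /=; over.
  rewrite exchange_big /=; apply: eq_bigr => U _.
  rewrite !exprS expr0 mulr1 -!cU mulr_suml mulr_suml; apply: eq_bigr => S1 _.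
  rewrite mulr_suml mulr_sumr mulr_suml; apply: eq_bigr => S2 _.
  rewrite mulr_suml !mulr_sumr mulr_suml; apply: eq_bigr => S3 _.
  by rewrite !mulr_sumr mulr_suml.
apply: ler_sum => S1 _; apply: ler_sum => S2 _; apply: ler_sum => S3 _.
apply: ler_sum => S4 _; have term0 U : 0 <= c U S1 * (c U S2 * (c U S3 * c U S4)) / N ^+ #|U|.
  by rewrite !mulr_ge0 ?ler0n ?invr_ge0 ?exprn_ge0.
case: ifP => [sm|_]; last by apply: sumr_ge0.
rewrite (bigD1 (union4 S1 S2 S3 S4)) ?card_union4 //= /c.
rewrite (_ : S1 \subset _) 1?(_ : S2 \subset _) 1?(_ : S3 \subset _) 1?(_ : S4 \subset _).
  by rewrite !mul1r lerDl sumr_ge0.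
all: by apply/subsetP => i iS; rewrite !inE iS ?orbT.
Qed.

End Counting.

(** * Expansion of four-fold linear functionals *)

Section Quadrilinear.
Variables (R : realFieldType) (V : Type).
Local Notation fn := (V -> R).

Definition lin (L : fn -> R) :=
  forall c F G, L (fun A => c * F A + G A) = c * L F + L G.

Lemma lin0 L : lin L -> L (fun=> 0) = 0.
Proof.
move=> Ll; have := Ll 1 (fun=> 0) (fun=> 0).
rewrite (_ : (fun _ => _) = fun=> 0); last by apply: funext => A; rewrite mulr0 addr0.
by rewrite mul1r => /eqP; rewrite addrC -subr_eq subrr => /eqP.
Qed.

Lemma linB L F G : lin L -> L (fun A => F A - G A) = L F - L G.
Proof.
move=> Ll; rewrite (_ : (fun _ => _) = fun A => -1 * G A + F A).
  by rewrite Ll mulN1r addrC.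
by apply: funext => A; rewrite mulN1r addrC.
Qed.

Lemma lin_sum L (K : finType) (b : K -> R) (F : K -> fn) : lin L ->
  L (fun A => \sum_k b k * F k A) = \sum_k b k * L (F k).
Proof.
move=> Ll; elim: (index_enum K) => [|k s IH].
  rewrite big_nil; transitivity (L (fun=> 0)); last exact: lin0.
  by congr L; apply: funext => A; rewrite big_nil.
rewrite big_cons -IH -Ll; congr L; apply: funext => A; by rewrite big_cons.
Qed.

Record quadlin (Q : fn -> fn -> fn -> fn -> R) := {
  quadlin1 : forall F2 F3 F4, lin (fun F => Q F F2 F3 F4);
  quadlin2 : forall F1 F3 F4, lin (fun F => Q F1 F F3 F4);
  quadlin3 : forall F1 F2 F4, lin (fun F => Q F1 F2 F F4);
  quadlin4 : forall F1 F2 F3, lin (fun F => Q F1 F2 F3 F) }.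

Lemma quad_sum Q (K : finType) (b1 b2 b3 b4 : K -> R) (F1 F2 F3 F4 : K -> fn) :
  quadlin Q ->
  Q (fun A => \sum_k b1 k * F1 k A) (fun A => \sum_k b2 k * F2 k A)
    (fun A => \sum_k b3 k * F3 k A) (fun A => \sum_k b4 k * F4 k A)
  = \sum_k1 \sum_k2 \sum_k3 \sum_k4
      b1 k1 * (b2 k2 * (b3 k3 * (b4 k4 * Q (F1 k1) (F2 k2) (F3 k3) (F4 k4)))).
Proof.
move=> Ql; rewrite (lin_sum _ _ (quadlin1 Ql _ _ _)); apply: eq_bigr => k1 _.
rewrite (lin_sum _ _ (quadlin2 Ql _ _ _)) mulr_sumr; apply: eq_bigr => k2 _.
rewrite (lin_sum _ _ (quadlin3 Ql _ _ _)) !mulr_sumr; apply: eq_bigr => k3 _.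
by rewrite (lin_sum _ _ (quadlin4 Ql _ _ _)) !mulr_sumr.
Qed.

End Quadrilinear.

(** * Resampling differences on doubled coordinates *)

Section Lifts.
Variables (R : realFieldType) (T : finType) (mu : T -> R).
Hypotheses (mu_ge0 : forall t, 0 <= mu t) (mu_sum1 : \sum_t mu t = 1).
Local Notation ex := (ex mu).
Variables (K : finType) (r : nat).
Local Notation I := (K * bool)%type.
Local Notation fn := ({ffun I -> T} -> R).
Variable psi : {set I} -> fn.
Hypothesis dep_psi : forall P, dep P (psi P).
Hypothesis psi_image : forall (f : I -> I) (P : {set I}) A, injective f ->
  (#|P| <= r)%N -> psi [set f i | i in P] A = psi P [ffun i => A (f i)].

(* Coordinate [(k, true)] is an independent copy of [(k, false)]: resampling the
   [k]-th vertex amounts to swapping the two. *)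
Definition flip (k : K) (u : I) : I := if u.1 == k then (u.1, ~~ u.2) else u.

Lemma flipK k : involutive (flip k).
Proof. by case=> l b; rewrite /flip; case lk: (l == k); rewrite /= lk ?negbK. Qed.

Lemma flip_fst k u : (flip k u).1 = u.1.
Proof. by rewrite /flip; case: ifP. Qed.

Definition act k (A : {ffun I -> T}) : {ffun I -> T} := [ffun u => A (flip k u)].

Lemma actK k : involutive (act k).
Proof. by move=> A; apply/ffunP => u; rewrite !ffunE flipK. Qed.

Lemma actC k l A : act k (act l A) = act l (act k A).
Proof.
apply/ffunP => -[j b]; rewrite !ffunE /flip /=.
by case jk: (j == k); case jl: (j == l); rewrite /= ?jk ?jl.
Qed.

Lemma ex_act k (F : fn) : ex (fun A => F (act k A)) = ex F.
Proof. exact: (ex_reindex mu_sum1 F (inv_inj (flipK k))). Qed.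

Definition diff k (F : fn) : fn := fun A => F A - F (act k A).

Definition diff_prod (F G : fn) : fn := fun A => \sum_k diff k F A * diff k G A.

(* Signed combinations of a given number of [psi P] with [P] a lift of [S]. *)
Inductive lift_comb (S : {set K}) : nat -> fn -> Prop :=
| Lift_psi (P : {set I}) : fst @: P = S -> #|P| = #|S| -> lift_comb S 1 (psi P)
| Lift_sub a b F G : lift_comb S a F -> lift_comb S b G ->
    lift_comb S (a + b) (fun A => F A - G A).

Lemma lift_comb_act k (S : {set K}) a F : (#|S| <= r)%N -> lift_comb S a F ->
  lift_comb S a (fun A => F (act k A)).
Proof.
move=> Sr; elim=> [P PS cP|a' b' F' G' _ IF _ IG]; last exact: Lift_sub.
have finj := inv_inj (flipK k).
rewrite (_ : (fun _ => _) = psi [set flip k i | i in P]); last first.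
  by apply: funext => A; rewrite psi_image ?cP.
apply: Lift_psi; last by rewrite card_imset.
by rewrite -imset_comp -PS; apply: eq_imset => u; rewrite /= flip_fst.
Qed.

Lemma lift_comb_diff k (S : {set K}) a F : (#|S| <= r)%N -> lift_comb S a F ->
  lift_comb S (a + a) (diff k F).
Proof. by move=> Sr FS; apply: Lift_sub => //; exact: lift_comb_act. Qed.

Lemma diff_notin k (S : {set K}) a F : k \notin S -> lift_comb S a F ->
  diff k F = fun=> 0.
Proof.
move=> kS FS; apply: funext => A; apply/eqP; rewrite subr_eq0; apply/eqP; move: A.
elim: FS => [P PS _ A|a' b' F' G' _ IF _ IG A]; last by rewrite IF IG.
apply: dep_psi => u uP; rewrite ffunE /flip; case: eqP => // uk.
by case/negP: kS; rewrite -PS -uk; apply/imsetP; exists u.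
Qed.

Lemma lift_comb_lin (L : fn -> R) (S : {set K}) a F c : lin L ->
  (forall P : {set I}, fst @: P = S -> #|P| = #|S| -> `|L (psi P)| <= c) ->
  lift_comb S a F -> `|L F| <= a%:R * c.
Proof.
move=> Ll LP; elim=> [P PS cP|a' b' F' G' _ IF _ IG]; first by rewrite mul1r LP.
by rewrite linB // natrD mulrDl (le_trans (ler_normB _ _)) // lerD.
Qed.

Lemma lift_comb_quad Q (S1 S2 S3 S4 : {set K}) a1 a2 a3 a4 F1 F2 F3 F4 c :
  quadlin Q ->
  (forall P1 P2 P3 P4 : {set I}, fst @: P1 = S1 -> #|P1| = #|S1| ->
    fst @: P2 = S2 -> #|P2| = #|S2| -> fst @: P3 = S3 -> #|P3| = #|S3| ->
    fst @: P4 = S4 -> #|P4| = #|S4| ->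
    `|Q (psi P1) (psi P2) (psi P3) (psi P4)| <= c) ->
  lift_comb S1 a1 F1 -> lift_comb S2 a2 F2 -> lift_comb S3 a3 F3 ->
  lift_comb S4 a4 F4 ->
  `|Q F1 F2 F3 F4| <= a1%:R * (a2%:R * (a3%:R * (a4%:R * c))).
Proof.
move=> Ql QP l1 l2 l3 l4.
apply: (lift_comb_lin (quadlin1 Ql F2 F3 F4) _ l1) => P1 e1 c1.
apply: (lift_comb_lin (quadlin2 Ql _ F3 F4) _ l2) => P2 e2 c2.
apply: (lift_comb_lin (quadlin3 Ql _ _ F4) _ l3) => P3 e3 c3.
apply: (lift_comb_lin (quadlin4 Ql _ _ _) _ l4) => P4 e4 c4.
exact: QP.
Qed.

Hypothesis K_gt0 : (0 < #|K|)%N.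
Local Notation N := (#|K|%:R : R).

(** The weight [N ^+ (r - #|S|)] is the order of the number of [r]-sets that contain [S]. The
    coefficients of both forms, the statistic and the Stein solution, are of this size. *)
Definition admissible (b : {set K} -> R) :=
  forall S, 0 <= b S /\ if (#|S| <= r)%N then b S * N ^+ #|S| <= N ^+ r else b S == 0.

(** The square counts the choices of [k] and [l] in a union of at most [4 * r] points; the rest
    comes from [sum_quad_bound]. *)
Definition total_const : R := (4 * r)%:R ^+ 2 * ((4 * r).+1%:R * (2 ^+ (4 * r)) ^+ 4).

Let N_gt0 k : 0 < N ^+ k. Proof. by rewrite exprn_gt0 // ltr0n. Qed.

Lemma total_bound (t : K -> K -> {set K} -> {set K} -> {set K} -> {set K} -> R) c :
  0 <= c ->
  (forall k l S1 S2 S3 S4, `|t k l S1 S2 S3 S4| <=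
     if [&& small4 r S1 S2 S3 S4, k \in union4 S1 S2 S3 S4
          & l \in union4 S1 S2 S3 S4] then c / N ^+ #|union4 S1 S2 S3 S4| else 0) ->
  `|\sum_k \sum_l \sum_S1 \sum_S2 \sum_S3 \sum_S4 t k l S1 S2 S3 S4|
    <= c * total_const.
Proof.
move=> c0 tb.
apply: le_trans (_ : \sum_S1 \sum_S2 \sum_S3 \sum_S4 \sum_k \sum_l
   `|t k l S1 S2 S3 S4| <= _).
  have -> : \sum_k \sum_l \sum_S1 \sum_S2 \sum_S3 \sum_S4 t k l S1 S2 S3 S4 =
    \sum_S1 \sum_S2 \sum_S3 \sum_S4 \sum_k \sum_l t k l S1 S2 S3 S4.
    under eq_bigr => k _.
      rewrite exchange_big; under eq_bigr => S1 _.
        rewrite exchange_big; under eq_bigr => S2 _.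
          rewrite exchange_big; under eq_bigr => S3 _ do rewrite exchange_big.
          over.
        over.
      over.
    rewrite exchange_big; apply: eq_bigr => S1 _.
    rewrite exchange_big; apply: eq_bigr => S2 _.
    rewrite exchange_big; apply: eq_bigr => S3 _.
    by rewrite exchange_big.
  do 6 (apply: le_trans (ler_norm_sum _ _ _) _; apply: ler_sum => ? _) => //.
rewrite /total_const [leRHS]mulrA.
have c1 : 0 <= c * (4 * r)%:R ^+ 2 by rewrite mulr_ge0 ?sqr_ge0.
refine (le_trans _ (ler_wpM2l c1 (sum_quad_bound R K_gt0 r))).
rewrite mulr_sumr; apply: ler_sum => S1 _; rewrite mulr_sumr; apply: ler_sum => S2 _.
rewrite mulr_sumr; apply: ler_sum => S3 _; rewrite mulr_sumr; apply: ler_sum => S4 _.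
set U := union4 S1 S2 S3 S4.
apply: le_trans (_ : \sum_k \sum_l (if small4 r S1 S2 S3 S4 && (k \in U) && (l \in U)
   then c / N ^+ #|U| else 0) <= _).
  by apply: ler_sum => k _; apply: ler_sum => l _; rewrite -andbA; exact: tb.
case: (boolP (small4 r S1 S2 S3 S4)) => [sm|_]; last by rewrite /= mulr0 big1 // => k _; rewrite big1.
rewrite (eq_bigr (fun k => if k \in U then c / N ^+ #|U| *+ #|U| else 0)); last first.
  move=> k _ /=; case: (k \in U); last by rewrite big1.
  by rewrite -big_mkcond sumr_const.
rewrite -big_mkcond sumr_const -mulrnA -[_ *+ _]mulr_natr [leRHS]mulrAC.
rewrite ler_wpM2l ?divr_ge0 ?(ltW (N_gt0 _)) //.
by rewrite natrM -expr2 lerXn2r ?nnegrE ?ler0n // ler_nat card_union4.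
Qed.

(** The weight of [S] contributes at most [N ^+ (r - #|S|)] and the moment bound the complementary
    powers. Hence each term is at most a constant times [(N ^+ r) ^+ 4] divided by [N] to the size
    of the union, whatever the sizes of the four sets. *)
Lemma quad_total Q (gd : {set K} -> {set K} -> {set K} -> {set K} -> bool)
    a1 a2 a3 a4 b1 b2 b3 b4 (F1 F2 F3 F4 : K -> K -> {set K} -> fn) c :
  quadlin Q -> 0 <= c ->
  admissible b1 -> admissible b2 -> admissible b3 -> admissible b4 ->
  (forall k l (S : {set K}), (#|S| <= r)%N -> lift_comb S a1 (F1 k l S)) ->
  (forall k l (S : {set K}), (#|S| <= r)%N -> lift_comb S a2 (F2 k l S)) ->
  (forall k l (S : {set K}), (#|S| <= r)%N -> lift_comb S a3 (F3 k l S)) ->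
  (forall k l (S : {set K}), (#|S| <= r)%N -> lift_comb S a4 (F4 k l S)) ->
  (forall P1 P2 P3 P4 : {set I},
    (#|P1| <= r)%N -> (#|P2| <= r)%N -> (#|P3| <= r)%N -> (#|P4| <= r)%N ->
    gd (fst @: P1) (fst @: P2) (fst @: P3) (fst @: P4) ->
    `|Q (psi P1) (psi P2) (psi P3) (psi P4)|
      * N ^+ #|union4 (fst @: P1) (fst @: P2) (fst @: P3) (fst @: P4)|
    <= c * N ^+ (#|P1| + #|P2| + #|P3| + #|P4|)) ->
  (forall k l (S1 S2 S3 S4 : {set K}), small4 r S1 S2 S3 S4 ->
    ~~ [&& gd S1 S2 S3 S4, k \in union4 S1 S2 S3 S4 & l \in union4 S1 S2 S3 S4] ->
    Q (F1 k l S1) (F2 k l S2) (F3 k l S3) (F4 k l S4) = 0) ->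
  `|\sum_k \sum_l Q (fun A => \sum_S b1 S * F1 k l S A)
     (fun A => \sum_S b2 S * F2 k l S A) (fun A => \sum_S b3 S * F3 k l S A)
     (fun A => \sum_S b4 S * F4 k l S A)|
  <= (a1 * a2 * a3 * a4)%:R * (c * (N ^+ r) ^+ 4) * total_const.
Proof.
move=> Ql c0 ad1 ad2 ad3 ad4 l1 l2 l3 l4 Qb Q0.
under eq_bigr => k _ do under eq_bigr => l _ do rewrite quad_sum //.
apply: total_bound => [|k l S1 S2 S3 S4].
  by rewrite !mulr_ge0 ?ler0n ?exprn_ge0 ?(ltW (N_gt0 _)).
have [b1_0 h1] := ad1 S1; have [b2_0 h2] := ad2 S2.
have [b3_0 h3] := ad3 S3; have [b4_0 h4] := ad4 S4.
case: (boolP (small4 r S1 S2 S3 S4)) => [sm|nsm]; last first.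
  suff -> : b1 S1 * (b2 S2 * (b3 S3 * (b4 S4 *
     Q (F1 k l S1) (F2 k l S2) (F3 k l S3) (F4 k l S4)))) = 0 by rewrite normr0.
  move: nsm h1 h2 h3 h4; rewrite /small4.
  case: ifP => _; last by move=> _ /eqP ->; rewrite mul0r.
  case: ifP => _; last by move=> _ _ /eqP ->; rewrite mul0r mulr0.
  case: ifP => _; last by move=> _ _ _ /eqP ->; rewrite mul0r !mulr0.
  by case: ifP => _ // _ _ _ _ /eqP ->; rewrite mul0r !mulr0.
set U := union4 S1 S2 S3 S4; rewrite /=.
case: (boolP [&& gd S1 S2 S3 S4, k \in U & l \in U]) => [/andP[gdS ->]|ng]; last first.
  rewrite (Q0 _ _ _ _ _ _ sm ng) !mulr0 normr0; case: ifP => // _.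
  by rewrite !mulr_ge0 ?invr_ge0 ?ler0n ?exprn_ge0 ?(ltW (N_gt0 _)).
have /and4P[s1 s2 s3 s4] := sm.
rewrite s1 in h1; rewrite s2 in h2; rewrite s3 in h3; rewrite s4 in h4.
have QF : `|Q (F1 k l S1) (F2 k l S2) (F3 k l S3) (F4 k l S4)| <=
    a1%:R * (a2%:R * (a3%:R * (a4%:R * (c * N ^+ (#|S1| + #|S2| + #|S3| + #|S4|) / N ^+ #|U|)))).
  apply: lift_comb_quad (l1 k l S1 s1) (l2 k l S2 s2) (l3 k l S3 s3) (l4 k l S4 s4) => //.
  move=> P1 P2 P3 P4 e1 c1 e2 c2 e3 c3 e4 c4.
  by rewrite ler_pdivlMr // /U -c1 -c2 -c3 -c4 -e1 -e2 -e3 -e4 Qb ?c1 ?c2 ?c3 ?c4 ?e1 ?e2 ?e3 ?e4.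
rewrite !normrM (ger0_norm b1_0) (ger0_norm b2_0) (ger0_norm b3_0) (ger0_norm b4_0) ler_pdivlMr //.
apply: le_trans (_ : b1 S1 * (b2 S2 * (b3 S3 * (b4 S4 * (a1%:R * (a2%:R * (a3%:R *
    (a4%:R * (c * N ^+ (#|S1| + #|S2| + #|S3| + #|S4|) / N ^+ #|U|)))))))) * N ^+ #|U| <= _).
  by rewrite ler_wpM2r ?(ltW (N_gt0 _)) // !ler_wpM2l.
have -> : b1 S1 * (b2 S2 * (b3 S3 * (b4 S4 * (a1%:R * (a2%:R * (a3%:R *
    (a4%:R * (c * N ^+ (#|S1| + #|S2| + #|S3| + #|S4|) / N ^+ #|U|)))))))) * N ^+ #|U|
  = (a1 * a2 * a3 * a4)%:R * (c * (b1 S1 * N ^+ #|S1| *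
    (b2 S2 * N ^+ #|S2| * (b3 S3 * N ^+ #|S3| * (b4 S4 * N ^+ #|S4|))))).
  rewrite !exprD !natrM; have := gt_eqF (N_gt0 #|U|) => /negbT nz; field; exact: nz.
rewrite ler_wpM2l ?ler0n // ler_wpM2l // [(N ^+ r) ^+ 4]exprS [_ ^+ 3]exprS [_ ^+ 2]exprS expr1.
by do 3 (apply: ler_pM => //; rewrite ?mulr_ge0 ?(ltW (N_gt0 _)) //).
Qed.

Definition mom4 (F1 F2 F3 F4 : fn) := ex (fun A => F1 A * F2 A * (F3 A * F4 A)).
Definition cov4 (F1 F2 F3 F4 : fn) := mom4 F1 F2 F3 F4 -
  ex (fun A => F1 A * F2 A) * ex (fun A => F3 A * F4 A).

Lemma quadlin_mom4 : quadlin mom4.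
Proof.
split=> *; rewrite /lin /mom4 => c F G; rewrite -exZ -exD; apply: eq_ex => A; ring.
Qed.

Lemma quadlin_cov4 : quadlin cov4.
Proof.
have [m1 m2 m3 m4] := quadlin_mom4.
have e1 c F G H : ex (fun A => (c * F A + G A) * H A)
    = c * ex (fun A => F A * H A) + ex (fun A => G A * H A).
  by rewrite -exZ -exD; apply: eq_ex => A; ring.
have e2 c F G H : ex (fun A => H A * (c * F A + G A))
    = c * ex (fun A => H A * F A) + ex (fun A => H A * G A).
  by rewrite -exZ -exD; apply: eq_ex => A; ring.
split=> *; rewrite /lin /cov4 => c F G.
- by rewrite m1 e1; ring.
- by rewrite m2 e2; ring.
- by rewrite m3 e1; ring.
- by rewrite m4 e2; ring.
Qed.

Definition base (S : {set K}) : {set I} := [set (k, false) | k in S].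

Lemma base_comb (S : {set K}) : lift_comb S 1 (psi (base S)).
Proof.
have binj : injective (fun k : K => (k, false)) by move=> ? ? [].
apply: Lift_psi; last by rewrite card_imset.
rewrite /base -imset_comp (eq_imset (g := id)) //; apply/setP => k.
by apply/imsetP/idP => [[j jS ->]//|kS]; exists k.
Qed.

Definition form (b : {set K} -> R) : fn := fun A => \sum_S b S * psi (base S) A.

Lemma diff_sum k (b : {set K} -> R) (F : {set K} -> fn) :
  diff k (fun A => \sum_S b S * F S A) = fun A => \sum_S b S * diff k (F S) A.
Proof.
by apply: funext => A; rewrite /diff -sumrB; apply: eq_bigr => S _; rewrite mulrBr.
Qed.

Lemma diff0 k : diff k (fun=> 0) = fun=> 0.
Proof. by apply: funext => A; rewrite /diff subrr. Qed.

Variable B : R.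
Hypothesis B_ge0 : 0 <= B.
Hypothesis mom_bound : forall P1 P2 P3 P4 : {set I},
  (#|P1| <= r)%N -> (#|P2| <= r)%N -> (#|P3| <= r)%N -> (#|P4| <= r)%N ->
  (fst @: P1) :&: (fst @: P2) != set0 -> (fst @: P3) :&: (fst @: P4) != set0 ->
  (fst @: P1 :|: fst @: P2) :&: (fst @: P3 :|: fst @: P4) != set0 ->
  `|mom4 (psi P1) (psi P2) (psi P3) (psi P4)|
     * N ^+ #|union4 (fst @: P1) (fst @: P2) (fst @: P3) (fst @: P4)|
  <= B * N ^+ (#|P1| + #|P2| + #|P3| + #|P4|).
Hypothesis cov_bound : forall P1 P2 P3 P4 : {set I},
  (#|P1| <= r)%N -> (#|P2| <= r)%N -> (#|P3| <= r)%N -> (#|P4| <= r)%N ->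
  (fst @: P1) :&: (fst @: P2) != set0 -> (fst @: P3) :&: (fst @: P4) != set0 ->
  `|cov4 (psi P1) (psi P2) (psi P3) (psi P4)|
     * N ^+ #|union4 (fst @: P1) (fst @: P2) (fst @: P3) (fst @: P4)|
  <= 2 * B * N ^+ (#|P1| + #|P2| + #|P3| + #|P4|).

(** Here 64 is [4 * 4 * 2 * 2], the numbers of lifts in the four differences. A nonzero term has [k]
    in all four sets, which provides every required intersection. *)
Lemma fourth_diff_bound b1 b2 : admissible b1 -> admissible b2 ->
  \sum_k \sum_l ex (fun A => diff l (diff k (form b1)) A ^+ 2 * diff k (form b2) A ^+ 2)
  <= 64 * (B * (N ^+ r) ^+ 4) * total_const.
Proof.
move=> ad1 ad2; apply: le_trans (ler_norm _) _.
pose F k l S := diff l (diff k (psi (base S))).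
pose G (k l : K) S := diff k (psi (base S)).
pose gd (S1 S2 S3 S4 : {set K}) := [&& S1 :&: S2 != set0, S3 :&: S4 != set0
  & (S1 :|: S2) :&: (S3 :|: S4) != set0].
have lF k l (S : {set K}) : (#|S| <= r)%N -> lift_comb S 4 (F k l S).
  move=> Sr; apply: (@lift_comb_diff _ _ 2) => //; apply: (@lift_comb_diff _ _ 1) => //.
  exact: base_comb.
have lG k l (S : {set K}) : (#|S| <= r)%N -> lift_comb S 2 (G k l S).
  move=> Sr; apply: (@lift_comb_diff _ _ 1) => //; exact: base_comb.
have G0 k l (S : {set K}) : k \notin S -> G k l S = fun=> 0.
  by move=> kS; apply: diff_notin kS (base_comb S).
have F0 k l (S : {set K}) : (#|S| <= r)%N -> ~~ ((k \in S) && (l \in S)) -> F k l S = fun=> 0.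
  move=> Sr; rewrite negb_and => /orP[kS|lS].
    by rewrite /F (diff_notin kS (base_comb S)) diff0.
  by apply: diff_notin lS (lG k l S Sr).
have := @quad_total mom4 gd 4 4 2 2 b1 b1 b2 b2 F F G G B quadlin_mom4 B_ge0
  ad1 ad1 ad2 ad2 lF lF lG lG.
rewrite (eq_bigr (fun k => \sum_l ex (fun A =>
   diff l (diff k (form b1)) A ^+ 2 * diff k (form b2) A ^+ 2))); last first.
  move=> k _; apply: eq_bigr => l _; apply: eq_ex => A.
  by rewrite /form !diff_sum !expr2.
apply.
  move=> P1 P2 P3 P4 p1 p2 p3 p4 /and3P[]; exact: mom_bound.
move=> k l S1 S2 S3 S4 /and4P[s1 s2 s3 s4] ng; have [m1 m2 m3 m4] := quadlin_mom4.
have [/andP[k1 l1]|n1] := boolP ((k \in S1) && (l \in S1)); last first.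
  by rewrite (F0 _ _ _ s1 n1) (lin0 (m1 _ _ _)).
have [/andP[k2 l2]|n2] := boolP ((k \in S2) && (l \in S2)); last first.
  by rewrite (F0 _ _ _ s2 n2) (lin0 (m2 _ _ _)).
have [k3|n3] := boolP (k \in S3); last by rewrite (G0 _ _ _ n3) (lin0 (m3 _ _ _)).
have [k4|n4] := boolP (k \in S4); last by rewrite (G0 _ _ _ n4) (lin0 (m4 _ _ _)).
case/negP: ng; rewrite /union4 !inE k1 l1 /= !andbT; apply/and3P.
by split; apply/set0Pn; exists k; rewrite !inE ?k1 ?k2 ?k3 ?k4.
Qed.

(** In a nonzero term [k] joins the first pair of sets and [l] the second. Nothing forces the pairs
    to meet each other, which is why covariances are used. Here 16 is [2 ^ 4], each difference
    having two lifts. *)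
Lemma var_diff_bound b1 b2 : admissible b1 -> admissible b2 ->
  ex (fun A => (diff_prod (form b1) (form b2) A - ex (diff_prod (form b1) (form b2))) ^+ 2)
  <= 16 * (2 * B * (N ^+ r) ^+ 4) * total_const.
Proof.
move=> ad1 ad2; apply: le_trans (ler_norm _) _.
set V := diff_prod _ _.
pose F (k l : K) S := diff k (psi (base S)).
pose G (k l : K) S := diff l (psi (base S)).
pose gd (S1 S2 S3 S4 : {set K}) := (S1 :&: S2 != set0) && (S3 :&: S4 != set0).
have lF k l (S : {set K}) : (#|S| <= r)%N -> lift_comb S 2 (F k l S).
  move=> Sr; apply: (@lift_comb_diff _ _ 1) => //; exact: base_comb.
have lG k l (S : {set K}) : (#|S| <= r)%N -> lift_comb S 2 (G k l S).
  move=> Sr; apply: (@lift_comb_diff _ _ 1) => //; exact: base_comb.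
have F0 k l (S : {set K}) : k \notin S -> F k l S = fun=> 0.
  by move=> kS; apply: diff_notin kS (base_comb S).
have G0 k l (S : {set K}) : l \notin S -> G k l S = fun=> 0.
  by move=> lS; apply: diff_notin lS (base_comb S).
have B2 : 0 <= 2 * B by rewrite mulr_ge0.
have := @quad_total cov4 gd 2 2 2 2 b1 b2 b1 b2 F F G G _ quadlin_cov4 B2
  ad1 ad2 ad1 ad2 lF lF lG lG.
rewrite (_ : \sum_k \sum_l _ = ex (fun A => (V A - ex V) ^+ 2)); last first.
  pose v k A := diff k (form b1) A * diff k (form b2) A.
  transitivity (\sum_k \sum_l (ex (fun A => v k A * v l A) - ex (v k) * ex (v l))).
    apply: eq_bigr => k _; apply: eq_bigr => l _.
    by rewrite /cov4 /mom4 /v /form !diff_sum.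
  transitivity (ex (fun A => V A ^+ 2) - ex V ^+ 2).
    under eq_bigr => k _ do rewrite sumrB -mulr_sumr.
    rewrite sumrB -mulr_suml -ex_sum -expr2; congr (_ - _).
    under eq_bigr => k _ do rewrite -ex_sum.
    rewrite -ex_sum; apply: eq_ex => A; rewrite expr2 mulr_suml.
    by apply: eq_bigr => k _; rewrite mulr_sumr.
  rewrite [RHS](eq_ex _ (G := fun A => V A ^+ 2 - 2 * ex V * V A + ex V ^+ 2)); last first.
    by move=> A; ring.
  by rewrite exD exB exZ ex_cst //; ring.
apply.
  move=> P1 P2 P3 P4 p1 p2 p3 p4 /andP[]; exact: cov_bound.
move=> k l S1 S2 S3 S4 /and4P[s1 s2 s3 s4] ng; have [m1 m2 m3 m4] := quadlin_cov4.
have [k1|n1] := boolP (k \in S1); last by rewrite (F0 _ _ _ n1) (lin0 (m1 _ _ _)).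
have [k2|n2] := boolP (k \in S2); last by rewrite (F0 _ _ _ n2) (lin0 (m2 _ _ _)).
have [k3|n3] := boolP (l \in S3); last by rewrite (G0 _ _ _ n3) (lin0 (m3 _ _ _)).
have [k4|n4] := boolP (l \in S4); last by rewrite (G0 _ _ _ n4) (lin0 (m4 _ _ _)).
case/negP: ng; rewrite /union4 !inE k1 k3 ?orbT /= !andbT; apply/andP.
by split; apply/set0Pn; [exists k|exists l]; rewrite !inE ?k1 ?k2 ?k3 ?k4.
Qed.

End Lifts.

(** * Stein's method for exchangeable pairs *)

Section ExchangeablePairs.
Variables (R : rcfType) (T : finType) (mu : T -> R).
Hypotheses (mu_ge0 : forall t, 0 <= mu t) (mu_sum1 : \sum_t mu t = 1).
Local Notation ex := (ex mu).
Variable K : finType.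
Local Notation I := (K * bool)%type.
Local Notation fn := ({ffun I -> T} -> R).
Implicit Types F G H : fn.

Lemma diff_act k F A : diff k F (act k A) = - diff k F A.
Proof. by rewrite /diff actK opprB. Qed.

(** [act k] preserves the law and changes the sign of [F], so the two parts of [diff k H] contribute
    equally. *)
Lemma ex_antisym k F H : (forall A, F (act k A) = - F A) ->
  ex (fun A => F A * diff k H A) = 2 * ex (fun A => F A * H A).
Proof.
move=> anti; have e : ex (fun A => F A * H (act k A)) = - ex (fun A => F A * H A).
  rewrite -(ex_act mu_sum1 k (fun A => F A * H A)) -exN; apply: eq_ex => A.
  by rewrite anti mulNr opprK.
transitivity (ex (fun A => F A * H A) - ex (fun A => F A * H (act k A))).
  by rewrite -exB; apply: eq_ex => A; rewrite /diff mulrBr.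
by rewrite e; ring.
Qed.

Definition second_diff F G : R :=
  \sum_k \sum_l ex (fun A => diff l (diff k F) A ^+ 2 * diff k G A ^+ 2).

Definition abs_diff_prod F G : fn := fun A => \sum_k `|diff k F A| * diff k G A.

(* Swapping coordinate [k] flips the sign of the [k]-th summand, so the cross
   terms only see how each summand reacts to resampling the other coordinate. *)
Lemma ex_abs_diff_prod_sqr F G :
  ex (fun A => abs_diff_prod F G A ^+ 2) <= (second_diff F G + second_diff G F) / 2.
Proof.
pose U k A := `|diff k F A| * diff k G A.
have Uact k A : U k (act k A) = - U k A.
  by rewrite /U !diff_act normrN mulrN.
have eUU k l : ex (fun A => U k A * U l A) =
    ex (fun A => diff l (U k) A * diff k (U l) A) / 4.
  have anti : forall A, diff k (U l) (act l A) = - diff k (U l) A.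
    by move=> A; rewrite /diff actC !Uact; ring.
  have := ex_antisym (U k) anti; have := ex_antisym (U l) (Uact k).
  rewrite (eq_ex _ (G := fun A => diff l (U k) A * diff k (U l) A)
    (F := fun A => diff k (U l) A * diff l (U k) A)); last by move=> A; rewrite mulrC.
  rewrite (eq_ex _ (G := fun A => diff k (U l) A * U k A)
    (F := fun A => U k A * diff k (U l) A)); last by move=> A; rewrite mulrC.
  by move=> -> ->; field.
have eU : ex (fun A => abs_diff_prod F G A ^+ 2) =
    \sum_k \sum_l ex (fun A => U k A * U l A).
  under eq_bigr => k _ do rewrite -ex_sum.
  rewrite -ex_sum; apply: eq_ex => A; rewrite expr2 mulr_suml.
  by apply: eq_bigr => k _; rewrite mulr_sumr.
pose v k l := ex (fun A => diff l (U k) A ^+ 2).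
have le1 k l : ex (fun A => U k A * U l A) <= (v k l + v l k) / 8.
  rewrite eUU; suff : ex (fun A => diff l (U k) A * diff k (U l) A) <= (v k l + v l k) / 2 by lra.
  rewrite /v -exD -exZr; apply: ler_ex => // A.
  have := sqr_ge0 (diff l (U k) A - diff k (U l) A); nra.
have le2 k l : v k l <= 2 * (ex (fun A => diff l (diff k F) A ^+ 2 * diff k G A ^+ 2)
   + ex (fun A => diff l (diff k G) A ^+ 2 * diff k F A ^+ 2)).
  rewrite -(ex_act mu_sum1 l (fun A => diff l (diff k G) A ^+ 2 * diff k F A ^+ 2)).
  rewrite -exD -exZ; apply: ler_ex => // A; rewrite diff_act sqrrN.
  rewrite /U /diff -/(diff k F A) -/(diff k G A) -/(diff k F (act l A)) -/(diff k G (act l A)).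
  set a := diff k F A; set a' := diff k F (act l A).
  set w := diff k G A; set w' := diff k G (act l A).
  have -> : `|a| * w - `|a'| * w' = (`|a| - `|a'|) * w + `|a'| * (w - w') by ring.
  have h1 : (`|a| - `|a'|) ^+ 2 <= (a - a') ^+ 2.
    rewrite -[leRHS]real_normK ?num_real // -[leLHS]real_normK ?num_real //.
    by rewrite lerXn2r ?nnegrE ?normr_ge0 // ler_dist_dist.
  have h2 : `|a'| ^+ 2 = a' ^+ 2 by rewrite real_normK ?num_real.
  have h3 := ler_wpM2r (sqr_ge0 w) h1.
  have := sqr_ge0 ((`|a| - `|a'|) * w - `|a'| * (w - w')).
  move: h3; rewrite -h2; nra.
rewrite eU; apply: le_trans (_ : \sum_k \sum_l (v k l + v l k) / 8 <= _).
  by apply: ler_sum => k _; apply: ler_sum => l _; exact: le1.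
have -> : \sum_k \sum_l (v k l + v l k) / 8 = (\sum_k \sum_l v k l) / 4.
  under eq_bigr => k _ do rewrite -mulr_suml big_split /=.
  by rewrite -mulr_suml big_split /= [X in _ + X]exchange_big /=; field.
have : \sum_k \sum_l v k l <= 2 * (second_diff F G + second_diff G F).
  rewrite /second_diff -big_split /= mulr_sumr; apply: ler_sum => k _.
  by rewrite -big_split /= mulr_sumr; apply: ler_sum => l _; exact: le2.
lra.
Qed.

(** This is the diagonal part [l = k] of [second_diff]: applying [diff k] twice doubles the
    difference. *)
Lemma ex_sqr_diff_prod F G :
  \sum_k ex (fun A => diff k F A ^+ 2 * diff k G A ^+ 2) <= second_diff F G / 4.
Proof.
rewrite /second_diff mulr_suml; apply: ler_sum => k _.
rewrite (bigD1 k) //= mulrDl (eq_ex _ (F := fun A => diff k (diff k F) A ^+ 2 * diff k G A ^+ 2)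
  (G := fun A => 4 * (diff k F A ^+ 2 * diff k G A ^+ 2))); last first.
  by move=> A; rewrite {1}/diff diff_act; ring.
rewrite exZ mulrAC divff ?mul1r ?pnatr_eq0 // lerDl divr_ge0 ?ler0n //.
by apply: sumr_ge0 => l _; apply: ex_ge0 => // A; rewrite mulr_ge0 ?sqr_ge0.
Qed.

Lemma diff_divr k F (c : R) A : diff k (fun A => F A / c) A = diff k F A / c.
Proof. by rewrite /diff mulrBl. Qed.

Lemma norm_le_sqrt (x a : R) : x ^+ 2 <= a -> `|x| <= Num.sqrt a.
Proof.
by move=> xa; rewrite -sqrtr_sqr; apply: ler_wsqrtr.
Qed.

Lemma norm_le_sqrtM (x a c : R) : 0 <= c -> x ^+ 2 <= c ^+ 2 * a ->
  `|x| <= c * Num.sqrt a.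
Proof.
move=> c0 /norm_le_sqrt; rewrite sqrtrM ?sqr_ge0 // sqrtr_sqr.
by rewrite (ger0_norm c0).
Qed.

Definition normalized F : fn := fun A => F A / Num.sqrt (ex (fun A => F A ^+ 2)).

Variables (G X : fn).
Hypothesis stein_id : forall f : R -> R,
  ex (fun A => X A * f (X A)) = (\sum_k ex (fun A => diff k G A * diff k (f \o X) A)) / 2.
Hypothesis X_gt0 : 0 < ex (fun A => X A ^+ 2).

Local Notation s2 := (ex (fun A => X A ^+ 2)).
Local Notation sd := (Num.sqrt s2).
Local Notation V := (diff_prod G X).
Local Notation W := (normalized X).
Local Notation varV := (ex (fun A => (V A - ex V) ^+ 2)).

Lemma ex_diff_prod : ex V = 2 * s2.
Proof.
have := stein_id id; rewrite (eq_ex _ (G := fun A => X A ^+ 2)) => [->|A]; last first.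
  by rewrite expr2.
rewrite mulrC divfK ?pnatr_eq0 // /diff_prod ex_sum.
by apply: eq_bigr => k _; apply: eq_ex.
Qed.

Lemma stein_decomp (f fp : R -> R) :
  ex (fun A => fp (W A) - W A * f (W A)) =
  ex (fun A => fp (W A) * (ex V - V A)) / (2 * s2)
  - (\sum_k ex (fun A => diff k G A *
        (diff k (f \o W) A - diff k W A * fp (W A)))) / (2 * sd).
Proof.
have sd0 : sd != 0 by rewrite gt_eqF // sqrtr_gt0.
have sds : sd ^+ 2 = s2 by rewrite sqr_sqrtr // ltW.
have e1 : ex (fun A => W A * f (W A)) =
    (\sum_k ex (fun A => diff k G A * diff k (f \o W) A)) / (2 * sd).
  rewrite invfM mulrA -(stein_id (fun x => f (x / sd))) -exZr.
  by apply: eq_ex => A; rewrite /normalized mulrAC.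
have e2 : \sum_k ex (fun A => diff k G A * (diff k W A * fp (W A))) =
    ex (fun A => fp (W A) * V A) / sd.
  rewrite -ex_sum -exZr; apply: eq_ex => A.
  rewrite /diff_prod mulr_sumr mulr_suml; apply: eq_bigr => k _.
  by rewrite diff_divr; ring.
have e3 : \sum_k ex (fun A => diff k G A * (diff k (f \o W) A - diff k W A * fp (W A)))
   = \sum_k ex (fun A => diff k G A * diff k (f \o W) A)
     - \sum_k ex (fun A => diff k G A * (diff k W A * fp (W A))).
  by rewrite -sumrB; apply: eq_bigr => k _; rewrite -exB; apply: eq_ex => A; rewrite mulrBr.
rewrite exB e1 e3 e2.
have -> : ex (fun A => fp (W A) * (ex V - V A)) =
   ex (fun A => fp (W A)) * ex V - ex (fun A => fp (W A) * V A).
  by rewrite -exZr -exB; apply: eq_ex => A; rewrite mulrBr.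
rewrite ex_diff_prod; move: sds sd0; set u := sd; set v := s2 => <- u0.
by field.
Qed.

Lemma stein_main_term (fp : R -> R) c : 0 <= c -> (forall x, `|fp x| <= c) ->
  `|ex (fun A => fp (W A) * (ex V - V A)) / (2 * s2)|
  <= c * Num.sqrt varV / (2 * s2).
Proof.
move=> c0 fpc; rewrite normrM [X in _ * X]ger0_norm; last by rewrite invr_ge0 mulr_ge0 ?ltW.
rewrite ler_wpM2r //; first by rewrite invr_ge0 mulr_ge0 ?ltW.
apply: norm_le_sqrtM => //; apply: le_trans (ex_cauchy mu_ge0 _ _) _.
rewrite (eq_ex _ (F := fun A => (ex V - V A) ^+ 2) (G := fun A => (V A - ex V) ^+ 2)); last first.
  by move=> A; ring.
rewrite ler_wpM2r //; first by apply: ex_ge0 => // A; exact: sqr_ge0.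
rewrite -(ex_cst mu_sum1 I (c ^+ 2)); apply: ler_ex => // A.
by rewrite -real_normK ?num_real // lerXn2r ?nnegrE.
Qed.

Lemma stein_kolmogorov (f fp g : R -> R) :
  (forall x, `|fp x| <= 2) -> (forall x, `|g x| <= 2) ->
  (forall a b, `|f a - f b - (a - b) * fp a| <= (a - b) * (g a - g b)) ->
  `|ex (fun A => fp (W A) - W A * f (W A))| <=
  (Num.sqrt varV + 2 * Num.sqrt ((second_diff G X + second_diff X G) / 2)) / s2.
Proof.
move=> fp2 g2 fg; rewrite stein_decomp.
have sd0 : 0 < sd by rewrite sqrtr_gt0.
have sds : sd ^+ 2 = s2 by rewrite sqr_sqrtr // ltW.
apply: le_trans (ler_normB _ _) _; rewrite [leRHS]mulrDl lerD //.
  apply: le_trans (stein_main_term _ fp2) _ => //.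
  by rewrite invfM mulrA [2 * _]mulrC mulfK ?pnatr_eq0.
rewrite normrM [X in _ * X]ger0_norm; last by rewrite invr_ge0 mulr_ge0 ?ltW.
rewrite ler_pdivrMr ?mulr_gt0 //.
(* [|diff k G A| * diff k W A] changes sign under [act k], so [ex_antisym] trades the increment of
   [g \o W] for [2 * g (W A)], and a bound on [g] is enough. For this the factor [diff k W A] has to
   keep its sign. *)
have key : `|\sum_k ex (fun A => diff k G A * (diff k (f \o W) A - diff k W A * fp (W A)))|
   <= (2 / sd) * ex (fun A => abs_diff_prod G X A * g (W A)).
  have -> : (2 / sd) * ex (fun A => abs_diff_prod G X A * g (W A)) =
     \sum_k ex (fun A => `|diff k G A| * diff k W A * diff k (g \o W) A).
    transitivity (\sum_k 2 * ex (fun A => `|diff k G A| * diff k W A * g (W A))).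
      rewrite -mulr_sumr -mulrA; congr (_ * _); rewrite -ex_sum -exZ.
      apply: eq_ex => A; rewrite mulr_suml mulr_sumr; apply: eq_bigr => k _.
      by rewrite diff_divr; ring.
    apply: eq_bigr => k _; rewrite ex_antisym // => A.
    by rewrite !diff_act normrN mulrN.
  apply: le_trans (ler_norm_sum _ _ _) _; apply: ler_sum => k _.
  apply: le_trans (ler_norm_ex mu_ge0 _) _; apply: ler_ex => // A.
  by rewrite normrM -mulrA ler_wpM2l //; exact: fg.
apply: le_trans key _.
have : ex (fun A => abs_diff_prod G X A * g (W A)) <=
    2 * Num.sqrt ((second_diff G X + second_diff X G) / 2).
  apply: le_trans (ler_norm _) _.
  apply: norm_le_sqrtM => //; apply: le_trans (ex_cauchy mu_ge0 _ _) _; rewrite mulrC.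
  apply: ler_pM; try by apply: ex_ge0 => // A; exact: sqr_ge0.
    rewrite -(ex_cst mu_sum1 I (2 ^+ 2)); apply: ler_ex => // A.
    by rewrite -real_normK ?num_real // lerXn2r ?nnegrE.
  exact: ex_abs_diff_prod_sqr.
move=> /(ler_wpM2l (_ : 0 <= 2 / sd)) le1.
apply: le_trans (le1 _) _; first by rewrite divr_ge0 ?ltW.
rewrite le_eqVlt; apply/orP; left; apply/eqP.
by move: sds (gt_eqF sd0) => /=; set u := sd; set v := s2 => <- u0; field; rewrite u0.
Qed.

(** The quadratic remainder leaves a sum of third order. Cauchy-Schwarz over the pairs of [k] and
    [A] splits it into the diagonal part of [second_diff] and the sum of the squared differences of
    [X], which [d] compares with the variance. *)
Lemma stein_wasserstein (f fp : R -> R) c d : 0 <= c -> 0 <= d ->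
  (forall x, `|fp x| <= c) ->
  (forall a b, `|f a - f b - (a - b) * fp a| <= c * (a - b) ^+ 2) ->
  \sum_k ex (fun A => diff k X A ^+ 2) <= d * s2 ->
  `|ex (fun A => fp (W A) - W A * f (W A))| <=
  (c * Num.sqrt varV + c * Num.sqrt (d * second_diff G X / 4)) / (2 * s2).
Proof.
move=> c0 d0 fpc fq dX; rewrite stein_decomp.
have sd0 : 0 < sd by rewrite sqrtr_gt0.
have sds : sd ^+ 2 = s2 by rewrite sqr_sqrtr // ltW.
apply: le_trans (ler_normB _ _) _; rewrite [leRHS]mulrDl lerD //.
  exact: stein_main_term.
rewrite normrM [X in _ * X]ger0_norm; last by rewrite invr_ge0 mulr_ge0 ?ltW.
rewrite ler_pdivrMr ?mulr_gt0 //.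
apply: le_trans (_ : (c / s2) * \sum_k ex (fun A => `|diff k G A| * `|diff k X A| * `|diff k X A|) <= _).
  rewrite mulr_sumr; apply: le_trans (ler_norm_sum _ _ _) _; apply: ler_sum => k _.
  apply: le_trans (ler_norm_ex mu_ge0 _) _; rewrite -exZ; apply: ler_ex => // A.
  rewrite normrM; apply: le_trans (ler_wpM2l (normr_ge0 _) (fq _ _)) _.
  rewrite -/(diff k W A) diff_divr.
  rewrite exprMn exprVn sds -[X in X / s2]real_normK ?num_real //.
  rewrite le_eqVlt; apply/orP; left; apply/eqP; ring.
have : \sum_k ex (fun A => `|diff k G A| * `|diff k X A| * `|diff k X A|) <=
   Num.sqrt (d * second_diff G X / 4) * sd.
  apply: le_trans (ler_norm _) _; rewrite -sqrtrM; last first.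
    rewrite divr_ge0 // mulr_ge0 //; do 2 (apply: sumr_ge0 => ? _).
    by apply: ex_ge0 => // A; rewrite mulr_ge0 ?sqr_ge0.
  apply: norm_le_sqrt.
  have cs := @sum_cauchy R (K * {ffun I -> T})%type (fun u => pw mu u.2)
    (fun u => `|diff u.1 G u.2| * `|diff u.1 X u.2|) (fun u => `|diff u.1 X u.2|)
    (fun u => pw_ge0 mu_ge0 u.2).
  have pairE (g : K -> fn) : \sum_(u : K * {ffun I -> T}) pw mu u.2 * g u.1 u.2
      = \sum_k ex (g k).
    by rewrite -(pair_bigA _ (fun k A => pw mu A * g k A)).
  rewrite (pairE (fun k A => `|diff k G A| * `|diff k X A| * `|diff k X A|)) in cs.
  rewrite (pairE (fun k A => (`|diff k G A| * `|diff k X A|) ^+ 2)) in cs.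
  rewrite (pairE (fun k A => `|diff k X A| ^+ 2)) in cs.
  apply: le_trans (cs) _.
  have -> : d * second_diff G X / 4 * s2 = (second_diff G X / 4) * (d * s2) by ring.
  apply: ler_pM.
  - by do 2 (apply: sumr_ge0 => ? _); rewrite mulr_ge0 ?sqr_ge0 ?pw_ge0.
  - by do 2 (apply: sumr_ge0 => ? _); rewrite mulr_ge0 ?sqr_ge0 ?pw_ge0.
  - apply: le_trans (ex_sqr_diff_prod G X); rewrite le_eqVlt; apply/orP; left; apply/eqP.
    apply: eq_bigr => k _; apply: eq_bigr => A _.
    by rewrite exprMn !real_normK ?num_real.
  apply: le_trans dX; rewrite le_eqVlt; apply/orP; left; apply/eqP.
  by apply: eq_bigr => k _; apply: eq_bigr => A _; rewrite real_normK ?num_real.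
move=> /(ler_wpM2l (_ : 0 <= c / s2)) le1.
apply: le_trans (le1 _) _; first by rewrite divr_ge0 // ltW.
rewrite le_eqVlt; apply/orP; left; apply/eqP; field; by rewrite gt_eqF.
Qed.

End ExchangeablePairs.

(** * The statistic and its Stein solution as forms in the projections *)

Section HoeffdingForms.
Variables (R : rcfType) (T : finType) (mu : T -> R).
Hypotheses (mu_ge0 : forall t, 0 <= mu t) (mu_sum1 : \sum_t mu t = 1).
Local Notation ex := (ex mu).
Local Notation cond := (cond mu).
Variables (K : finType) (r : nat).
Hypothesis K_gt0 : (0 < #|K|)%N.
Local Notation I := (K * bool)%type.
Local Notation fn := ({ffun I -> T} -> R).
Local Notation N := (#|K|%:R : R).
Variable psi : {set I} -> fn.
Hypothesis dep_psi : forall P, dep P (psi P).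
Hypothesis psi_set0 : forall A, psi set0 A = 0.
Hypothesis cond_psi : forall (Z P : {set I}) A,
  (#|P| <= r)%N -> cond Z (psi P) A = psi (Z :&: P) A.
Hypothesis psi_image : forall (f : I -> I) (P : {set I}) A, injective f ->
  (#|P| <= r)%N -> psi [set f i | i in P] A = psi P [ffun i => A (f i)].

Local Notation form := (form psi).
Local Notation Z0 := [set u : I | ~~ u.2].

Lemma mem_base (S : {set K}) k b : ((k, b) \in base S) = (k \in S) && ~~ b.
Proof.
apply/imsetP/andP => [[l lS [-> ->]]//|[kS /negbTE ->]].
by exists k.
Qed.

Lemma card_base (S : {set K}) : #|base S| = #|S|.
Proof. by rewrite card_imset // => ? ? []. Qed.

Lemma base_sub (S : {set K}) : base S \subset Z0.
Proof. by apply/subsetP => -[k b]; rewrite mem_base inE => /andP[]. Qed.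

Definition proj_ex (F : fn) (S : {set K}) : R := ex (fun A => psi (base S) A * F A).

(** Resampling moves [k] to its second copy, which [F] does not read. Conditioning on the first
    copies averages it out, and [cond_psi] drops [k] from the set. *)
Lemma ex_psi_act k (S : {set K}) (F : fn) : (#|S| <= r)%N -> dep Z0 F ->
  ex (fun A => psi (base S) (act k A) * F A) = proj_ex F (S :\ k).
Proof.
move=> Sr FZ; rewrite -(ex_cond mu_sum1 Z0); apply: eq_ex => A.
have finj := inv_inj (@flipK K k).
rewrite (eq_cond _ _ _ (G := fun A => F A * psi [set flip k i | i in base S] A)); last first.
  by move=> C; rewrite psi_image ?card_base // mulrC.
rewrite cond_pull // mulrC cond_psi ?(card_imset _ finj) ?card_base //; congr (psi _ A * _).
apply/setP => -[l b]; rewrite in_setI mem_base inE /= in_setD1.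
case: b; rewrite ?andbF ?andbT //=.
apply/imsetP/andP => [[[j c]]|[lk lS]].
  rewrite mem_base /flip /= => /andP[jS nc]; case: (j =P k) => [_ [-> c0]|/eqP jk [-> _]] //.
  by rewrite -c0 in nc.
by exists (l, false); rewrite ?mem_base ?lS // /flip /= (negbTE lk).
Qed.

Lemma sum_ex_diff (b : {set K} -> R) (F : fn) : dep Z0 F ->
  (forall S : {set K}, (r < #|S|)%N -> b S = 0) ->
  \sum_k ex (fun A => diff k (form b) A * F A) =
  \sum_S b S * \sum_k (proj_ex F S - proj_ex F (S :\ k)).
Proof.
move=> FZ b0.
transitivity (\sum_k \sum_S b S * (proj_ex F S - proj_ex F (S :\ k))); last first.
  by rewrite exchange_big; apply: eq_bigr => S _; rewrite mulr_sumr.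
apply: eq_bigr => k _; rewrite /form diff_sum.
rewrite (eq_ex _ (G := fun A => \sum_S b S * (diff k (psi (base S)) A * F A))); last first.
  by move=> A; rewrite mulr_suml; apply: eq_bigr => S _; rewrite mulrA.
rewrite ex_sum; apply: eq_bigr => S _; rewrite exZ.
have [Sr|/b0 ->] := leqP #|S| r; last by rewrite !mul0r.
congr (_ * _); rewrite -(ex_psi_act k Sr FZ) -exB; apply: eq_ex => A.
by rewrite -mulrBl.
Qed.

(** Summation by parts: the pairs with [k \in S] correspond to the pairs with [k \notin U] through
    [U = S :\ k]. The deletion of points is thereby moved from [m] to the coefficients. *)
Lemma sum_setD1 (b m : {set K} -> R) :
  \sum_S b S * \sum_k (m S - m (S :\ k))
  = \sum_(S : {set K}) (b S * #|S|%:R - \sum_(k | k \notin S) b (k |: S)) * m S.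
Proof.
have e1 (S : {set K}) : \sum_k (m S - m (S :\ k)) = m S *+ #|S| - \sum_(k in S) m (S :\ k).
  rewrite (bigID (mem S)) /= [X in _ + X]big1 ?addr0; last first.
    by move=> k kS; rewrite (setDidPl _) ?subrr // disjoint_sym disjoints1.
  by rewrite sumrB sumr_const.
transitivity (\sum_(S : {set K}) b S * #|S|%:R * m S - \sum_(S : {set K}) \sum_(k in S) b S * m (S :\ k)).
  rewrite -sumrB; apply: eq_bigr => S _; rewrite e1 mulrBr mulr_sumr.
  by rewrite -mulr_natr; congr (_ - _); ring.
have -> : \sum_(S : {set K}) \sum_(k in S) b S * m (S :\ k) =
    \sum_(U : {set K}) (\sum_(k | k \notin U) b (k |: U)) * m U.
  transitivity (\sum_k \sum_(S : {set K} | k \in S) b S * m (S :\ k)).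
    by rewrite (exchange_big_dep predT).
  transitivity (\sum_k \sum_(U : {set K} | k \notin U) b (k |: U) * m U).
    apply: eq_bigr => k _; rewrite (reindex_onto (fun U => k |: U) (fun S => S :\ k)) /=.
      apply: eq_big => [U|U /andP[_ /eqP ->]] //.
      rewrite setU11 /=; apply/eqP/idP => [<-|kU]; first by rewrite setD11.
      by rewrite setU1K.
    by move=> S kS; rewrite setD1K.
  by rewrite (exchange_big_dep predT) //=; apply: eq_bigr => U _; rewrite mulr_suml.
by rewrite -sumrB; apply: eq_bigr => S _; rewrite mulrBl.
Qed.

Definition top_coef (S : {set K}) : R := (#|S| == r)%:R.

(* Coefficients of the form [G] that solves [\sum_k (G - E_k G) = X], where [E_k]
   integrates out the [k]-th coordinate and [X] has coefficients [top_coef]. *)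
Definition inv_coef (S : {set K}) : R :=
  if (#|S| <= r)%N then
    ((#|K| - #|S|) ^_ (r - #|S|) * (#|S|.-1)`!)%:R / (r`!)%:R else 0.

(** For a coefficient [b_j] that depends only on [j = #|S|] the equation reads [j * b_j - (#|K| - j)
    * b_(j+1) = (j == r)]. Starting from [b_r = 1 / r] and descending produces the falling factorial
    and [(j - 1)!]. The recursion stops before [j = 0], where [psi] vanishes. *)
Lemma inv_coefP (S : {set K}) : (0 < #|S|)%N ->
  inv_coef S * #|S|%:R - \sum_(k | k \notin S) inv_coef (k |: S) = top_coef S.
Proof.
move=> S0.
have fr : (r`!)%:R != 0 :> R by rewrite pnatr_eq0 -lt0n fact_gt0.
have cS k : k \notin S -> #|k |: S| = #|S|.+1 by move=> kS; rewrite cardsU1 kS.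
have -> : \sum_(k | k \notin S) inv_coef (k |: S) =
   (#|K| - #|S|)%:R * (if (#|S|.+1 <= r)%N then
    ((#|K| - #|S|.+1) ^_ (r - #|S|.+1) * (#|S|)`!)%:R / (r`!)%:R else 0).
  rewrite (eq_bigr (fun=> if (#|S|.+1 <= r)%N then
    ((#|K| - #|S|.+1) ^_ (r - #|S|.+1) * (#|S|)`!)%:R / (r`!)%:R else 0)).
    rewrite sumr_const -[LHS]mulr_natl; congr (_ * _); congr (_%:R).
    by rewrite -(cardsC S) addKn; apply: eq_card => k; rewrite !inE.
  by move=> k kS; rewrite /inv_coef cS.
rewrite /inv_coef /top_coef; move: S0 {cS}; case: #|S| => // j _.
case: (ltngtP j.+1 r) => [lt|gt|eq].
- rewrite -(subnSK lt) ffactnS -subnS factS /= !natrM; ring.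
- by rewrite mul0r mulr0 subrr.
- by rewrite mulr0 subr0 -eq subnn ffactn0 mul1n mulrAC -natrM mulnC -factS divff // eq.
Qed.

Lemma top_admissible : admissible r top_coef.
Proof.
move=> S; split; first by rewrite ler0n.
rewrite /top_coef; case: ltngtP => [lt|gt|->]; rewrite ?mul0r ?mul1r //.
Qed.

Lemma inv_admissible : admissible r inv_coef.
Proof.
move=> S; rewrite /inv_coef; split.
  by case: ifP => // _; rewrite divr_ge0.
case: (leqP #|S| r) => [Sr|_]; last by rewrite eqxx.
rewrite -[r in X in _ <= X](subnK Sr) exprD ler_wpM2r ?exprn_ge0 //.
rewrite ler_pdivrMr ?ltr0n ?fact_gt0 // natrM -natrX -!natrM ler_nat leq_mul //.
  by rewrite leq_ffact_exp // leq_subr.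
by rewrite leq_fact // (leq_trans (leq_pred _)).
Qed.

Lemma dep_form b : dep Z0 (form b).
Proof.
move=> A A' AA'; apply: eq_bigr => S _; congr (_ * _); apply: dep_psi => u uS.
by apply: AA'; apply: (subsetP (base_sub S)).
Qed.

Lemma ex_form b (F : fn) :
  ex (fun A => form b A * F A) = \sum_S b S * proj_ex F S.
Proof.
rewrite (eq_ex _ (G := fun A => \sum_S b S * (psi (base S) A * F A))); last first.
  by move=> A; rewrite mulr_suml; apply: eq_bigr => S _; rewrite mulrA.
by rewrite ex_sum; apply: eq_bigr => S _; rewrite exZ.
Qed.

Lemma base0 : base (set0 : {set K}) = set0.
Proof. by rewrite /base imset0. Qed.

(** [ex_antisym] removes the difference on [f]. What remains reads [f] through first copies only, so
    [sum_ex_diff] and [sum_setD1] reduce the identity to the equation [inv_coefP] for the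
    coefficients. *)
Lemma stein_form (f : R -> R) :
  ex (fun A => form top_coef A * f (form top_coef A)) =
  (\sum_k ex (fun A => diff k (form inv_coef) A * diff k (f \o form top_coef) A)) / 2.
Proof.
have -> : \sum_k ex (fun A => diff k (form inv_coef) A * diff k (f \o form top_coef) A)
  = 2 * \sum_k ex (fun A => diff k (form inv_coef) A * (f \o form top_coef) A).
  rewrite mulr_sumr; apply: eq_bigr => k _; apply: ex_antisym => // A.
  exact: diff_act.
rewrite mulrAC divff ?mul1r ?pnatr_eq0 // sum_ex_diff; first last.
- by move=> S; rewrite ltnNge /inv_coef => /negbTE ->.
- by move=> A A' AA'; rewrite /= (dep_form _ AA').
rewrite sum_setD1 (ex_form _ (f \o form top_coef)); apply: eq_bigr => S _.
have [->|S0] := eqVneq S set0.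
  suff -> : proj_ex (f \o form top_coef) set0 = 0 by rewrite !mulr0.
  rewrite /proj_ex base0 (eq_ex _ (G := fun=> 0)) ?ex_cst // => A.
  by rewrite psi_set0 mul0r.
by rewrite inv_coefP // card_gt0.
Qed.

Lemma ex_psi_psi (P Q : {set I}) : (#|P| <= r)%N -> (#|Q| <= r)%N ->
  ex (fun A => psi P A * psi Q A) = ex (fun A => psi (P :&: Q) A ^+ 2).
Proof.
move=> Pr Qr; have PQr : (#|P :&: Q| <= r)%N by rewrite (leq_trans _ Pr) // subset_leq_card ?subsetIl.
rewrite -(ex_cond mu_sum1 P) [LHS](eq_ex _ (G := fun A => psi (P :&: Q) A * psi P A)); last first.
  by move=> A; rewrite cond_pull // cond_psi // mulrC.
rewrite -[LHS](ex_cond mu_sum1 (P :&: Q)); apply: eq_ex => A.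
by rewrite cond_pull // cond_psi // setIAC setIid expr2.
Qed.

Lemma proj_top_ge0 (S : {set K}) : (#|S| <= r)%N -> 0 <= proj_ex (form top_coef) S.
Proof.
move=> Sr; rewrite /proj_ex (eq_ex _ (G := fun A => form top_coef A * psi (base S) A)); last first.
  by move=> A; rewrite mulrC.
rewrite ex_form; apply: sumr_ge0 => U _; rewrite /top_coef.
have [Ur|] := eqVneq #|U| r; last by rewrite mul0r.
rewrite mul1r /proj_ex ex_psi_psi ?card_base ?Ur //.
by apply: ex_ge0 => // A; exact: sqr_ge0.
Qed.

Lemma sum_ex_sqr_diff :
  \sum_k ex (fun A => diff k (form top_coef) A ^+ 2)
  <= (2 * r)%:R * ex (fun A => form top_coef A ^+ 2).
Proof.
set X := form top_coef.
have -> : \sum_k ex (fun A => diff k X A ^+ 2) = 2 * \sum_k ex (fun A => diff k X A * X A).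
  rewrite mulr_sumr; apply: eq_bigr => k _.
  by rewrite -(ex_antisym mu_sum1 X (diff_act k X)); apply: eq_ex => A; rewrite expr2.
rewrite natrM -mulrA ler_wpM2l ?ler0n // sum_ex_diff; first last.
- by move=> S; rewrite /top_coef; case: ltngtP.
- exact: dep_form.
rewrite (eq_ex _ (F := fun A => X A ^+ 2) (G := fun A => X A * X A)); last first.
  by move=> A; rewrite expr2.
rewrite ex_form mulr_sumr; apply: ler_sum => S _; rewrite /top_coef.
have [Sr|] := eqVneq #|S| r; last by rewrite !mul0r mulr0.
rewrite !mul1r (bigID (mem S)) /= [X in _ + X]big1 ?addr0; last first.
  by move=> k kS; rewrite (setDidPl _) ?subrr // disjoint_sym disjoints1.
rewrite sumrB sumr_const Sr -[_ S *+ r]mulr_natl lerBlDr lerDl; apply: sumr_ge0 => k kS.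
by apply: proj_top_ge0; rewrite -Sr subset_leq_card ?subD1set.
Qed.

End HoeffdingForms.

(** * Increasing index maps and [r]-subsets *)

Section IncreasingMaps.
Variables (r n : nat).

Definition increasing (k : {ffun 'I_r -> 'I_n}) : bool :=
  [forall i : 'I_r, forall j : 'I_r, (i < j)%N ==> (k i < k j)%N].

Lemma increasing_inj k : increasing k -> injective k.
Proof.
move=> /forallP kinc i j kij; apply: val_inj; case: (ltngtP i j) => // ij.
  by have /forallP/(_ j)/implyP/(_ ij) := kinc i; rewrite kij ltnn.
by have /forallP/(_ i)/implyP/(_ ij) := kinc j; rewrite kij ltnn.
Qed.

(** The only increasing map with image [S] is the enumeration of [S], which lists ordinals in
    increasing order. *)
Lemma sum_increasing (R : nmodType) (F : {ffun 'I_r -> 'I_n} -> R) (G : {set 'I_n} -> R) :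
  (forall k, increasing k -> F k = G [set k i | i : 'I_r]) ->
  \sum_(k | increasing k) F k = \sum_(S : {set 'I_n} | #|S| == r) G S.
Proof.
move=> FG; rewrite (partition_big (fun k : {ffun 'I_r -> 'I_n} => [set k i | i : 'I_r])
  (fun S : {set 'I_n} => #|S| == r)) /=; last first.
  by move=> k /increasing_inj kinj; rewrite card_imset // card_ord.
apply: eq_bigr => S /eqP Sr.
have szS : size (enum S) = r by rewrite -cardE.
have ltS (i : 'I_r) : (i < size (enum S))%N by rewrite szS.
pose k0 : {ffun 'I_r -> 'I_n} := [ffun i => enum_val (cast_ord (esym Sr) i)].
have ltn_trans' : transitive (fun x y : 'I_n => (x < y)%N) by move=> x y z; exact: ltn_trans.
have sortS : sorted (fun x y : 'I_n => (x < y)%N) (enum S).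
  rewrite /enum_mem; apply: sorted_filter => //.
  have := iota_ltn_sorted 0 n; rewrite -val_enum_ord sorted_map.
  by rewrite enumT.
rewrite (big_pred1 k0) => [|k] /=.
  rewrite FG; last first.
    apply/forallP => i; apply/forallP => j; apply/implyP => ij; rewrite !ffunE.
    have x0 : 'I_n := enum_val (cast_ord (esym Sr) i).
    rewrite !(enum_val_nth x0) /=.
    by apply: (sorted_ltn_nth ltn_trans' x0 sortS) => //; rewrite inE.
  congr G; apply/setP => x; apply/imsetP/idP => [[i _ ->]|xS].
    by rewrite ffunE; exact: enum_valP.
  exists (cast_ord Sr (enum_rank_in xS x)) => //.
  by rewrite ffunE cast_ordK enum_rankK_in.
apply/andP/eqP => [[kinc /eqP kS]|->].
  have sortk : sorted (fun x y : 'I_n => (x < y)%N) (codom k).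
    rewrite sorted_map.
    have := iota_ltn_sorted 0 r; rewrite -val_enum_ord sorted_map.
    apply: sub_sorted => i j /= ij.
    by have /forallP/(_ i)/forallP/(_ j)/implyP/(_ ij) := kinc.
  have codE : codom k = enum S.
    apply: (irr_sorted_eq ltn_trans') => //; first by move=> x; rewrite /= ltnn.
    by move=> x; rewrite mem_enum -kS; apply/codomP/imsetP => [[i ->]|[i _ ->]]; exists i.
  apply/ffunP => i; rewrite ffunE (enum_val_nth (k i)) /= -codE.
  by rewrite (nth_codom_ord (k i) k (ltn_ord i)); congr (k _); apply: val_inj.
split.
  apply/forallP => i; apply/forallP => j; apply/implyP => ij; rewrite !ffunE.
  have x0 : 'I_n := enum_val (cast_ord (esym Sr) i).
  rewrite !(enum_val_nth x0) /=.
  by apply: (sorted_ltn_nth ltn_trans' x0 sortS) => //; rewrite inE.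
apply/eqP/setP => x; apply/imsetP/idP => [[i _ ->]|xS].
  by rewrite ffunE; exact: enum_valP.
exists (cast_ord Sr (enum_rank_in xS x)) => //.
by rewrite ffunE cast_ordK enum_rankK_in.
Qed.

End IncreasingMaps.

(** * Application to the attribute vectors *)

Section UStatistic.
Variables (R : realType) (r n m : nat) (p : R) (h : {ffun 'I_r -> attr m} -> R).
Hypotheses (p01 : 0 < p < 1) (hsym : symmetric_fun h).
Hypotheses (n_gt0 : (0 < n)%N) (rn : (r <= n)%N).
Local Notation K := 'I_n.
Local Notation I := (K * bool)%type.
Local Notation ex := (ex (mu_mp p)).
Local Notation psi := (@psi R m r p h I).
Local Notation Xf := (form psi (top_coef R r)).
Local Notation Gf := (form psi (inv_coef R r)).
Local Notation B := (bracket p h n).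
Local Notation X := (Ustat h : {ffun K -> attr m} -> R).

Let mu0 := @mu_mp_ge0 R m p p01.
Let mu1 := @mu_mp_sum1 R m p.
Let i0 : I := (Ordinal n_gt0, false).
Let rI : (r <= #|{: I}|)%N.
Proof. by rewrite card_prod card_ord card_bool muln2 -addnn (leq_trans rn) // leq_addr. Qed.

Let dpsi := @dep_psi R m r p h I.
Let psi0 A := @psi_set0 R m r p h hsym I i0 rI A.
Let cpsi := @cond_psi R m r p h hsym I i0 rI.
Let ipsi := @psi_image R m r p h hsym I.

Definition restr (A : {ffun I -> attr m}) : {ffun K -> attr m} := [ffun k => A (k, false)].

(** The sample space of the statement is the marginal of the doubled one on the first copies. *)
Lemma Expect_ex (Y : {ffun K -> attr m} -> R) :
  Expect p Y = ex (fun A => Y (restr A)).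
Proof.
have einj : injective (fun k : K => (k, false)) by move=> ? ? [].
exact: esym (ex_reindex mu1 Y einj).
Qed.

Lemma Ustat_form : exists c, forall A, Ustat h (restr A) = Xf A + c.
Proof.
pose c := \sum_(x : {ffun 'I_r -> attr m}) muprod p x * hproj p h x.
exists (\sum_(S : {set K} | #|S| == r) c) => A.
rewrite /form (bigID (fun S : {set K} => #|S| == r)) /= [X in _ + X + _]big1 ?addr0; last first.
  by move=> S /negbTE Sr; rewrite /top_coef Sr mul0r.
rewrite -big_split /=; apply: sum_increasing => k kinc.
have kinj := increasing_inj kinc; set S := [set k i | i : 'I_r]%SET.
have Sr : #|S| = r by rewrite card_imset // card_ord.
rewrite /top_coef Sr eqxx mul1r -psi_top ?card_base //.
transitivity (hseq h [seq A (k i, false) | i <- enum 'I_r]).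
  congr h; apply/ffunP => i; rewrite !ffunE (nth_map i) ?size_enum_ord //.
  by rewrite nth_ord_enum.
apply: (hseq_perm hsym); first by rewrite size_map -cardE card_base.
rewrite (map_comp A (fun i => (k i, false))); apply: perm_map.
have kinj' : injective (fun i => (k i, false)) by move=> i j [] /kinj.
apply: uniq_perm; [by rewrite (map_inj_uniq kinj') enum_uniq|exact: enum_uniq|].
move=> [l b]; rewrite mem_enum mem_base.
apply/mapP/andP => [[i _ [-> ->]]|[/imsetP[i _ ->] /negbTE ->]].
  by split => //; apply/imsetP; exists i.
by exists i; rewrite ?mem_enum.
Qed.

Lemma ex_top_form : ex Xf = 0.
Proof.
rewrite /form ex_sum big1 // => S _; rewrite exZ.
have [Sr|] := eqVneq #|S| r; last by move=> /negbTE Sr; rewrite /top_coef Sr mul0r.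
by rewrite ex_psi ?mulr0 // card_base Sr.
Qed.

Lemma Ustat_centered A : X (restr A) - Expect p X = Xf A.
Proof.
have [c UE] := Ustat_form; rewrite Expect_ex UE (eq_ex _ UE) exD ex_top_form ex_cst // add0r.
by rewrite addrK.
Qed.

Lemma Variance_form : Variance p X = ex (fun A => Xf A ^+ 2).
Proof.
by rewrite /Variance Expect_ex; apply: eq_ex => A; rewrite Ustat_centered.
Qed.

Hypothesis var_gt0 : 0 < Variance p X.

Local Notation s2 := (ex (fun A => Xf A ^+ 2)).
Local Notation V := (diff_prod Gf Xf).
Local Notation scale := (B * ((n%:R ^+ r) ^+ 4) : R).

Let s2_gt0 : 0 < s2. Proof. by rewrite -Variance_form. Qed.
Let K_gt0 : (0 < #|K|)%N. Proof. by rewrite card_ord. Qed.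
Let N_ge1 : 1 <= #|K|%:R :> R. Proof. by rewrite ler1n. Qed.
Let B_ge0 : 0 <= bracket p h #|K|.
Proof. exact: bracket_ge0. Qed.

Let sqr_b := @cond_sqr_bound R m r p h p01 hsym I i0 rI #|K| K_gt0.
Let two_b := @cond_two_bound R m r p h p01 hsym I i0 #|K| K_gt0.
Let sub_b := @cond_sub_bound R m r p h p01 hsym I i0 #|K| K_gt0.

Let mom_b (P1 P2 P3 P4 : {set I}) p1 p2 p3 p4 n12 n34 nZ :=
  @ex_four_proj _ _ _ mu0 mu1 I psi r _ _ B_ge0 N_ge1 dpsi psi0 cpsi sqr_b two_b sub_b
    K fst P1 P2 P3 P4 p1 p2 p3 p4 n12 n34 nZ.
Let cov_b (P1 P2 P3 P4 : {set I}) p1 p2 p3 p4 n12 n34 :=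
  @ex_cov_proj _ _ _ mu0 mu1 I psi r _ _ B_ge0 N_ge1 dpsi psi0 cpsi sqr_b two_b sub_b
    K fst P1 P2 P3 P4 p1 p2 p3 p4 n12 n34.

Let topA := @top_admissible R K r.
Let invA := @inv_admissible R K r.

Lemma second_diff_Gf : second_diff (mu_mp p) Gf Xf <= 64 * scale * total_const R r.
Proof.
have := fourth_diff_bound dpsi ipsi K_gt0 B_ge0 mom_b invA topA.
by rewrite card_ord.
Qed.

Lemma second_diff_Xf : second_diff (mu_mp p) Xf Gf <= 64 * scale * total_const R r.
Proof.
have := fourth_diff_bound dpsi ipsi K_gt0 B_ge0 mom_b topA invA.
by rewrite card_ord.
Qed.

Lemma var_diff_prod : ex (fun A => (V A - ex V) ^+ 2) <= 32 * scale * total_const R r.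
Proof.
have := var_diff_bound mu1 dpsi ipsi K_gt0 B_ge0 cov_b invA topA.
rewrite card_ord => /le_trans; apply; rewrite le_eqVlt; apply/orP; left; apply/eqP; ring.
Qed.

Let stein_id (f : R -> R) := stein_form mu1 dpsi psi0 cpsi ipsi f.

Lemma scale_sqrt c : 0 <= c ->
  Num.sqrt (c * scale) = Num.sqrt c * (n%:R ^+ (2 * r) * Num.sqrt B).
Proof.
move=> c0; rewrite sqrtrM // [B * _]mulrC sqrtrM ?exprn_ge0 //; congr (_ * (_ * _)).
by rewrite -!exprM (_ : r * 4 = 2 * r * 2)%N ?exprM ?sqrtr_sqr ?ger0_norm ?exprn_ge0 //; lia.
Qed.

Lemma le_scale_sqrt x c : 0 <= c -> x <= c * scale * total_const R r ->
  Num.sqrt x <= Num.sqrt (c * total_const R r) * (n%:R ^+ (2 * r) * Num.sqrt B).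
Proof.
move=> c0 xc; have t0 : 0 <= total_const R r by rewrite /total_const !mulr_ge0 ?exprn_ge0.
by rewrite -scale_sqrt ?mulr_ge0 // ler_wsqrtr // mulrAC.
Qed.

Definition std (A : {ffun K -> attr m}) : R :=
  (X A - Expect p X) / Num.sqrt (Variance p X).

Lemma std_normalized A : std (restr A) = normalized (mu_mp p) Xf A.
Proof. by rewrite /std Ustat_centered Variance_form. Qed.

Definition kolm_const : R :=
  Num.sqrt (32 * total_const R r) + 2 * Num.sqrt (64 * total_const R r).

Lemma dK_bound : (dK_normal p std <=
  (kolm_const * (n%:R ^+ (2 * r) * Num.sqrt B) / Variance p X)%:E)%E.
Proof.
apply: ub_ereal_sup => _ [t _ <-].
have [f [fp [g [fpE fp2 g2 fg]]]] := stein_solution_ind t.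
have -> : Prob p (fun A => std A <= t) = ex (fun A => (normalized (mu_mp p) Xf A <= t)%R%:R).
  transitivity (Expect p (fun A : {ffun K -> attr m} => (std A <= t)%R%:R)).
    rewrite /Prob /Expect big_mkcond; apply: eq_bigr => A _.
    by case: ifP => _; rewrite ?mulr1 ?mulr0.
  by rewrite Expect_ex; apply: eq_ex => A; rewrite std_normalized.
rewrite normal_prob_itv -EFinB /= lee_fin.
rewrite -(ex_cst mu1 I (Phi01 t)) -exB.
rewrite (eq_ex _ (G := fun A => fp (normalized (mu_mp p) Xf A)
  - normalized (mu_mp p) Xf A * f (normalized (mu_mp p) Xf A))); last by move=> A; rewrite fpE.
apply: le_trans (stein_kolmogorov mu0 mu1 stein_id s2_gt0 fp2 g2 fg) _.
rewrite Variance_form ler_wpM2r ?invr_ge0 ?(ltW s2_gt0) // /kolm_const [leRHS]mulrDl lerD //.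
  by apply: le_scale_sqrt => //; exact: var_diff_prod.
rewrite -mulrA ler_wpM2l //; apply: le_scale_sqrt => //.
have := second_diff_Gf; have := second_diff_Xf; lra.
Qed.

Lemma dW_bound c : 0 <= c ->
  (forall phi : R -> R, (forall x y, `|phi x - phi y| <= `|x - y|) ->
    exists f fp : R -> R,
    [/\ forall w, fp w - w * f w = phi w - normal_mean phi, forall w, `|fp w| <= c
      & forall a b, `|f a - f b - (a - b) * fp a| <= c * (a - b) ^+ 2]) ->
  (dW_normal p std <=
  (c * (Num.sqrt (32 * total_const R r) + Num.sqrt (32 * r%:R * total_const R r))
     * (n%:R ^+ (2 * r) * Num.sqrt B) / Variance p X)%:E)%E.
Proof.
move=> c0 sol; apply: ub_ereal_sup => _ [phi lip <-].
have [f [fp [fpE fpc fq]]] := sol phi lip.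
rewrite integral_lip // -EFinB /= lee_fin Expect_ex -(ex_cst mu1 I (normal_mean phi)) -exB.
rewrite (eq_ex _ (G := fun A => fp (normalized (mu_mp p) Xf A)
  - normalized (mu_mp p) Xf A * f (normalized (mu_mp p) Xf A))); last first.
  by move=> A; rewrite std_normalized fpE.
have dX := sum_ex_sqr_diff mu0 mu1 dpsi cpsi ipsi.
apply: le_trans (stein_wasserstein mu0 mu1 stein_id s2_gt0 c0 (ler0n R (2 * r)) fpc fq dX) _.
rewrite Variance_form invfM mulrA ler_wpM2r ?invr_ge0 ?(ltW s2_gt0) //.
have h1 := le_scale_sqrt (ler0n R 32) var_diff_prod.
(* The 32 is [2 * 64 / 4]: [2 * r] from [sum_ex_sqr_diff], 64 from [second_diff_Gf], and 4 from the
   diagonal in [ex_sqr_diff_prod]. *)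
have h2 : Num.sqrt ((2 * r)%:R * second_diff (mu_mp p) Gf Xf / 4) <=
  Num.sqrt (32 * r%:R * total_const R r) * (n%:R ^+ (2 * r) * Num.sqrt B).
  apply: le_scale_sqrt; first by rewrite mulr_ge0.
  have := ler_wpM2l (ler0n R r) second_diff_Gf; rewrite natrM; lra.
have T0 : 0 <= n%:R ^+ (2 * r) * Num.sqrt B by rewrite mulr_ge0 ?exprn_ge0 ?sqrtr_ge0.
have a0 := mulr_ge0 (sqrtr_ge0 (32 * total_const R r)) T0.
have b0 := mulr_ge0 (sqrtr_ge0 (32 * r%:R * total_const R r)) T0.
have b := ler_wpM2l c0 (lerD h1 h2); have q := mulr_ge0 c0 (addr_ge0 a0 b0).
rewrite -mulrDl [leRHS]mulrA in b; rewrite -mulrDl mulrA in q.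
by rewrite -mulrDr; lra.
Qed.

End UStatistic.

Lemma Variance_cst (R : realType) m n (p c : R) (X : {ffun 'I_n -> attr m} -> R) :
  (forall A, X A = c) -> Variance p X = 0.
Proof.
move=> Xc.
have exc (Y : {ffun 'I_n -> attr m} -> R) d : (forall A, Y A = d) -> Expect p Y = d.
  move=> Yd; rewrite -[RHS](ex_cst (@mu_mp_sum1 R m p) 'I_n d).
  by apply: eq_bigr => A _; rewrite Yd.
by apply: (exc) => A; rewrite Xc (exc _ c) // subrr expr2 mulr0.
Qed.

(** For [n = 0] the sample space is a single point, and for [n < r] there is no increasing index
    map. Either way the statistic is constant. *)
Lemma Variance_Ustat_gt0 (R : realType) r m n (p : R) (h : {ffun 'I_r -> attr m} -> R) :
  0 < Variance p (Ustat h : {ffun 'I_n -> attr m} -> R) -> (0 < n)%N /\ (r <= n)%N.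
Proof.
move=> var_gt0; split.
  case: n var_gt0 => // var_gt0; pose A0 : {ffun 'I_0 -> attr m} := [ffun => [ffun => false]].
  have Uc (A : {ffun 'I_0 -> attr m}) : Ustat h A = Ustat h A0.
    by congr (Ustat h _); apply/ffunP => -[].
  by rewrite (Variance_cst p Uc) ltxx in var_gt0.
rewrite leqNgt; apply/negP => nr.
suff U0 (A : {ffun 'I_n -> attr m}) : Ustat h A = 0.
  by rewrite (Variance_cst p U0) ltxx in var_gt0.
rewrite /Ustat big1 // => k /increasing_inj kinj.
by have := leq_card k kinj; rewrite !card_ord leqNgt nr.
Qed.

Unset Implicit Arguments.
Set Strict Implicit.
Set Printing Implicit Defensive.

Theorem theorem2p1 (R : realType) (r : nat) :
  exists C : R, 0 < C /\
  forall (n m : nat) (p : R) (h : {ffun 'I_r -> attr m} -> R),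
    0 < p < 1 ->
    symmetric_fun h ->
    let X : {ffun 'I_n -> attr m} -> R := Ustat h in
    0 < Variance p X ->
    (dKW_normal p (fun A => (X A - Expect p X) / Num.sqrt (Variance p X))%R
     <= ((C * (n%:R) ^+ (2 * r) / Variance p X *
         Num.sqrt (
           \sum_(j < r.+1) \sum_(i < j)
              contr_norm2 p i j (@hbar _ _ p _ h j) (@hbar _ _ p _ h j) / (n%:R) ^+ (3 * j - i)
         + \sum_(j < r.+1) \sum_(i < j | (1 <= i)%N)
              (contr_norm2 p i i (@hbar _ _ p _ h j) (@hbar _ _ p _ h j) / (n%:R) ^+ (2 * j)
               + contr_norm2 p i i (@hbar _ _ p _ h j) (@hbar _ _ p _ h i) / (n%:R) ^+ (j + i))
         )))%R%:E)%E.
Proof.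
have [c c0 sol] := stein_solution_lip R.
pose cK := kolm_const R r.
pose cW : R := c * (Num.sqrt (32 * total_const R r) + Num.sqrt (32 * r%:R * total_const R r)).
have cK0 : 0 <= cK by rewrite addr_ge0 ?mulr_ge0 ?sqrtr_ge0.
have cW0 : 0 <= cW by rewrite mulr_ge0 ?addr_ge0 ?sqrtr_ge0.
(* The added 1 makes the constant positive even when the other terms vanish. *)
exists (cK + cW + 1); split=> [|n m p h p01 hsym X var_gt0]; first by lra.
have [n_gt0 rn] := Variance_Ustat_gt0 var_gt0.
rewrite -/(bracket p h n).
have bound d : 0 <= d -> d <= cK + cW + 1 ->
    ((d * (n%:R ^+ (2 * r) * Num.sqrt (bracket p h n)) / Variance p X)%:E <=
    ((cK + cW + 1) * n%:R ^+ (2 * r) / Variance p X * Num.sqrt (bracket p h n))%:E)%E.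
  move=> d0 dC; rewrite lee_fin -!mulrA [_^-1 * _]mulrC !mulrA.
  rewrite ler_wpM2r ?invr_ge0 ?(ltW var_gt0) // ler_wpM2r ?sqrtr_ge0 //.
  by rewrite ler_wpM2r ?exprn_ge0.
rewrite /dKW_normal ge_max; apply/andP; split.
  by apply: le_trans (dK_bound p01 hsym n_gt0 rn var_gt0) (bound cK _ _) => //; lra.
by apply: le_trans (dW_bound p01 hsym n_gt0 rn var_gt0 c0 sol) (bound cW _ _) => //; lra.
Qed.
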